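(* Let $m,n\ge1$, let $q_1,\dots,q_n$ be monomials in $\mathbb{C}\langle X_1,\dots,X_m\rangle$ and $V_t=\sum_{i=1}^n t_i(q_i+q_i^* )$ for $t\in\mathbb{R}^n$. Let $a<1$ and let $U_a$ be the set of $t\in\mathbb{R}^n$ for which $V_t$ is convex in the sense that, for all $N\in\mathbb{N}$, the function $(A_1,\dots,A_m)\mapsto \mathrm{tr}(V_t(A_1,\dots,A_m))+\frac a2\sum_{k=1}^m\mathrm{tr}(A_k^2)$ of the real entries of $(A_1,\dots,A_m)\in\mathcal{H}_N^m$ is convex. Then there exists $\epsilon>0$ such that for all $t\in U_a\cap B(0,\epsilon)$, $\mu^N_{V_t}[\hat\mu^N_{\mathbf A}]$ converges as $N\to\infty$ to $\tau_t$ (that is, $\int\hat\mu^N_{\mathbf A}(P)\,d\mu^N_{V_t}(\mathbf A)\to\tau_t(P)$ for all $P\in\mathbb{C}\langle X_1,\dots,X_m\rangle$), where $\tau_t$ is the unique solution of $\mathbf{SD}[V_t]$ satisfying, for some fixed $R>2$, $|\tau_t(X_{i_1}\cdots X_{i_p})|\le R^p$ for all $p$ and all $i_1,\dots,i_p\in\{1,\dots,m\}$.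
   Context: **Non-commutative polynomials.** $\mathbb{C}\langle X_1,\dots,X_m\rangle$ is the algebra of polynomials in $m$ self-adjoint non-commutative variables, with involution $(zX_{i_1}\cdots X_{i_p})^*=\bar z X_{i_p}\cdots X_{i_1}$. $D_i$ and $\mathcal{D}_i$ are the linear maps given on monomials by $D_iP=\sum_{P=P_1X_iP_2}P_1\otimes P_2$ and $\mathcal{D}_iP=\sum_{P=P_1X_iP_2}P_2P_1$. **Schwinger–Dyson equation.** A linear form $\tau$ on $\mathbb{C}\langle X_1,\dots,X_m\rangle$ with $\tau(a^* )=\overline{\tau(a)}$ satisfies $\mathbf{SD}[V]$ if $\tau(1)=1$ and $\tau\otimes\tau(D_iP)=\tau((\mathcal{D}_iV+X_i)P)$ for all $i\in\{1,\dots,m\}$ and all $P$. For fixed $R>2$ and $|t|$ small enough there is a unique solution $\tau_t$ of $\mathbf{SD}[V_t]$ with $|\tau_t(X_{i_1}\cdots X_{i_p})|\le R^p$ for all $p$ and all indices. **Matrix model.** $\mathcal{H}_N$ is the set of $N\times N$ Hermitian matrices, $\mathrm{tr}$ the unnormalized trace, $\mu_N$ the GUE law on $\mathcal{H}_N$, $\mu_N(dA)=Z_N^{-1}e^{-\frac N2\mathrm{tr}(A^2)}dA$ with $dA$ Lebesgue measure on the real entries. $Z^N_V=\int e^{-N\mathrm{tr}(V(A_1,\dots,A_m))}\prod_{i}\mu_N(dA_i)$ and $\mu^N_V(dA_1,\dots,dA_m)=(Z_V^N)^{-1}e^{-N\mathrm{tr}(V(A_1,\dots,A_m))}\prod_i\mu_N(dA_i)$.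 The empirical distribution is $\hat\mu^N_{\mathbf A}(P)=\frac1N\mathrm{tr}(P(A_1,\dots,A_m))$, and $\mu^N_V[\hat\mu^N_{\mathbf A}]$ is its expectation under $\mu_V^N$. $B(0,\epsilon)=\{t\in\mathbb{R}^n:|t|\le\epsilon\}$ with $|t|=\max_i|t_i|$. *)

(* Defs.v *)
From HB Require Import structures.
From mathcomp Require Import all_boot all_order all_algebra.
From mathcomp Require Import finmap complex.
(* The notations of monalg clash with those of MathComp-Analysis. *)
From mathcomp Require Import -(notations) monalg.
From mathcomp Require Import all_classical all_reals all_analysis.
From mathcomp Require Import measurable_realfun.

Set Implicit Arguments.
Unset Strict Implicit.
Unset Printing Implicit Defensive.

Import Order.TTheory GRing.Theory Num.Theory.
Import numFieldNormedType.Exports.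

Local Open Scope classical_set_scope.
Local Open Scope ring_scope.
Local Open Scope complex_scope.

Definition word (m : nat) : Type := seq 'I_m.

HB.instance Definition _ m := Choice.on (word m).

Lemma word_unit m (u v : word m) : u ++ v = [::] -> u = [::] /\ v = [::].
Proof. by case: u. Qed.

HB.instance Definition _ m := monalg.Choice_isMonomialDef.Build (word m)
  (@catA 'I_m) (@cat0s 'I_m) (@cats0 'I_m) (@word_unit m).

(* C<X_1, ..., X_m> is the algebra of the free monoid of words. *)
Notation ncpoly R m := (malg (word m) R[i]).

(* C<X_1, ..., X_m> (x) C<X_1, ..., X_m> is the free vector space on the pairs
   of words, u (x) v being the basis vector (u, v). *)
Notation nctensor R m := (malg (word m * word m)%type R[i]).

Section noncommutative_polynomials.
Context {R : realType} {m : nat}.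
Implicit Types (P V : ncpoly R m) (w : word m) (i : 'I_m).

Definition ncmonom w : ncpoly R m := mkmalgU w 1.

Definition ncX i : ncpoly R m := ncmonom [:: i].

Definition ncstar P : ncpoly R m :=
  \sum_(w <- msupp P) mkmalgU (rev w : word m) (mcoeff w P)^*.

(* The factorizations w = w1 X_i w2 are indexed by the positions k of the
   letter i in w, with w1 = take k w and w2 = drop k.+1 w. *)
Definition ncdiff_word i w : nctensor R m :=
  \sum_(k < size w | tnth (in_tuple w) k == i)
    mkmalgU ((take k w : word m), (drop k.+1 w : word m)) 1.

Definition ncdiff i P : nctensor R m :=
  \sum_(w <- msupp P) mcoeff w P *: ncdiff_word i w.

Definition cyclic_diff_word i w : ncpoly R m :=
  \sum_(k < size w | tnth (in_tuple w) k == i)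
    ncmonom (drop k.+1 w ++ take k w).

Definition cyclic_diff i P : ncpoly R m :=
  \sum_(w <- msupp P) mcoeff w P *: cyclic_diff_word i w.

Definition tensor_form (tau : {scalar ncpoly R m}) (Q : nctensor R m) : R[i] :=
  \sum_(u <- msupp Q) mcoeff u Q * (tau (ncmonom u.1) * tau (ncmonom u.2)).

Definition schwinger_dyson V (tau : {scalar ncpoly R m}) : Prop :=
  [/\ forall P, tau (ncstar P) = (tau P)^*,
      tau 1 = 1 &
      forall i P, tensor_form tau (ncdiff i P)
                  = tau ((cyclic_diff i V + ncX i) * P)].

Definition moments_bounded (r : R) (tau : {scalar ncpoly R m}) : Prop :=
  forall w, `|tau (ncmonom w)| <= (r ^+ size w)%:C.

Definition nceval N (A : 'I_m -> 'M[R[i]]_N) P : 'M[R[i]]_N :=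
  \sum_(w <- msupp P) mcoeff w P *: \big[mulmx/1%:M]_(i <- w) A i.

Definition empirical N (A : 'I_m -> 'M[R[i]]_N) P : R[i] :=
  N%:R^-1 * \tr (nceval A P).

End noncommutative_polynomials.

(* The Hermitian matrix with diagonal entries x i i and, for i < j, with
   Re A_ij = x i j and Im A_ij = x j i: a linear bijection from R^(N x N) onto
   the Hermitian matrices, whose coordinates are the real entries. *)
Definition hermitian_of {R : realType} {N} (x : 'M[R]_N) : 'M[R[i]]_N :=
  \matrix_(i, j) if (i < j)%N then x i j +i* x j i
                 else if (j < i)%N then x j i -i* x i j
                 else (x i i)%:C.

Lemma hermitian_of_inj (R : realType) N : injective (@hermitian_of R N).
Proof.
move=> x y xy; apply/matrixP => i j.
have := congr1 (fun A : 'M[R[i]]_N => A i j) xy.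
have := congr1 (fun A : 'M[R[i]]_N => A j i) xy.
rewrite !mxE; case: (ltngtP i j) => [ij|ij|/val_inj <-].
- by move=> _ [].
- by move=> [_ ->].
- by move=> [].
Qed.

Lemma hermitian_ofP (R : realType) N (A : 'M[R[i]]_N) :
  (forall i j, A j i = (A i j)^*) <-> exists x, A = hermitian_of x.
Proof.
split=> [hA|[x ->] i j]; last first.
  rewrite !mxE; case: (ltngtP i j) => [_|_|/val_inj <-] //=.
  - by rewrite opprK.
  - by rewrite oppr0.
exists (\matrix_(i, j) if (i <= j)%N then complex.Re (A i j)
                       else complex.Im (A j i)).
apply/matrixP => i j; rewrite !mxE; case: (ltngtP i j) => [_|_|/val_inj <-].
- by case: (A i j).
- by rewrite hA; case: (A j i) => u v /=; rewrite ?opprK.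
- have := hA i i; case: (A i i) => u v /= [vN].
  by move/eqP : vN; rewrite leqnn -addr_eq0 -mulr2n mulrn_eq0 => /eqP ->.
Qed.

Definition potential {R : realType} {m n} (q : 'I_n -> word m) (t : 'rV[R]_n) :
    ncpoly R m :=
  \sum_j ((t 0 j)%:C *: (ncmonom (q j) + ncstar (ncmonom (q j)))).

(* For a self-adjoint V the trace of V(A) is real at Hermitian matrices, so
   that taking real parts below loses nothing. *)
Definition trace_eval {R : realType} {m N} (V : ncpoly R m)
    (A : 'I_m -> 'M[R[i]]_N) : R :=
  complex.Re (\tr (nceval A V)).

Definition trace_sqr {R : realType} {N} (A : 'M[R[i]]_N) : R :=
  complex.Re (\tr (A *m A)).

Definition convex_domain {R : realType} {m n} (q : 'I_n -> word m) (a : R) :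
    set 'rV[R]_n :=
  [set t | forall N, convex_function setT (fun X : 'I_m -> 'M[R]_N =>
     trace_eval (potential q t) (fun k => hermitian_of (X k))
     + a / 2 * \sum_k trace_sqr (hermitian_of (X k)))].

(* The k-fold product measure mu \x (mu \x ...) on k-tuples. *)
Fixpoint tuple_measure d (T : measurableType d) (R : realType)
    (mu : set T -> \bar R) (k : nat) {struct k} : set (k.-tuple T) -> \bar R :=
  match k with
  | 0 => dirac [tuple]
  | k'.+1 => pushforward (mu \x @tuple_measure d T R mu k')%E
               (fun p : T * k'.-tuple T => [tuple of p.1 :: p.2])
  end.
Arguments tuple_measure {d T R} mu k _.

Section tuple_measure_is_measure.
Context d (T : measurableType d) (R : realType).
Variable mu : {sigma_finite_measure set T -> \bar R}.

Let consp k (p : T * k.-tuple T) : k.+1.-tuple T := [tuple of p.1 :: p.2].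

Let uncons k (t : k.+1.-tuple T) : T * k.-tuple T :=
  (thead t, [tuple of behead t]).

Let measurable_consp k : measurable_fun setT (@consp k).
Proof. exact: measurable_cons. Qed.

Let measurable_uncons k : measurable_fun setT (@uncons k).
Proof.
apply/measurable_fun_pair; first exact: measurable_tnth.
exact: measurable_behead.
Qed.

Let consK k : cancel (@consp k) (@uncons k).
Proof.
by case=> x t; rewrite /uncons /consp theadE; congr pair; exact/val_inj.
Qed.

Let cons_measure k (nu : {sigma_finite_measure set (k.-tuple T) -> \bar R}) :
  {rho : {sigma_finite_measure set (k.+1.-tuple T) -> \bar R} |
    (rho : set _ -> \bar R) = pushforward (mu \x nu)%E (@consp k)}.
Proof.
pose m := pushforward (mu \x nu)%E (@consp k).
have mc := @measurable_consp k.
have m0 : m set0 = 0%E by exact: measure0.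
have mge0 A : (0 <= m A)%E by exact: measure_ge0.
have msigma : semi_sigma_additive m by exact: measure_semi_sigma_additive.
have msf : sigma_finite setT m.
  have [F TF Foo] : sigma_finite setT (mu \x nu)%E.
    have [F [TF ndF Foo]] := (sigma_finiteP _ _).1 (sigma_finiteT mu).
    have [G [TG ndG Goo]] := (sigma_finiteP _ _).1 (sigma_finiteT nu).
    exists (fun n => F n `*` G n).
      rewrite -setXTT TF TG predeqE => -[x y]; split.
        move=> [/= [n _ Fnx] [l _ Gly]]; exists (maxn n l) => //; split.
        - by move: x Fnx; exact/subsetPset/ndF/leq_maxl.
        - by move: y Gly; exact/subsetPset/ndG/leq_maxr.
      by move=> [n _ []/= ? ?]; split; exists n.
    move=> n; have [? ?] := Foo n; have [? ?] := Goo n.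
    split; first exact: measurableX.
    by rewrite product_measure1E// lte_mul_pinfty// ge0_fin_numE.
  exists (fun i => @uncons k @^-1` F i); first by rewrite -preimage_bigcup -TF.
  move=> i; have [mF muF] := Foo i; split.
    by rewrite -[X in measurable X]setTI; exact: measurable_uncons.
  rewrite /m /pushforward -comp_preimage.
  by rewrite (_ : _ \o _ = id) ?preimage_id//; apply/funext => p; exact: consK.
have [m' m'E] : {m' | m' = m} by exists m.
rewrite -m'E in m0 mge0 msigma msf; rewrite -/m -m'E.
pose M := isMeasure.Build _ _ _ m' m0 mge0 msigma.
pose rho : {measure set (k.+1.-tuple T) -> \bar R} := HB.pack m' M.
pose S := Measure_isSigmaFinite.Build _ _ _ rho msf.
pose rho' : {sigma_finite_measure set (k.+1.-tuple T) -> \bar R} :=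
  HB.pack m' M S.
by exists rho'.
Qed.

Let tuple_measure_ex k :
  {nu : {sigma_finite_measure set (k.-tuple T) -> \bar R} |
    (nu : set (k.-tuple T) -> \bar R) = tuple_measure mu k}.
Proof.
elim: k => [|k [nu nuE]] /=; first by exists (dirac [tuple]).
by have [rho rhoE] := cons_measure nu; exists rho; rewrite rhoE nuE.
Qed.

Variable k : nat.

Let tuple_measure0 : tuple_measure mu k set0 = 0%E.
Proof. by case: (tuple_measure_ex k) => nu <-; exact: measure0. Qed.

Let tuple_measure_ge0 A : (0 <= tuple_measure mu k A)%E.
Proof. by case: (tuple_measure_ex k) => nu <-; exact: measure_ge0. Qed.

Let tuple_measure_sigma_additive : semi_sigma_additive (tuple_measure mu k).
Proof.
by case: (tuple_measure_ex k) => nu <-; exact: measure_semi_sigma_additive.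
Qed.

HB.instance Definition _ := isMeasure.Build _ _ _ (tuple_measure mu k)
  tuple_measure0 tuple_measure_ge0 tuple_measure_sigma_additive.

Let tuple_measure_sigma_finite : sigma_finite setT (tuple_measure mu k).
Proof. by case: (tuple_measure_ex k) => nu <-; exact: sigma_finiteT. Qed.

HB.instance Definition _ := Measure_isSigmaFinite.Build _ _ _
  (tuple_measure mu k) tuple_measure_sigma_finite.

End tuple_measure_is_measure.

(* gibbs mu h is the probability measure e^{-h} dmu / \int e^{-h} dmu;
   it is the zero measure when the normalizing integral is 0 or +oo. *)
Definition gibbs d (T : measurableType d) (R : realType)
    (mu : set T -> \bar R) (h : T -> R) : set T -> \bar R :=
  fun A => ((fine (\int[mu]_x (expR (- h x))%:E))^-1%:E *
            \int[mu]_(x in A) (expR (- h x))%:E)%E.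

Section gibbs_is_measure.
Context d (T : measurableType d) (R : realType).
Variables (mu : {sigma_finite_measure set T -> \bar R}) (h : {mfun T >-> R}).

Let mexp : measurable_fun [set: T] (fun x => (expR (- h x))%:E).
Proof.
apply/measurable_EFinP; apply: measurableT_comp => //.
by apply: measurableT_comp => //.
Qed.

Let Z_ge0 : (0 <= (fine (\int[mu]_x (expR (- h x))%:E))^-1%:E :> \bar R)%E.
Proof.
rewrite lee_fin invr_ge0 fine_ge0//.
by apply: integral_ge0 => x _; rewrite lee_fin expR_ge0.
Qed.

Let gibbs0 : gibbs mu h set0 = 0%E.
Proof. by rewrite /gibbs integral_set0 mule0. Qed.

Let gibbs_ge0 A : (0 <= gibbs mu h A)%E.
Proof.
by apply: mule_ge0 => //; apply: integral_ge0 => x _; rewrite lee_fin expR_ge0.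
Qed.

Let gibbs_sigma_additive : semi_sigma_additive (gibbs mu h).
Proof.
move=> A mA tA mUA; rewrite /gibbs/=.
rewrite ge0_integral_bigcup//=; last exact: measurable_funTS.
set c := (_^-1)%:E.
rewrite -nneseriesZl//; last first.
  by move=> n _; apply: integral_ge0 => x _; rewrite lee_fin expR_ge0.
apply: is_cvg_ereal_nneg_natsum_cond => n _ _.
by apply: mule_ge0 => //; apply: integral_ge0 => x _; rewrite lee_fin expR_ge0.
Qed.

HB.instance Definition _ := isMeasure.Build _ _ _ (gibbs mu h)
  gibbs0 gibbs_ge0 gibbs_sigma_additive.

Let gibbs_finite : fin_num_fun (gibbs mu h).
Proof.
move=> A mA; rewrite ge0_fin_numE// /gibbs.
have Zge0 : (0 <= \int[mu]_x (expR (- h x))%:E)%E.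
  by apply: integral_ge0 => x _; rewrite lee_fin expR_ge0.
have [Zoo|Zoo] := eqVneq (\int[mu]_x (expR (- h x))%:E)%E +oo%E.
  by rewrite Zoo/= invr0 mul0e.
apply: lte_mul_pinfty => //.
apply: (@le_lt_trans _ _ (\int[mu]_x (expR (- h x))%:E)%E); last first.
  by rewrite lt_neqAle Zoo leey.
by apply: ge0_subset_integral => // x _; rewrite lee_fin expR_ge0.
Qed.

HB.instance Definition _ := Measure_isFinite.Build _ _ _ (gibbs mu h)
  gibbs_finite.

End gibbs_is_measure.

(* Families of real entries, which parametrize H_N and H_N^m. *)
Notation entries R N := ((N * N).-tuple (measurableTypeR R)).
Notation mentries R m N := (m.-tuple (entries R N)).

Section potentials.
Context {R : realType}.

Definition herm N (x : entries R N) : 'M[R[i]]_N :=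
  hermitian_of (\matrix_(i, j) tnth x (mxvec_index i j)).

Definition herms m N (x : mentries R m N) (k : 'I_m) : 'M[R[i]]_N :=
  herm (tnth x k).

Definition gue_potential N (x : entries R N) : R :=
  N%:R / 2 * trace_sqr (herm x).

Definition model_potential m N (V : ncpoly R m) (x : mentries R m N) : R :=
  N%:R * trace_eval V (herms x).

End potentials.

Section measurable_potentials.
Context {R : realType} d (T : measurableType d).

Let cmeas (f : T -> R[i]) :=
  measurable_fun [set: T] (fun x => complex.Re (f x)) /\
  measurable_fun [set: T] (fun x => complex.Im (f x)).

Let cmeas_cst c : cmeas (fun=> c).
Proof. by split; exact: measurable_cst. Qed.

Let cmeasD f g : cmeas f -> cmeas g -> cmeas (fun x => f x + g x).
Proof.
move=> [f1 f2] [g1 g2]; split.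
- under eq_fun do rewrite raddfD; exact: measurable_funD.
- under eq_fun do rewrite raddfD; exact: measurable_funD.
Qed.

Let cmeasM f g : cmeas f -> cmeas g -> cmeas (fun x => f x * g x).
Proof.
move=> [f1 f2] [g1 g2]; split.
- rewrite (_ : (fun x => _) = (fun x => complex.Re (f x) * complex.Re (g x)
    - complex.Im (f x) * complex.Im (g x))); last first.
    by apply/funext => x; case: (f x) (g x) => ? ? [].
  by apply: measurable_funB; exact: measurable_funM.
- rewrite (_ : (fun x => _) = (fun x => complex.Re (f x) * complex.Im (g x)
    + complex.Im (f x) * complex.Re (g x))); last first.
    by apply/funext => x; case: (f x) (g x) => ? ? [].
  by apply: measurable_funD; exact: measurable_funM.
Qed.

Let cmeas_sum (I : Type) (s : seq I) (F : I -> T -> R[i]) :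
  (forall i, cmeas (F i)) -> cmeas (fun x => \sum_(i <- s) F i x).
Proof.
move=> mF; elim: s => [|i s ih].
  by under eq_fun do rewrite big_nil; exact: cmeas_cst.
by under eq_fun do rewrite big_cons; exact: cmeasD.
Qed.

Let mmeas m n (f : T -> 'M[R[i]]_(m, n)) :=
  forall i j, cmeas (fun x => f x i j).

Let mmeasM m n p (f : T -> 'M[R[i]]_(m, n)) (g : T -> 'M[R[i]]_(n, p)) :
  mmeas f -> mmeas g -> mmeas (fun x => f x *m g x).
Proof.
move=> mf mg i j; under eq_fun do rewrite mxE.
by apply: cmeas_sum => k; exact: cmeasM.
Qed.

Let cmeas_trace N (f : T -> 'M[R[i]]_N) : mmeas f -> cmeas (fun x => \tr (f x)).
Proof. by move=> mf; apply: cmeas_sum => k; exact: mf. Qed.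

Let mmeas_nceval m N (A : T -> 'I_m -> 'M[R[i]]_N) (V : ncpoly R m) :
  (forall k, mmeas (A ^~ k)) -> mmeas (fun x => nceval (A x) V).
Proof.
move=> mA i j; under eq_fun do rewrite summxE.
apply: cmeas_sum => w; under eq_fun do rewrite mxE.
apply: cmeasM; first exact: cmeas_cst.
elim: w i j => [|k w ih] i j.
  by under eq_fun do rewrite big_nil; exact: cmeas_cst.
by under eq_fun do rewrite big_cons; exact: mmeasM.
Qed.

Let mmeas_herm N (f : T -> entries R N) :
  measurable_fun [set: T] f -> mmeas (fun x => herm (f x)).
Proof.
move=> mf i j; have mt k : measurable_fun [set: T] (fun x => tnth (f x) k : R).
  exact: (measurable_fun_tnthP _).1.
under eq_fun do rewrite !mxE.
case: ltngtP => _; split => //=.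
exact: measurable_funN (mt _).
Qed.

Lemma measurable_trace_sqr_herm N (f : T -> entries R N) :
  measurable_fun [set: T] f ->
  measurable_fun [set: T] (fun x => trace_sqr (herm (f x))).
Proof.
by move=> mf; case: (cmeas_trace (mmeasM (mmeas_herm mf) (mmeas_herm mf))).
Qed.

Lemma measurable_empirical_herms m N (P : ncpoly R m)
    (f : T -> mentries R m N) : measurable_fun [set: T] f ->
  measurable_fun [set: T]
    (fun x => complex.Re (\tr (nceval (herms (f x)) P))) /\
  measurable_fun [set: T]
    (fun x => complex.Im (\tr (nceval (herms (f x)) P))).
Proof.
move=> mf; apply: cmeas_trace; apply: mmeas_nceval => k.
by apply: mmeas_herm; exact: (measurable_fun_tnthP _).1.
Qed.

End measurable_potentials.

Section matrix_model.
Context {R : realType}.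

Let measurable_gue_potential N :
  measurable_fun [set: entries R N] (@gue_potential R N).
Proof.
apply: measurable_funM; first exact: measurable_cst.
exact: (measurable_trace_sqr_herm (@measurable_id _ _ _)).
Qed.

HB.instance Definition _ N := isMeasurableFun.Build _ _ _ _
  (@gue_potential R N) (@measurable_gue_potential N).

Let measurable_model_potential m N (V : ncpoly R m) :
  measurable_fun [set: mentries R m N] (@model_potential R m N V).
Proof.
apply: measurable_funM; first exact: measurable_cst.
exact: (measurable_empirical_herms V (@measurable_id _ _ _)).1.
Qed.

HB.instance Definition _ m N V := isMeasurableFun.Build _ _ _ _
  (@model_potential R m N V) (@measurable_model_potential m N V).

Definition gue N : set (entries R N) -> \bar R :=
  gibbs (tuple_measure lebesgue_measure (N * N)) (@gue_potential R N).
Arguments gue N _ : clear implicits.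

HB.instance Definition _ N := FiniteMeasure.copy (gue N)
  (gibbs (tuple_measure lebesgue_measure (N * N)) (@gue_potential R N)).

Definition matrix_model m N (V : ncpoly R m) : set (mentries R m N) -> \bar R :=
  gibbs (tuple_measure (gue N) m) (@model_potential R m N V).
Arguments matrix_model {m} N V _.

HB.instance Definition _ m N V := FiniteMeasure.copy (@matrix_model m N V)
  (gibbs (tuple_measure (gue N) m) (@model_potential R m N V)).

Definition mean_empirical m (V : ncpoly R m) N (P : ncpoly R m) : R[i] :=
  (\int[matrix_model N V]_x complex.Re (empirical (herms x) P)) +i*
  (\int[matrix_model N V]_x complex.Im (empirical (herms x) P)).

End matrix_model.

Arguments gue {R} N _.
Arguments matrix_model {R m} N V _.
Arguments mean_empirical {R m} V N P.

(* Main.v *)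
(* Write M_N(w_1, ..., w_k) for the mean of the product of the normalized traces
   of the words w_j under the matrix model.  Integration by parts gives a linear
   recursion for M_N, with an error term of order N^-2, in which the first word
   is shortened or, at the cost of a small coefficient of V, lengthened.
   In the weight \prod_j rho^|w_j| / (|w_j| + 1)^2 this recursion is a
   contraction, so that the difference of two approximate solutions of at most
   exponential growth tends to 0: the M_N form a Cauchy sequence, the limit M
   satisfies M(W W') = M(W) M(W'), whence tau(w) = M(w) solves the
   Schwinger-Dyson equation, and it is the only solution bounded by r^|w|.
   That M(w) is itself bounded by r^|w| follows by comparing it, along the
   iteration of the same recursion, with a scalar majorant of generating
   function at most 2 at 1/r.

   The a priori bound |M_N(W)| <= 4 K^|W| for |W| <= K N is where the convexity
   is used.  It makes the density of the model strictly log-concave, so the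
   midpoint Prekopa-Leindler inequality bounds E e^(s l) E e^(-s l) by
   e^(s^2 / (N (1 - a))) for each linear form l = Re <u, A_k v>.  The mean of
   A_k is a scalar matrix by unitary invariance, and it is bounded because of a
   second moment estimate.  Taking s = 2 N and summing over u and v in a grid
   with e^(O(N)) points gives E e^(N |A_k|) <= e^(K N) for the operator norm. *)

Require Import Defs.
From HB Require Import structures.
From mathcomp Require Import all_boot all_order all_algebra.
From mathcomp Require Import finmap complex.
(* The notations of monalg clash with those of MathComp-Analysis. *)
From mathcomp Require Import -(notations) monalg.
From mathcomp Require Import all_classical all_reals all_analysis.
From mathcomp Require Import measurable_realfun.
From mathcomp Require Import ring lra.

Set Implicit Arguments.
Unset Strict Implicit.
Unset Printing Implicit Defensive.

Import Order.TTheory GRing.Theory Num.Theory.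
Import numFieldNormedType.Exports.

Local Open Scope classical_set_scope.
Local Open Scope ring_scope.
Local Open Scope complex_scope.

(** * Prekopa-Leindler inequality and densities on tuples *)

(** The equation for one mean trace contains the mean of a product of two traces, whose
    factorization is not known in advance. With all products of traces as unknowns the recursion is
    linear and closed, and factorization is read off in the limit from uniqueness, without any
    concentration of the traces. The factor [(|w| + 1)^2] compensates for the number of ways to
    split a word: the sequence [1 / (l + 1)^2] dominates its own convolution up to a constant, while
    a pure power of [rho] would lose a factor [|w|].

    The obstacle is that the recursion lengthens words, so it yields nothing without a growth bound
    whose rate [K] is fixed before the size of the coefficients of [V]. Here [K] depends only on [m]
    and [a]; [rho] is chosen from [K] and [r], and [eps] comes last. Besides reality and convexity,
    the rate uses only a bound on the coefficients of the one-letter words of [V], which displace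
    the mean. Words stay fixed while [N] grows, so a bound for [|W| <= K N] is enough. As [K] may
    exceed [r], the bound [r^|w|] needs its own majorant. *)

Section lebesgue_affine.
Context {R : realType}.
Notation mu := (@lebesgue_measure R).

(** By uniqueness of Lebesgue measure: [c] times its image under the affine map gives half-open
    intervals their length. *)
Lemma lebesgue_measure_affine (c b : R) (A : set R) : 0 < c -> measurable A ->
  mu ((fun x => (c * x + b)%R) @^-1` A) = ((c^-1)%:E * mu A)%E.
Proof.
move=> c0 mA.
have c0' := lt0r_neq0 c0.
have mf : measurable_fun [set: measurableTypeR R]
   (fun x => c * x + b : measurableTypeR R).
  by apply: measurable_funD => //; apply: measurable_funM.
pose f : measurableTypeR R -> measurableTypeR R := fun x => c * x + b.
pose nu : {measure set (measurableTypeR R) -> \bar R} :=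
  mscale (NngNum (ltW c0)) (pushforward mu f).
suff : forall A, measurable A -> mu A = nu mf A.
  move=> /(_ A mA) ->; rewrite /nu/= /mscale/= /pushforward/= muleA -EFinM.
  by rewrite mulVf// mul1e.
apply: (@lebesgue_measure_unique _ (nu mf)) => X [[x y]/= _ <-].
rewrite /nu /= /mscale/= /pushforward.
have -> : f @^-1` `]x, y]%classic = `](x - b) / c, (y - b) / c]%classic.
  apply/seteqP; split => z /=; rewrite !in_itv/= /f ltr_pdivrMr// ler_pdivlMr//.
    by rewrite ltrBlDr lerBrDr (mulrC z).
  by rewrite ltrBlDr lerBrDr (mulrC z).
rewrite !lebesgue_measure_itv/= !lte_fin ltr_pM2r ?invr_gt0// ltrD2r.
case: ifPn => _; last by rewrite mule0.
rewrite -!EFinB -EFinM; congr EFin.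
by field.
Qed.

Lemma ge0_integral_lebesgue_shift (f : R -> \bar R) (b : R) :
  measurable_fun [set: measurableTypeR R] f -> (forall x, 0 <= f x)%E ->
  (\int[mu]_x f (x + b)%R = \int[mu]_x f x)%E.
Proof.
move=> mf f0.
have mg : measurable_fun [set: measurableTypeR R]
   (fun x => x + b : measurableTypeR R).
  exact: measurable_funD.
pose g : measurableTypeR R -> measurableTypeR R := fun x => x + b.
transitivity (\int[pushforward mu g]_x f x)%E.
  by rewrite ge0_integral_pushforward.
apply: eq_measure_integral => A mA _.
transitivity (mu A); last by [].
rewrite -(mul1e (mu A)) -invr1 -(lebesgue_measure_affine b ltr01 mA).
by congr (mu _); apply/funext => x /=; rewrite mul1r.
Qed.
End lebesgue_affine.

(** * Integration over superlevel sets *)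

Section layer_cake.
Context d (T : measurableType d) {R : realType}.
Variable mu : {sigma_finite_measure set T -> \bar R}.
Notation leb := (@lebesgue_measure R).

Lemma measurable_superlevel (f : T -> R) (s : R) : measurable_fun setT f ->
  measurable [set x | s < f x].
Proof.
move=> mf; have := mf measurableT `]s, +oo[%classic (measurable_itv _).
by rewrite setTI; congr measurable; apply/seteqP; split=> x /=;
  rewrite in_itv/= andbT.
Qed.

Lemma measurable_measure_superlevel (f : T -> R) : measurable_fun setT f ->
  measurable_fun [set: measurableTypeR R] (fun s => mu [set x | s < f x]).
Proof.
move=> mf.
pose F (p : T * measurableTypeR R) : R := ((p.2 < f p.1 :> R)%R)%:R.
have mF : measurable_fun setT (EFin \o F).
  apply/measurable_EFinP.
  apply: (measurableT_comp (f := fun b : bool => b%:R : R)) => //.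
  apply: measurable_fun_ltr => //.
  exact: measurableT_comp.
have F0 p : (0 <= (EFin \o F) p)%E by rewrite /= lee_fin /F.
have := measurable_fun_fubini_tonelli_G (m1 := mu) _ mF F0.
congr (measurable_fun _ _); apply/funext => s; rewrite /fubini_G /=.
rewrite -[X in _ = mu X]setIT -integral_indic//; last first.
  exact: measurable_superlevel.
apply: eq_integral => x _; rewrite /F /= indicE; congr ((nat_of_bool _)%:R%:E).
by apply/idP/idP => [sf|/set_mem//]; apply/mem_set.
Qed.

(** Tonelli for the indicator of [0 <= s < 1], [s < f x]. The levels stop short of [1], so that for
    a function of supremum [1] every superlevel set that occurs is nonempty. *)
Lemma layer_cake01 (f : T -> R) : measurable_fun setT f ->
  (forall x, 0 <= f x <= 1) ->
  (\int[mu]_x (f x)%:E = \int[leb]_(s in `[0%R, 1%R[) mu [set x | s < f x]%R)%E.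
Proof.
move=> mf f01.
pose F (p : T * measurableTypeR R) : R := \1_(`[0%R, 1%R[%classic : set R) (p.2 : R) * ((p.2 < f p.1 :> R)%R)%:R.
have mF : measurable_fun setT (EFin \o F).
  apply/measurable_EFinP; apply: measurable_funM.
    exact: measurableT_comp.
  apply: (measurableT_comp (f := fun b : bool => b%:R : R)) => //.
  apply: measurable_fun_ltr => //.
  exact: measurableT_comp.
have F0 p : (0 <= (EFin \o F) p)%E by rewrite /= lee_fin /F mulr_ge0.
transitivity (\int[mu]_x \int[leb]_s (EFin \o F) (x, s))%E.
  apply: eq_integral => x _.
  transitivity (\int[leb]_s (\1_(`[0, f x[%classic : set R) s)%:E)%E.
    rewrite integral_indic//.
    rewrite setIT.
    transitivity (leb [set` `[0%R, f x[]); last by [].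
    rewrite lebesgue_measure_itv/= lte_fin.
    have /andP[] := f01 x; rewrite le_eqVlt => /orP[/eqP <- _|->]; last by rewrite oppr0 addr0.
    by rewrite ltxx.
  apply: eq_integral => s _ /=; congr EFin; rewrite /F/= !indicE -natrM mulnb.
  congr (nat_of_bool _)%:R.
  have /andP[_ fx] := f01 x.
  apply/idP/idP => [/set_mem/=|/andP[/set_mem/=]]; rewrite in_itv/=.
    move=> /andP[s0 sf]; rewrite sf andbT; apply/mem_set => /=.
    by rewrite in_itv/= s0 (lt_le_trans sf fx).
  by move=> /andP[s0 _] sf; apply/mem_set => /=; rewrite in_itv/= s0.
rewrite fubini_tonelli//.
rewrite [RHS]integral_mkcond; apply: eq_integral => s _.
rewrite patchE /F/=.
case: ifPn => ss.
  rewrite -[X in mu X]setIT -integral_indic//.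
    apply: eq_integral => x _; congr EFin.
    rewrite indicE (_ : (s \in _) = true) ?mul1r ?indicE//.
    by congr ((nat_of_bool _)%:R); apply/idP/idP; rewrite inE.
  exact: measurable_superlevel.
rewrite (eq_integral (cst 0%E)) ?integral0// => x _.
by rewrite indicE (negbTE ss) mul0r.
Qed.
End layer_cake.

(** * One-dimensional Brunn-Minkowski inequality for midpoints *)

Section brunn_minkowski.
Context {R : realType}.
Notation mu := (@lebesgue_measure R).
Local Open Scope ereal_scope.

Lemma compact_measurableR (K : set R) : compact K ->
  measurable (K : set (measurableTypeR R)).
Proof. by move=> cK; apply: closed_measurable; exact: compact_closed. Qed.

(** With [k] the maximum of [K] and [l] the minimum of [L], the sets [(K + l) / 2] and [(k + L) / 2]
    lie in [C], one to the left and the other to the right of [(k + l) / 2], so that they share at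
    most this point. *)
Lemma brunn_minkowski_compact (K L C : set R) : compact K -> compact L ->
  K !=set0 -> L !=set0 -> measurable (C : set (measurableTypeR R)) ->
  (forall x y, K x -> L y -> C ((x + y) / 2)%R) ->
  mu K + mu L <= 2%:E * mu C.
Proof.
move=> cK cL K0 L0 mC KLC.
have cid (A : set R) : {within A, continuous (@idfun R)}.
  by apply: continuous_subspaceT => x; exact: cvg_id.
have [k kK kmax] := compact_EVT_max K0 cK (cid K).
have [l lL lmin] := compact_EVT_min L0 cL (cid L).
have mK := compact_measurableR cK; have mL := compact_measurableR cL.
pose K' := (fun z => 2 * z + - l)%R @^-1` K.
pose L' := (fun z => 2 * z + - k)%R @^-1` L.
have maff (b : R) (A : set R) : measurable (A : set (measurableTypeR R)) ->
    measurable ((fun z => 2 * z + b)%R @^-1` A : set (measurableTypeR R)).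
  move=> mA; rewrite -[X in measurable X]setTI.
  have mf : measurable_fun [set: measurableTypeR R]
      ((fun z => 2 * z + b)%R : measurableTypeR R -> measurableTypeR R).
    by apply: measurable_funD => //; apply: measurable_funM.
  exact: mf.
have muK' : mu K = 2%:E * mu K'.
  rewrite /K' lebesgue_measure_affine// muleA -EFinM divff ?mul1e//.
have muL' : mu L = 2%:E * mu L'.
  rewrite /L' lebesgue_measure_affine// muleA -EFinM divff ?mul1e//.
have K'C : K' `<=` C.
  move=> z; rewrite /K' /= => Kz.
  by have := KLC _ _ Kz (set_mem lL); congr C; field.
have L'C : L' `<=` C.
  move=> z; rewrite /L' /= => Lz.
  by have := KLC _ _ (set_mem kK) Lz; congr C; field.
have mK' : measurable (K' : set (measurableTypeR R)) by exact: maff.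
have mL' : measurable (L' : set (measurableTypeR R)) by exact: maff.
pose p := ((k + l) / 2)%R.
have KLp : K' `&` L' `<=` [set p].
  move=> z [] /=; rewrite /K' /L' /= => Kz Lz.
  have := kmax _ (mem_set Kz); have := lmin _ (mem_set Lz).
  rewrite /idfun /p => h1 h2; lra.
rewrite muK' muL' -ge0_muleDr//.
apply: lee_pmul => //; first by rewrite adde_ge0.
have mp : measurable ([set p] : set (measurableTypeR R)) by exact: measurable_set1.
have -> : mu K' = mu (K' `\` [set p]).
  rewrite [LHS](measureDI mu mK' mp) [X in _ + X](_ : _ = 0) ?adde0//.
  apply: (@subset_measure0 _ _ _ mu _ [set p]) => //.
  - exact: measurableI.
  - exact: lebesgue_measure_set1.
have mD : measurable (K' `\` [set p] : set (measurableTypeR R)).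
  exact: measurableD.
rewrite -measureU//; last first.
  apply/seteqP; split => // z [[Kz pz] Lz]; apply: pz.
  exact: KLp.
apply: le_measure; rewrite ?inE//; first exact: measurableU.
by move=> z [[/K'C]|/L'C].
Qed.

(** Inner regularity reduces the claim to compact sets. [C] stands for the set of midpoints, which
    need not be measurable; an empty [A] or [B] would have no midpoints and impose nothing on
    [C]. *)
Lemma brunn_minkowski1 (A B C : set (measurableTypeR R)) :
  measurable A -> measurable B -> measurable C ->
  A !=set0 -> B !=set0 ->
  (forall x y : R, A x -> B y -> C ((x + y) / 2)%R) ->
  mu A + mu B <= 2%:E * mu C.
Proof.
move=> mA mB mC [a Aa] [b Bb] ABC.
have KL (K L : set R) : compact K -> compact L -> K `<=` A -> L `<=` B ->
    mu K + mu L <= 2%:E * mu C.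
  move=> cK cL KA LB.
  have mK := compact_measurableR cK; have mL := compact_measurableR cL.
  (* The points [a] and [b] are added to make the compact sets nonempty. *)
  apply: (@le_trans _ _ (mu (K `|` [set a]) + mu (L `|` [set b]))).
    by apply: leeD; apply: le_measure; rewrite ?inE//; apply: measurableU.
  apply: brunn_minkowski_compact => //.
  - by apply: compactU => //; exact: compact_set1.
  - by apply: compactU => //; exact: compact_set1.
  - by exists a; right.
  - by exists b; right.
  - move=> x y Kx Ly; apply: ABC.
      by case: Kx => [/KA//|->].
    by case: Ly => [/LB//|->].
have [Coo|Cfin] := eqVneq (mu C) +oo.
  by rewrite Coo gt0_muley ?leey// lte_fin.
have Xfin : 2%:E * mu C \is a fin_num.
  by rewrite fin_numM// ge0_fin_numE// lt_neqAle Cfin leey.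
have Kfin (K L : set R) : compact K -> compact L -> K `<=` A -> L `<=` B ->
    mu K \is a fin_num /\ mu L \is a fin_num.
  move=> cK cL KA LB; have le := KL _ _ cK cL KA LB.
  split; rewrite ge0_fin_numE//; apply: le_lt_trans (_ : 2%:E * mu C < +oo).
  - by apply: le_trans le; rewrite leeDl.
  - by rewrite ltey_eq Xfin.
  - by apply: le_trans le; rewrite leeDr.
  - by rewrite ltey_eq Xfin.
(* The supremum is taken over [K] and then over [L]; each time the other measure is finite and moves
   across the inequality. *)
have AL (L : set R) : compact L -> L `<=` B -> mu A + mu L <= 2%:E * mu C.
  move=> cL LB.
  have [_ Lfin] := Kfin set0 L (@compact0 _) cL (@sub0set _ _) LB.
  rewrite -leeBrDr//.
  rewrite lebesgue_regularity_inner_sup//; apply: ge_ereal_sup => _ [K [cK KA]] <-.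
  by rewrite leeBrDr//; exact: KL.
have Afin : mu A \is a fin_num.
  rewrite ge0_fin_numE//; apply: le_lt_trans (_ : 2%:E * mu C < +oo).
    by have := AL set0 (@compact0 _) (@sub0set _ _); rewrite measure0 adde0.
  by rewrite ltey_eq Xfin.
rewrite addeC -leeBrDr//.
rewrite (lebesgue_regularity_inner_sup mB); apply: ge_ereal_sup => _ [L [cL LB]] <-.
by rewrite leeBrDr// addeC; exact: AL.
Qed.
End brunn_minkowski.

(** Only the midpoint case, squared to avoid roots. Values are extended reals because in the
    induction on the number of coordinates the functions are partial integrals, which may be
    infinite. *)
Definition prekopa_leindler d (T : measurableType d) (R : realType)
    (mu : set T -> \bar R) (mid : T -> T -> T) : Prop :=
  forall f g h : T -> \bar R, measurable_fun setT f -> measurable_fun setT g ->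
    measurable_fun setT h -> (forall x, 0 <= f x)%E -> (forall x, 0 <= g x)%E ->
    (forall x, 0 <= h x)%E ->
    (forall x y, f x * g y <= h (mid x y) * h (mid x y))%E ->
  ((\int[mu]_x f x) * (\int[mu]_x g x) <= (\int[mu]_x h x) * (\int[mu]_x h x))%E.

Lemma lee_sqr_of_amean (R : realType) (x y z : \bar R) :
  (0 <= x -> 0 <= y -> 0 <= z -> x + y <= 2%:E * z -> x * y <= z * z)%E.
Proof.
move=> x0 y0 z0; have [->|] := eqVneq z +oo%E; first by rewrite mulyy leey.
case: z z0 => [z| |] // z0 _; move: x y x0 y0 => [x| |] [y| |] //.
rewrite -!EFinM -EFinD !lee_fin in z0 * => x0 y0 xyz.
have xy0 : 0 <= x + y by exact: addr_ge0.
have : (x + y) ^+ 2 <= (2 * z) ^+ 2 by rewrite ler_sqr// nnegrE; lra.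
have := sqr_ge0 (x - y); nra.
Qed.

(** A zero limit is treated apart because the product of extended reals is not continuous at
    [(0, +oo)]. *)
Lemma mule_le_lim (R : realType) (x y c : \bar R) (u v : (\bar R)^nat) :
  (0 <= x -> 0 <= y -> 0 <= c -> u n @[n --> \oo] --> x -> v n @[n --> \oo] --> y ->
   (forall n, u n * v n <= c) -> x * y <= c)%E.
Proof.
move=> x0 y0 c0 ux vy uvc.
have [->|xn0] := eqVneq x 0%E; first by rewrite mul0e.
have [->|yn0] := eqVneq y 0%E; first by rewrite mule0.
have xy : (x *? y)%E.
  by rewrite mule_defE (negbTE xn0) (negbTE yn0).
have h : (u n * v n)%E @[n --> \oo] --> (x * y)%E by exact: cvgeM.
by apply: cvge_le h => //; exact: nearW.
Qed.

(** * Prekopa-Leindler inequality on the line *)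

Section prekopa_leindler_lebesgue.
Context {R : realType}.
Notation mu := (@lebesgue_measure R).
Notation T := (measurableTypeR R).

(** At each level [s < 1] the midpoints of [{f > s}] and [{g > s}] lie in [{h > s}], and
    Brunn-Minkowski applies level by level. Normalizing both suprema to [1] thus yields a bound on
    the sum of the integrals, stronger than the one on their product. *)
Lemma prekopa_leindler_sup1 (f g h : T -> R) :
  measurable_fun setT f -> measurable_fun setT g -> measurable_fun setT h ->
  (forall x, 0 <= f x <= 1) -> (forall x, 0 <= g x <= 1) -> (forall x, 0 <= h x) ->
  (forall s, 0 <= s < 1 -> exists x, s < f x) ->
  (forall s, 0 <= s < 1 -> exists x, s < g x) ->
  (forall x y : R, f x * g y <= h ((x + y) / 2) ^+ 2) ->
  (\int[mu]_x (f x)%:E + \int[mu]_x (g x)%:E <= 2%:E * \int[mu]_x (h x)%:E)%E.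
Proof.
move=> mf mg mh f01 g01 h0 fs gs fgh.
(* Truncated at [1] so that the layer-cake formula applies; the levels below [1] are unaffected. *)
pose k (x : T) := Num.min (h x) 1.
have mk : measurable_fun setT k by apply: measurable_minr.
have k01 x : 0 <= k x <= 1.
  by rewrite /k le_min h0 ler01/= ge_min lexx orbT.
have kh : (\int[mu]_x (k x)%:E <= \int[mu]_x (h x)%:E)%E.
  apply: ge0_le_integral => //.
  - by move=> x _; rewrite lee_fin; case/andP: (k01 x).
  - exact/measurable_EFinP.
  - exact/measurable_EFinP.
  - by move=> x _; rewrite lee_fin /k ge_min lexx.
apply: (@le_trans _ _ (2%:E * \int[mu]_x (k x)%:E)%E); last first.
  by rewrite lee_pmul2l// lte_fin.
rewrite !(layer_cake01 mu)//.
have mlev (u : T -> R) : measurable_fun setT u -> (forall x, 0 <= u x <= 1) ->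
    measurable_fun (`[0%R, 1%R[%classic : set T)
      (fun s : T => mu [set x | s < u x]).
  move=> mu_ u01; apply: measurable_funTS.
  exact: measurable_measure_superlevel.
rewrite -ge0_integralD//; [|exact: mlev..].
rewrite -ge0_integralZl//; [|exact: mlev..].
apply: ge0_le_integral => //.
- by move=> s _; rewrite adde_ge0.
- by apply: emeasurable_funD; exact: mlev.
- by apply: measurable_funeM; exact: mlev.
move=> s /=; rewrite in_itv/= => /andP[s0 s1].
apply: brunn_minkowski1.
- exact: measurable_superlevel.
- exact: measurable_superlevel.
- exact: measurable_superlevel.
- by have [|x] := fs s; [rewrite s0|exists x].
- by have [|x] := gs s; [rewrite s0|exists x].
move=> x y /= sx sy; rewrite /k lt_min s1 andbT.
have := fgh x y.
rewrite ltNge => h1; apply/negP => h2.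
have := h0 ((x+y)/2) => h3.
have : h ((x + y) / 2) ^+ 2 <= s ^+ 2 by rewrite ler_sqr.
have : s ^+ 2 < f x * g y by rewrite expr2 ltr_pM.
lra.
Qed.

(** Dividing [f], [g] and [h] by [a], [b] and the square root of [a * b], where [a] and [b] are the
    suprema, preserves the hypothesis and leads to the normalized case. If a supremum vanishes, so
    does an integral on the left. *)
Lemma prekopa_leindler_bounded (f g h : T -> R) (M : R) :
  measurable_fun setT f -> measurable_fun setT g -> measurable_fun setT h ->
  (forall x, 0 <= f x <= M) -> (forall x, 0 <= g x <= M) -> (forall x, 0 <= h x) ->
  (forall x y : R, f x * g y <= h ((x + y) / 2) ^+ 2) ->
  ((\int[mu]_x (f x)%:E) * (\int[mu]_x (g x)%:E)
     <= (\int[mu]_x (h x)%:E) * (\int[mu]_x (h x)%:E))%E.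
Proof.
move=> mf mg mh f0M g0M h0 fgh.
have supP (u : T -> R) : (forall x, 0 <= u x <= M) ->
    (forall x, u x = 0) \/ exists2 a, 0 < a &
      (forall x, u x <= a) /\ forall s, 0 <= s < 1 -> exists x, s * a < u x.
  move=> u0M; pose a := sup (range u).
  have hs : has_sup (range u).
    split; first by exists (u 0), 0.
    by exists M => _ [x _ <-]; case/andP: (u0M x).
  have ua x : u x <= a by apply: ub_le_sup; [case: hs | exists x].
  have a0 : 0 <= a by apply: le_trans (ua 0); case/andP: (u0M 0).
  have [a0'|a0'] := eqVneq a 0.
    left => x; apply/eqP; rewrite eq_le -{1}a0' ua.
    by case/andP: (u0M x).
  right; exists a; first by rewrite lt_neqAle eq_sym a0'.
  split => // s /andP[s0 s1].
  have e0 : 0 < (1 - s) * a.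
    by rewrite mulr_gt0 ?subr_gt0// lt_neqAle eq_sym a0'.
  have [_ [x _ <-] ux] := sup_adherent e0 hs.
  by exists x; apply: le_lt_trans ux; rewrite -/a; lra.
have [f0|[a a0 [fa fs]]] := supP _ f0M.
  rewrite (eq_integral (cst 0%E)) ?integral0 ?mul0e ?mule_ge0//;
    first [by apply: integral_ge0 => x _; rewrite lee_fin | by move=> x _; rewrite f0].
have [g0|[b b0 [gb gs]]] := supP _ g0M.
  rewrite [X in (_ * X)%E](eq_integral (cst 0%E)) ?integral0 ?mule0 ?mule_ge0//;
    first [by apply: integral_ge0 => x _; rewrite lee_fin | by move=> x _; rewrite g0].
pose c := Num.sqrt (a * b).
have ab0 : 0 < a * b by exact: mulr_gt0.
have c0 : 0 < c by rewrite sqrtr_gt0.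
have c2 : c ^+ 2 = a * b by rewrite sqr_sqrtr// ltW.
have scale (u : T -> R) k : 0 < k -> measurable_fun setT u -> (forall x, 0 <= u x) ->
    (\int[mu]_x (u x)%:E = k%:E * \int[mu]_x (u x / k)%:E)%E.
  move=> k0 mu_ u0; rewrite -ge0_integralZl//=.
  - apply: eq_integral => x _; rewrite -EFinM; congr EFin.
    by rewrite mulrC divfK// lt0r_neq0.
  - by apply/measurable_EFinP; apply: measurable_funM.
  - by move=> x _; rewrite lee_fin divr_ge0// ltW.
  - by rewrite lee_fin ltW.
have f00 x : 0 <= f x by case/andP: (f0M x).
have g00 x : 0 <= g x by case/andP: (g0M x).
rewrite (scale f a)// (scale g b)// (scale h c)//.
rewrite muleACA [X in (_ <= X)%E]muleACA -!EFinM -expr2 c2.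
apply: lee_wpmul2l; first by rewrite lee_fin ltW.
apply: lee_sqr_of_amean.
- by apply: integral_ge0 => x _; rewrite lee_fin divr_ge0// ltW.
- by apply: integral_ge0 => x _; rewrite lee_fin divr_ge0// ltW.
- by apply: integral_ge0 => x _; rewrite lee_fin divr_ge0// ltW.
apply: prekopa_leindler_sup1.
- exact: measurable_funM.
- exact: measurable_funM.
- exact: measurable_funM.
- by move=> x; rewrite divr_ge0 ?(ltW a0)//= ler_pdivrMr// mul1r.
- by move=> x; rewrite divr_ge0 ?(ltW b0)//= ler_pdivrMr// mul1r.
- by move=> x; rewrite divr_ge0 ?(ltW c0).
- by move=> s /fs[x sx]; exists x; rewrite ltr_pdivlMr.
- by move=> s /gs[x sx]; exists x; rewrite ltr_pdivlMr.
- move=> x y; rewrite expr_div_n c2 mulf_div ler_pM2r ?invr_gt0//.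
Qed.

(** Truncating the three functions at [n] preserves the hypothesis, since the new upper bound is
    either the old one or [n * n]; monotone convergence removes the truncation. *)
Lemma prekopa_leindler_lebesgue :
  prekopa_leindler mu (fun x y : T => (x + y) / 2 : R).
Proof.
move=> f g h mf mg mh f0 g0 h0 fgh.
pose tr (u : T -> \bar R) n x : R := fine (mine (u x) n%:R%:E).
have trE u n x : (0 <= u x)%E -> (tr u n x)%:E = mine (u x) n%:R%:E.
  move=> u0; rewrite /tr fineK// ge0_fin_numE ?le_min ?u0 ?lee_fin ?ler0n//.
  by rewrite gt_min ltry orbT.
have mtr u n : measurable_fun setT u -> measurable_fun setT (tr u n).
  move=> mu_; apply: (measurableT_comp (f := @fine R)) => //.
  exact: measurable_mine.
have tr_bd u n x : (0 <= u x)%E -> 0 <= tr u n x <= n%:R.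
  by move=> u0; rewrite -!lee_fin trE// le_min u0 lee_fin ler0n/= ge_min lexx orbT.
have cvgtr u : measurable_fun setT u -> (forall x, 0 <= u x)%E ->
   (\int[mu]_x (tr u n x)%:E)%E @[n --> \oo] --> (\int[mu]_x u x)%E.
  move=> mu_ u0.
  have := @cvg_monotone_convergence _ T R mu setT measurableT
    (fun n x => (tr u n x)%:E).
  have -> : (\int[mu]_x u x)%E = (\int[mu]_x limn (fun n => (tr u n x)%:E))%E.
    apply: eq_integral => x _; apply/esym/cvg_lim => //.
    under eq_fun do rewrite trE//.
    have [->|ux] := eqVneq (u x) +oo%E.
      under eq_fun do rewrite min_r ?leey//.
      exact/cvgenyP.
    have uf : u x \is a fin_num by rewrite ge0_fin_numE// ltey.
    apply: (@cvg_near_cst _ _ _ _ \oo).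
    near=> n; rewrite min_l// -(fineK uf) lee_fin.
    by near: n; exact: nbhs_infty_ger.
  apply.
  - by move=> n; apply/measurable_EFinP; exact: mtr.
  - by move=> n x _; rewrite lee_fin; case/andP: (tr_bd u n x (u0 x)).
  - move=> x _ i j ij; rewrite !trE// le_min ge_min lexx/=.
    by rewrite ge_min lee_fin ler_nat ij orbT.
apply: (mule_le_lim _ _ _ (cvgtr f mf f0) (cvgtr g mg g0)).
- exact: integral_ge0.
- exact: integral_ge0.
- by apply: mule_ge0; exact: integral_ge0.
move=> n; apply: (@le_trans _ _ ((\int[mu]_x (tr h n x)%:E) * (\int[mu]_x (tr h n x)%:E))%E).
  apply: (@prekopa_leindler_bounded _ _ _ n%:R); try exact: mtr.
  - by move=> x; exact: tr_bd.
  - by move=> x; exact: tr_bd.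
  - by move=> x; case/andP: (tr_bd h n x (h0 x)).
  - move=> x y; rewrite -lee_fin expr2 !EFinM !trE//.
    have := fgh x y; set H := h _; have H0 : (0 <= H)%E by exact: h0.
    move=> fgH; case: (leP H n%:R%:E) => _.
      apply: le_trans fgH; apply: lee_pmul; rewrite ?le_min ?f0 ?g0 ?lee_fin ?ler0n//.
      by rewrite ge_min lexx.
      by rewrite ge_min lexx.
    apply: lee_pmul; rewrite ?le_min ?f0 ?g0 ?lee_fin ?ler0n//.
    by rewrite ge_min lexx orbT.
    by rewrite ge_min lexx orbT.
have hle : (\int[mu]_x (tr h n x)%:E <= \int[mu]_x h x)%E.
  apply: ge0_le_integral => //.
  - by move=> x _; rewrite lee_fin; case/andP: (tr_bd h n x (h0 x)).
  - by apply/measurable_EFinP; exact: mtr.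
  - by move=> x _; rewrite trE// ge_min lexx.
have h00 : (0 <= \int[mu]_x (tr h n x)%:E)%E.
  by apply: integral_ge0 => x _; rewrite lee_fin; case/andP: (tr_bd h n x (h0 x)).
by apply: lee_pmul.
Unshelve. all: by end_near. Qed.
End prekopa_leindler_lebesgue.

(** Testing against nonnegative functions lets the property pass through the iterated integrals on
    tuples, with no integrability to carry along. *)
Definition has_density d (T : measurableType d) (R : realType)
    (mu nu : set T -> \bar R) (rho : T -> \bar R) : Prop :=
  forall f : T -> \bar R, measurable_fun setT f -> (forall x, 0 <= f x)%E ->
  (\int[nu]_x f x = \int[mu]_x (f x * rho x))%E.

Definition preserves_ge0_integral d (T : measurableType d) (R : realType)
    (mu : set T -> \bar R) (phi : T -> T) : Prop :=
  forall f : T -> \bar R, measurable_fun setT f -> (forall x, 0 <= f x)%E ->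
  (\int[mu]_x f (phi x) = \int[mu]_x f x)%E.

(** * Product measures on tuples *)

Section tuple_measure_theory.
Context d (T : measurableType d) (R : realType).
Implicit Type mu : {sigma_finite_measure set T -> \bar R}.

Lemma ge0_integral_tuple_measure0 mu (f : 0.-tuple T -> \bar R) :
  measurable_fun setT f -> (forall t, 0 <= f t)%E ->
  (\int[tuple_measure mu 0]_t f t = f [tuple])%E.
Proof. by move=> mf f0; rewrite integral_dirac// diracT mul1e. Qed.

Lemma measurable_fun_cons_tuple k (f : k.+1.-tuple T -> \bar R) (x : T) :
  measurable_fun setT f -> measurable_fun setT (fun t : k.-tuple T => f [tuple of x :: t]).
Proof.
move=> mf; apply: (measurableT_comp mf).
exact: (measurable_cons (f := fun=> x) (g := id)).
Qed.

Lemma ge0_integral_tuple_measureS mu k (f : k.+1.-tuple T -> \bar R) :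
  measurable_fun setT f -> (forall t, 0 <= f t)%E ->
  (\int[tuple_measure mu k.+1]_t f t =
   \int[mu]_x \int[tuple_measure mu k]_t f [tuple of x :: t])%E.
Proof.
move=> mf f0.
have mc : measurable_fun setT (fun p : T * k.-tuple T => [tuple of p.1 :: p.2]).
  exact: measurable_cons.
rewrite /tuple_measure -/(tuple_measure) ge0_integral_pushforward//.
rewrite fubini_tonelli1//.
  exact: (measurableT_comp mf mc).
by move=> p; exact: f0.
Qed.

Lemma measurable_fun_integral_tuple_measure mu k (f : k.+1.-tuple T -> \bar R) :
  measurable_fun setT f -> (forall t, 0 <= f t)%E ->
  measurable_fun setT (fun x => \int[tuple_measure mu k]_t f [tuple of x :: t])%E.
Proof.
move=> mf f0.
have mc : measurable_fun setT (fun p : T * k.-tuple T => [tuple of p.1 :: p.2]).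
  exact: measurable_cons.
exact: (measurable_fun_fubini_tonelli_F (m2 := tuple_measure mu k) _
  (measurableT_comp mf mc) (fun p => f0 _)).
Qed.

Lemma measurable_mktuple k (phi : 'I_k -> T -> T) :
  (forall i, measurable_fun setT (phi i)) ->
  measurable_fun setT (fun t : k.-tuple T => [tuple phi i (tnth t i) | i < k]).
Proof.
move=> mphi; apply/measurable_fun_tnthP => i.
rewrite (_ : _ \o _ = phi i \o (fun t => tnth t i)).
  by apply: measurableT_comp => //; exact: measurable_tnth.
by apply/funext => t /=; rewrite tnth_mktuple.
Qed.

Lemma mktuple_cons k (phi : 'I_k.+1 -> T -> T) x (t : k.-tuple T) :
  [tuple phi i (tnth [tuple of x :: t] i) | i < k.+1] =
  [tuple of phi ord0 x :: [tuple phi (lift ord0 i) (tnth t i) | i < k]].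
Proof.
apply/eq_from_tnth => i; rewrite tnth_mktuple.
case: (unliftP ord0 i) => [j ->|->]; last by rewrite !tnth0.
by rewrite !tnthS tnth_mktuple.
Qed.

Lemma preserves_ge0_integral_tuple mu k (phi : 'I_k -> T -> T) :
  (forall i, measurable_fun setT (phi i)) ->
  (forall i, preserves_ge0_integral mu (phi i)) ->
  preserves_ge0_integral (tuple_measure mu k)
    (fun t => [tuple phi i (tnth t i) | i < k]).
Proof.
elim: k phi => [|k ih] phi mphi pphi f mf f0.
  rewrite !ge0_integral_tuple_measure0//; first by congr f; exact: tuple0.
  exact: (measurableT_comp mf (measurable_mktuple mphi)).
have mfphi := measurableT_comp mf (measurable_mktuple mphi).
rewrite !ge0_integral_tuple_measureS//.
have pk := ih _ (fun i => mphi (lift ord0 i)) (fun i => pphi (lift ord0 i)).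
transitivity (\int[mu]_x \int[tuple_measure mu k]_t f [tuple of phi ord0 x :: t])%E.
  apply: eq_integral => x _.
  rewrite -(pk (fun t => f [tuple of phi ord0 x :: t]))//.
    by apply: eq_integral => t _; rewrite mktuple_cons.
  exact: measurable_fun_cons_tuple.
apply: (pphi ord0 (fun x => \int[tuple_measure mu k]_t f [tuple of x :: t])%E).
  exact: measurable_fun_integral_tuple_measure.
by move=> x; exact: integral_ge0.
Qed.

(** Tonelli and induction on [k]: for first coordinates [x] and [y], the inequality in the remaining
    coordinates is exactly the hypothesis of the one-coordinate inequality for the partial
    integrals. *)
Lemma prekopa_leindler_tuple mu mid k : prekopa_leindler mu mid ->
  prekopa_leindler (tuple_measure mu k)
    (fun s t => [tuple mid (tnth s i) (tnth t i) | i < k]).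
Proof.
move=> pl; elim: k => [|k ih] f g h mf mg mh f0 g0 h0 fgh.
  rewrite !ge0_integral_tuple_measure0//.
  by have := fgh [tuple] [tuple]; rewrite (tuple0 (mktuple _)).
rewrite (ge0_integral_tuple_measureS _ mf f0) (ge0_integral_tuple_measureS _ mg g0)
  (ge0_integral_tuple_measureS _ mh h0).
apply: pl.
- exact: measurable_fun_integral_tuple_measure.
- exact: measurable_fun_integral_tuple_measure.
- exact: measurable_fun_integral_tuple_measure.
- by move=> x; exact: integral_ge0.
- by move=> x; exact: integral_ge0.
- by move=> x; exact: integral_ge0.
move=> x y; apply: ih => //.
- exact: measurable_fun_cons_tuple.
- exact: measurable_fun_cons_tuple.
- exact: measurable_fun_cons_tuple.
move=> s t; apply: le_trans (fgh _ _) _.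
rewrite (_ : [tuple mid _ _ | i < k.+1] =
  [tuple of mid x y :: [tuple mid (tnth s i) (tnth t i) | i < k]])//.
apply/eq_from_tnth => i; rewrite tnth_mktuple.
case: (unliftP ord0 i) => [j ->|->]; last by rewrite !tnth0.
by rewrite !tnthS tnth_mktuple.
Qed.

Lemma measurable_prod_tnth k (rho : T -> R) : measurable_fun setT rho ->
  measurable_fun setT (fun t : k.-tuple T => \prod_(i < k) rho (tnth t i)).
Proof.
move=> mr; apply: measurable_prod => i _.
exact: (measurableT_comp mr (measurable_tnth i)).
Qed.

Lemma prod_tnth_cons k (rho : T -> R) x (t : k.-tuple T) :
  \prod_(i < k.+1) rho (tnth [tuple of x :: t] i) =
  rho x * \prod_(i < k) rho (tnth t i).
Proof.
rewrite big_ord_recl tnth0; congr (_ * _).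
by apply: eq_bigr => i _; rewrite tnthS.
Qed.

Lemma has_density_tuple (mu nu : {sigma_finite_measure set T -> \bar R}) k (rho : T -> R) : measurable_fun setT rho ->
  (forall x, 0 <= rho x) -> has_density mu nu (EFin \o rho) ->
  has_density (tuple_measure mu k) (tuple_measure nu k)
    (fun t => (\prod_(i < k) rho (tnth t i))%:E).
Proof.
move=> mr r0 nr; elim: k => [|k ih] f mf f0.
  have mfr : measurable_fun setT
      (fun t : 0.-tuple T => (f t * (\prod_(i < 0) rho (tnth t i))%:E)%E).
    apply: emeasurable_funM => //; apply/measurable_EFinP.
    exact: measurable_prod_tnth.
  rewrite !ge0_integral_tuple_measure0// ?big_ord0 ?mule1// => t.
  by rewrite mule_ge0// lee_fin prodr_ge0.
have mfr : measurable_fun setT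
    (fun t : k.+1.-tuple T => (f t * (\prod_(i < k.+1) rho (tnth t i))%:E)%E).
  apply: emeasurable_funM => //; apply/measurable_EFinP.
  exact: measurable_prod_tnth.
rewrite (ge0_integral_tuple_measureS nu)// (ge0_integral_tuple_measureS mu)//; last first.
  by move=> t; rewrite mule_ge0// lee_fin prodr_ge0.
rewrite nr; last 2 first.
- exact: measurable_fun_integral_tuple_measure.
- by move=> x; exact: integral_ge0.
apply: eq_integral => x _.
rewrite ih//; last exact: measurable_fun_cons_tuple.
rewrite -ge0_integralZr//=.
- by apply: eq_integral => t _; rewrite prod_tnth_cons mulrC EFinM muleA.
- apply: emeasurable_funM; first exact: measurable_fun_cons_tuple.
  by apply/measurable_EFinP; exact: measurable_prod_tnth.
- by move=> t _; rewrite mule_ge0// lee_fin prodr_ge0.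
- by rewrite lee_fin.
Qed.

Lemma integral_prod_tnth_lty mu k (rho : T -> R) : measurable_fun setT rho ->
  (forall x, 0 <= rho x) -> (\int[mu]_x (rho x)%:E < +oo)%E ->
  (\int[tuple_measure mu k]_t (\prod_(i < k) rho (tnth t i))%:E < +oo)%E.
Proof.
move=> mr r0 rlty; elim: k => [|k ih].
  rewrite ge0_integral_tuple_measure0 ?ltry//.
    by apply/measurable_EFinP; exact: measurable_prod_tnth.
  by move=> t; rewrite lee_fin prodr_ge0.
rewrite ge0_integral_tuple_measureS; last 2 first.
- by apply/measurable_EFinP; exact: measurable_prod_tnth.
- by move=> t; rewrite lee_fin prodr_ge0.
under eq_integral.
  move=> x _.
  have -> : (\int[tuple_measure mu k]_t
      (\prod_(i < k.+1) rho (tnth [tuple of x :: t] i))%:E =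
      (rho x)%:E * \int[tuple_measure mu k]_t (\prod_(i < k) rho (tnth t i))%:E)%E.
    rewrite -ge0_integralZl//=; last 3 first.
    - by apply/measurable_EFinP; exact: measurable_prod_tnth.
    - by move=> t _; rewrite lee_fin prodr_ge0.
    - by rewrite lee_fin.
    by apply: eq_integral => t _; rewrite prod_tnth_cons EFinM.
  over.
rewrite ge0_integralZr//=; last 3 first.
- exact/measurable_EFinP.
- by move=> x _; rewrite lee_fin.
- by apply: integral_ge0 => t _; rewrite lee_fin prodr_ge0.
apply: lte_mul_pinfty => //.
- by apply: integral_ge0 => x _; rewrite lee_fin.
- by rewrite ge0_fin_numE//; apply: integral_ge0 => x _; rewrite lee_fin.
Qed.

End tuple_measure_theory.

Section gibbs_density.
Context d (T : measurableType d) (R : realType).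

Import HBNNSimple.

(** As [gibbs] is defined on sets, the identity is checked on approximating simple functions and
    passes to the limit by monotone convergence. *)
Lemma has_density_gibbs (mu : {sigma_finite_measure set T -> \bar R}) (h : {mfun T >-> R}) :
  has_density mu (gibbs mu h) (fun x =>
    ((fine (\int[mu]_x (expR (- h x))%:E))^-1 * expR (- h x))%:E).
Proof.
move=> f mf f0.
set c := (fine _)^-1.
have c0 : 0 <= c.
  by rewrite invr_ge0 fine_ge0// integral_ge0// => x _; rewrite lee_fin expR_ge0.
have mexp : measurable_fun [set: T] (fun x => expR (- h x)).
  apply: measurableT_comp => //; exact: measurableT_comp.
pose rho x := c * expR (- h x).
have rho0 x : 0 <= rho x by rewrite mulr_ge0// expR_ge0.
have mrho : measurable_fun setT rho by exact: measurable_funM.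
have gE A : measurable A -> (gibbs mu h A = \int[mu]_(x in A) (rho x)%:E)%E.
  move=> mA; rewrite /gibbs -/c -ge0_integralZl//=.
  by apply/measurable_EFinP; exact: measurable_funTS.
pose f_ := nnsfun_approx measurableT mf.
transitivity (limn (fun n => \int[gibbs mu h]_x (f_ n x)%:E)%E).
  rewrite -monotone_convergence//.
  - apply: eq_integral => x _; apply/esym/cvg_lim => //.
    exact: cvg_nnsfun_approx.
  - by move=> n; exact/measurable_EFinP/measurable_funP.
  - by move=> n x _; rewrite lee_fin.
  - by move=> x _ i j ij; rewrite lee_fin; exact/lefP/nd_nnsfun_approx.
transitivity (limn (fun n => \int[mu]_x ((f_ n x)%:E * (rho x)%:E))%E); last first.
  rewrite -monotone_convergence//.
  - apply: eq_integral => x _.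
    apply: cvg_lim => //.
    by apply: cvgeZr => //; exact: cvg_nnsfun_approx.
  - by move=> n; apply: emeasurable_funM; apply/measurable_EFinP.
  - by move=> n x _; rewrite mule_ge0// lee_fin.
  - move=> x _ i j ij; apply: lee_wpmul2r; rewrite lee_fin//.
    by exact/lefP/nd_nnsfun_approx.
congr (limn _); apply/funext => n.
transitivity (\sum_(k \in range (f_ n))
    \int[mu]_x ((k * \1_(f_ n @^-1` [set k]) x)%:E * (rho x)%:E))%E; last first.
  rewrite -ge0_integral_fsum//.
  - apply: eq_integral => x _; rewrite -ge0_mule_fsuml//.
      by rewrite fsumEFin// -fimfunE.
    by move=> r; rewrite nnfun_muleindic_ge0.
  - by move=> r; apply: emeasurable_funM; apply/measurable_EFinP => //;
      exact: measurable_funM.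
  - by move=> r x _; rewrite mule_ge0 ?lee_fin ?rho0// -lee_fin EFinM nnfun_muleindic_ge0.
under eq_integral do rewrite fimfunE -fsumEFin//.
rewrite ge0_integral_fsum//; last 2 first.
- by move=> y; exact/measurable_EFinP/measurable_funM.
- by move=> y x _; rewrite nnfun_muleindic_ge0.
apply: eq_fsbigr => r _.
rewrite integralZl_indic_nnsfun// integral_indic//= setIT gE//.
have [r0|r0] := leP 0 r; last first.
  by rewrite preimage_nnfun0// integral_set0 mule0; under eq_integral do
    rewrite indic0 mulr0 mul0e; rewrite integral0.
rewrite integral_mkcond -ge0_integralZl//=; last 2 first.
- by apply/(measurable_restrictT _ _).1 => //; apply: measurable_funTS;
    exact/measurable_EFinP.
- by move=> x _; apply: erestrict_ge0 => y _; rewrite lee_fin.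
apply: eq_integral => x _; rewrite EFinM -muleA; congr (_ * _)%E.
by rewrite epatch_indic muleC.
Qed.
End gibbs_density.

(** * Polynomial functions of the entries and integration by parts *)

Lemma is_derive_affine (R : realType) (a b s : R) :
  is_derive s 1 (fun t => a + t * b) b.
Proof.
have h : is_derive s (1 : R) (cst a + (@id R) * cst b)
    (0 + (s *: (0 : R^o) + b *: (1 : R^o))).
  by apply: is_deriveD; apply: is_deriveM.
by apply: is_derive_eq h _; rewrite scaler0 !add0r /GRing.scale/= mulr1.
Qed.

Section polynomial_functions.
Context {R : realType} {m N : nat}.
Notation C := R[i].
Notation T := (mentries R m N).
Notation dir := ('I_m -> 'M[C]_N).

Definition mshift (h : T) (s : R) (x : T) : T :=
  [tuple [tuple tnth (tnth x k) a + s * tnth (tnth h k) a : measurableTypeR R | a < N * N] | k < m].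

Lemma herms_mshift h s x k :
  herms (mshift h s x) k = herms x k + s%:C *: herms h k.
Proof.
apply/matrixP => i j; rewrite !mxE /mshift !tnth_mktuple.
case: ltngtP => _; rewrite ?mxE /=; apply/eqP; rewrite eq_complex /=; apply/andP;
  split; apply/eqP; ring.
Qed.

(** Pairs a polynomial in the matrix entries with its formal derivative. The direction is any family
    of complex matrices, so that elementary matrices, which are not Hermitian in general, may be
    inserted. *)
Inductive polyfun : (T -> C) -> (T -> dir -> C) -> Prop :=
| polyfun_cst c : polyfun (fun=> c) (fun _ _ => 0)
| polyfun_entry k i j : polyfun (fun x => herms x k i j) (fun _ H => H k i j)
| polyfunD f Df g Dg : polyfun f Df -> polyfun g Dg ->
    polyfun (fun x => f x + g x) (fun x H => Df x H + Dg x H)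
| polyfunM f Df g Dg : polyfun f Df -> polyfun g Dg ->
    polyfun (fun x => f x * g x) (fun x H => Df x H * g x + f x * Dg x H).

Lemma eq_polyfun f Df g Dg : polyfun f Df -> f =1 g ->
  (forall x H, Df x H = Dg x H) -> polyfun g Dg.
Proof.
move=> pf /funext <- DfE; suff <- : Df = Dg by [].
by apply/funext => x; apply/funext => H.
Qed.

Lemma polyfun_sum (I : Type) (r : seq I) (P : pred I) (F : I -> T -> C)
    (DF : I -> T -> dir -> C) : (forall i, polyfun (F i) (DF i)) ->
  polyfun (fun x => \sum_(i <- r | P i) F i x) (fun x H => \sum_(i <- r | P i) DF i x H).
Proof.
move=> pF; elim: r => [|i r ih].
  by apply: eq_polyfun (polyfun_cst 0) _ _ => [x|x H]; rewrite big_nil.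
have [Pi|Pi] := boolP (P i).
  by apply: eq_polyfun (polyfunD (pF i) ih) _ _ => [x|x H]; rewrite big_cons Pi.
by apply: eq_polyfun ih _ _ => [x|x H]; rewrite big_cons (negbTE Pi).
Qed.

Lemma polyfunZ c f Df : polyfun f Df ->
  polyfun (fun x => c * f x) (fun x H => c * Df x H).
Proof.
by move=> pf; apply: eq_polyfun (polyfunM (polyfun_cst c) pf) _ _ => // x H;
  rewrite mul0r add0r.
Qed.

Lemma polyfun_linear f Df : polyfun f Df -> forall x (c : C) (H K : dir),
  Df x (fun k => c *: H k + K k) = c * Df x H + Df x K.
Proof.
elim => [c|k i j|{}f {}Df g Dg _ ihf _ ihg|{}f {}Df g Dg _ ihf _ ihg] x e H K.
- by rewrite mulr0 addr0.
- by rewrite !mxE.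
- by rewrite ihf ihg; ring.
- by rewrite ihf ihg; ring.
Qed.

Definition ispoly f := exists Df, polyfun f Df.

Lemma ispolyD f g : ispoly f -> ispoly g -> ispoly (fun x => f x + g x).
Proof. by move=> [Df pf] [Dg pg]; exact: (ex_intro _ _ (polyfunD pf pg)). Qed.

Lemma ispolyM f g : ispoly f -> ispoly g -> ispoly (fun x => f x * g x).
Proof. by move=> [Df pf] [Dg pg]; exact: (ex_intro _ _ (polyfunM pf pg)). Qed.

Lemma ispoly_cst c : ispoly (fun=> c).
Proof. exact: (ex_intro _ _ (polyfun_cst c)). Qed.

Lemma ispolyZ c f : ispoly f -> ispoly (fun x => c * f x).
Proof. exact: (ispolyM (ispoly_cst c)). Qed.

Lemma ispoly_sum (I : Type) (r : seq I) (P : pred I) (F : I -> T -> C) :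
  (forall i, ispoly (F i)) -> ispoly (fun x => \sum_(i <- r | P i) F i x).
Proof.
move=> pF; exact: (ex_intro _ _ (polyfun_sum _ _ (fun i => svalP (cid (pF i))))).
Qed.

Lemma ispoly_deriv f Df H : polyfun f Df -> ispoly (Df ^~ H).
Proof.
elim => [c|k i j|{}f {}Df g Dg _ ihf _ ihg|{}f {}Df g Dg pf ihf pg ihg].
- exact: ispoly_cst.
- exact: ispoly_cst.
- exact: ispolyD.
- by apply: ispolyD; apply: ispolyM => //; [exists Dg|exists Df].
Qed.

Lemma Re_add (a b : C) : complex.Re (a + b) = complex.Re a + complex.Re b.
Proof. by case: a b => ? ? []. Qed.

Lemma Im_add (a b : C) : complex.Im (a + b) = complex.Im a + complex.Im b.
Proof. by case: a b => ? ? []. Qed.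

Lemma Re_mul (a b : C) : complex.Re (a * b) =
  complex.Re a * complex.Re b - complex.Im a * complex.Im b.
Proof. by case: a b => ? ? []. Qed.

Lemma Im_mul (a b : C) : complex.Im (a * b) =
  complex.Re a * complex.Im b + complex.Im a * complex.Re b.
Proof. by case: a b => ? ? []. Qed.

(** Translations of the real entries realize only Hermitian directions, so the formal derivative is
    an actual one only there; the other directions are reached by complex linearity. *)
Lemma polyfun_is_derive f Df : polyfun f Df -> forall (h x : T) (s : R),
  is_derive s 1 (fun t => complex.Re (f (mshift h t x)))
    (complex.Re (Df (mshift h s x) (herms h))) /\
  is_derive s 1 (fun t => complex.Im (f (mshift h t x)))
    (complex.Im (Df (mshift h s x) (herms h))).
Proof.
elim => [c|k i j|{}f {}Df g Dg _ ihf _ ihg|{}f {}Df g Dg _ ihf _ ihg] h x s.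
- by split; exact: is_derive_cst.
- split.
    rewrite (_ : (fun t => _) = (fun t => complex.Re (herms x k i j)
      + t * complex.Re (herms h k i j))); last first.
      by apply/funext => t; rewrite herms_mshift mxE [X in _ + X]mxE Re_add Re_mul/= mul0r subr0.
    exact: is_derive_affine.
  rewrite (_ : (fun t => _) = (fun t => complex.Im (herms x k i j)
    + t * complex.Im (herms h k i j))); last first.
    by apply/funext => t; rewrite herms_mshift mxE [X in _ + X]mxE Im_add Im_mul/= mul0r addr0.
  exact: is_derive_affine.
- have [? ?] := ihf h x s; have [? ?] := ihg h x s.
  split.
    under eq_fun do rewrite Re_add.
    by rewrite Re_add; apply: is_deriveD.
  under eq_fun do rewrite Im_add.
  by rewrite Im_add; apply: is_deriveD.
have [? ?] := ihf h x s; have [? ?] := ihg h x s.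
split.
  under eq_fun do rewrite Re_mul.
  apply: is_derive_eq; rewrite Re_add !Re_mul /GRing.scale/=; ring.
under eq_fun do rewrite Im_mul.
apply: is_derive_eq; rewrite Im_add !Im_mul /GRing.scale/=; ring.
Qed.

End polynomial_functions.

(** * Gaussian integrability and polynomial growth *)

Section gaussian_integrability.
Context {R : realType}.

Lemma integral_gaussian_lty (e : R) : 0 < e ->
  (\int[@lebesgue_measure R]_x (expR (- (e * x ^+ 2)))%:E < +oo)%E.
Proof.
move=> e0; pose s := Num.sqrt (2 * e)^-1.
have s0 : 0 < s by rewrite sqrtr_gt0 invr_gt0 mulr_gt0.
have s2 : s ^+ 2 = (2 * e)^-1 by rewrite sqr_sqrtr// invr_ge0 ltW// mulr_gt0.
have sn0 : s != 0 by exact: lt0r_neq0.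
have p0 : 0 < normal_peak s by exact: normal_peak_gt0.
have E x : (expR (- (e * x ^+ 2)))%:E =
    ((normal_peak s)^-1%:E * (normal_pdf 0 s x)%:E)%E.
  rewrite /normal_pdf (negbTE sn0) /normal_fun -EFinM mulKf ?lt0r_neq0//.
  congr (expR _)%:E; rewrite subr0 s2 -mulNr -mulr_natl.
  by field; rewrite lt0r_neq0.
under eq_integral do rewrite E.
rewrite ge0_integralZl//=.
- by rewrite integral_normal_pdf// mule1 ltry.
- by apply/measurable_EFinP; exact: measurable_normal_pdf.
- by move=> x _; rewrite lee_fin normal_pdf_ge0.
- by rewrite lee_fin invr_ge0 ltW.
Qed.

(** With [d = e / p], the chain [1 + y <= K * (1 + d * y) <= K * expR (d * y)] is raised to the
    power [p]. *)
Lemma poly_le_expR (p : nat) (e : R) : 0 < e ->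
  exists M : R, 0 <= M /\ forall y, 0 <= y -> (1 + y) ^+ p <= M * expR (e * y).
Proof.
move=> e0; have [->|p0] := posnP p.
  exists 1; split => // y y0.
  by rewrite expr0 mul1r -expR0 ler_expR mulr_ge0// ltW.
pose d := e / p%:R; pose K := Num.max 1 d^-1.
have pR : 0 < p%:R :> R by rewrite ltr0n.
have d0 : 0 < d by rewrite divr_gt0.
have K1 : 1 <= K by rewrite le_max lexx.
have Kd : 1 <= K * d by rewrite -ler_pdivrMr// mul1r le_max lexx orbT.
exists (K ^+ p); split; first by rewrite exprn_ge0// (le_trans ler01).
move=> y y0.
have -> : e * y = p%:R * (d * y).
  by rewrite /d; field; rewrite lt0r_neq0.
rewrite expRM_natl -exprMn ler_pXn2r ?nnegrE//.
- apply: le_trans (_ : K * (1 + d * y) <= _).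
    rewrite mulrDr mulr1 mulrA lerD//.
    by rewrite -[leLHS]mul1r ler_wpM2r.
  by rewrite ler_pM2l ?expR_ge1Dx// (lt_le_trans ltr01).
- by rewrite addr_ge0.
- by rewrite mulr_ge0 ?expR_ge0// (le_trans ler01).
Qed.

End gaussian_integrability.

Section matrix_growth.
Context {R : realType} {m N : nat}.
Notation C := R[i].
Notation T := (mentries R m N).

Definition mleb : set T -> \bar R :=
  tuple_measure (tuple_measure (@lebesgue_measure R) (N * N)) m.

HB.instance Definition _ := SigmaFiniteMeasure.copy mleb
  (tuple_measure (tuple_measure (@lebesgue_measure R) (N * N)) m).

Definition sqnorm (x : T) : R := \sum_k trace_sqr (herms x k).

Lemma herm_conj (x : entries R N) i j : herm x j i = (herm x i j)^*.
Proof. by move: i j; apply/hermitian_ofP; eexists. Qed.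

Definition csqr (z : C) : R := complex.Re z ^+ 2 + complex.Im z ^+ 2.

Lemma csqr_ge0 z : 0 <= csqr z. Proof. by rewrite addr_ge0 ?sqr_ge0. Qed.

Lemma trace_sqr_hermE (x : entries R N) :
  trace_sqr (herm x) = \sum_i \sum_j csqr (herm x i j).
Proof.
rewrite /trace_sqr raddf_sum; apply: eq_bigr => i _.
rewrite mxE raddf_sum; apply: eq_bigr => j _ /=.
rewrite (herm_conj x i j) /csqr; case: (herm x i j) => a b /=.
by rewrite !expr2; ring.
Qed.

(** Off-diagonal entries are counted twice in the trace, hence only an inequality. *)
Lemma entries_le_trace_sqr (x : entries R N) :
  \sum_a tnth x a ^+ 2 <= trace_sqr (herm x) :> R.
Proof.
rewrite trace_sqr_hermE.
rewrite (reindex _ (curry_mxvec_bij N N))/=.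
rewrite (eq_bigr (fun p : 'I_N * 'I_N => tnth x (mxvec_index p.1 p.2) ^+ 2 : R)); last first.
  by move=> [].
rewrite -(pair_bigA _ (fun i j => tnth x (mxvec_index i j) ^+ 2 : R))/=.
apply: ler_sum => i _; apply: ler_sum => j _.
rewrite /csqr !mxE; case: ltngtP => [_|_|/val_inj <-] /=; rewrite ?mxE.
- by rewrite lerDl sqr_ge0.
- by rewrite sqrrN lerDr sqr_ge0.
- by rewrite lerDl sqr_ge0.
Qed.

Lemma sqnorm_ge0 x : 0 <= sqnorm x.
Proof.
apply: sumr_ge0 => k _; rewrite trace_sqr_hermE.
by apply: sumr_ge0 => i _; apply: sumr_ge0 => j _; exact: csqr_ge0.
Qed.

Lemma ler_term_sum (I : finType) (F : I -> R) (i : I) : (forall j, 0 <= F j) ->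
  F i <= \sum_j F j.
Proof.
by move=> F0; rewrite (bigD1 i)//= lerDl sumr_ge0.
Qed.

Lemma csqr_le_sqnorm x k i j : csqr (herms x k i j) <= sqnorm x.
Proof.
apply: le_trans (ler_term_sum k _); last first.
  move=> l; rewrite trace_sqr_hermE.
  by apply: sumr_ge0 => ? _; apply: sumr_ge0 => ? _; exact: csqr_ge0.
rewrite trace_sqr_hermE; apply: le_trans (ler_term_sum i _); last first.
  by move=> l; apply: sumr_ge0 => ? _; exact: csqr_ge0.
by apply: (ler_term_sum (F := fun j => csqr (herms x k i j))) => l; exact: csqr_ge0.
Qed.

Lemma polyfun_growth f Df : @polyfun R m N f Df -> exists (K : R) (p : nat), 0 <= K /\ forall x,
  `|complex.Re (f x)| <= K * (1 + sqnorm x) ^+ p /\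
  `|complex.Im (f x)| <= K * (1 + sqnorm x) ^+ p.
Proof.
have S1 x : 1 <= 1 + sqnorm x by rewrite lerDl sqnorm_ge0.
elim => [c|k i j|{}f {}Df g Dg _ [K [p [K0 ihf]]] _ [L [q [L0 ihg]]]
                |{}f {}Df g Dg _ [K [p [K0 ihf]]] _ [L [q [L0 ihg]]]].
- exists (`|complex.Re c| + `|complex.Im c|), 0%N; split; first by rewrite addr_ge0.
  by move=> x; rewrite expr0 mulr1 lerDl lerDr !normr_ge0.
- exists 1, 1%N; split => // x; rewrite mul1r expr1.
  have h := csqr_le_sqnorm x k i j; rewrite /csqr in h.
  have hn (a : R) : `|a| <= 1 + a ^+ 2.
    by rewrite -real_normK ?num_real//; have := sqr_ge0 (`|a| - 1); have := normr_ge0 a; nra.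
  split; [apply: le_trans (hn _) _|apply: le_trans (hn _) _]; rewrite lerD2l;
    apply: le_trans h; by rewrite ?lerDl ?lerDr sqr_ge0.
- exists (K + L), (p + q)%N; split; first exact: addr_ge0.
  move=> x; have [f1 f2] := ihf x; have [g1 g2] := ihg x.
  have hp : (1 + sqnorm x) ^+ p <= (1 + sqnorm x) ^+ (p + q).
    by rewrite ler_weXn2l// leq_addr.
  have hq : (1 + sqnorm x) ^+ q <= (1 + sqnorm x) ^+ (p + q).
    by rewrite ler_weXn2l// leq_addl.
  have hK := ler_wpM2l K0 hp; have hL := ler_wpM2l L0 hq.
  rewrite Re_add Im_add mulrDl; split; apply: le_trans (ler_normD _ _) _; lra.
- exists (2 * (K * L)), (p + q)%N; split; first by rewrite !mulr_ge0.
  move=> x; have [f1 f2] := ihf x; have [g1 g2] := ihg x.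
  have hm (a b : R) : `|a| <= K * (1 + sqnorm x) ^+ p -> `|b| <= L * (1 + sqnorm x) ^+ q ->
      `|a * b| <= K * L * (1 + sqnorm x) ^+ (p + q).
    by move=> ha hb; rewrite normrM exprD mulrACA ler_pM.
  rewrite Re_mul Im_mul; split.
    apply: le_trans (ler_normB _ _) _.
    by have := hm _ _ f1 g1; have := hm _ _ f2 g2; lra.
  apply: le_trans (ler_normD _ _) _.
  by have := hm _ _ f1 g2; have := hm _ _ f2 g1; lra.
Qed.

Lemma measurable_entry (k : 'I_m) (a : 'I_(N * N)) :
  measurable_fun setT (fun x : T => tnth (tnth x k) a : R).
Proof.
exact: (measurableT_comp (measurable_tnth a) (measurable_tnth k)).
Qed.

Lemma polyfun_measurable f Df : @polyfun R m N f Df ->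
  measurable_fun setT (fun x => complex.Re (f x)) /\
  measurable_fun setT (fun x => complex.Im (f x)).
Proof.
elim => [c|k i j|{}f {}Df g Dg _ [f1 f2] _ [g1 g2]|{}f {}Df g Dg _ [f1 f2] _ [g1 g2]].
- by split; exact: measurable_cst.
- under eq_fun do rewrite !mxE.
  under [X in _ /\ measurable_fun _ X]eq_fun do rewrite !mxE.
  case: ltngtP => _ /=; split; try exact: measurable_entry; try exact: measurable_cst.
  by apply: measurable_funN; exact: measurable_entry.
- split.
    under eq_fun do rewrite Re_add; exact: measurable_funD.
  under eq_fun do rewrite Im_add; exact: measurable_funD.
- split.
    under eq_fun do rewrite Re_mul; apply: measurable_funB; exact: measurable_funM.
  under eq_fun do rewrite Im_mul; apply: measurable_funD; exact: measurable_funM.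
Qed.

End matrix_growth.

(** * Integration by parts for Lebesgue measure *)

Section integration_by_parts.
Context {R : realType} {m N : nat}.
Notation C := R[i].
Notation T := (mentries R m N).
Notation leb := (@lebesgue_measure R).
Notation mleb := (@mleb R m N).

Lemma ge0_integral_mshift (h : T) (s : R) : preserves_ge0_integral mleb (mshift h s).
Proof.
pose e := tuple_measure leb (N * N).
pose p1 k a (y : measurableTypeR R) : measurableTypeR R := y + s * tnth (tnth h k) a.
have mp1 k a : measurable_fun setT (p1 k a) by exact: measurable_funD.
pose p2 k (t : entries R N) : entries R N := [tuple p1 k a (tnth t a) | a < N * N].
have := @preserves_ge0_integral_tuple _ _ R e m p2.
apply; first by move=> k; exact: measurable_mktuple.
move=> k; apply: preserves_ge0_integral_tuple => // a f mf f0.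
exact: ge0_integral_lebesgue_shift.
Qed.

Lemma measurable_mshift2 (h : T) :
  measurable_fun setT (fun p : T * measurableTypeR R => mshift h p.2 p.1).
Proof.
apply/measurable_fun_tnthP => k; apply/measurable_fun_tnthP => a.
rewrite (_ : _ \o _ = fun p : T * measurableTypeR R =>
    (tnth (tnth p.1 k) a + p.2 * tnth (tnth h k) a : measurableTypeR R)); last first.
  by apply/funext => p /=; rewrite !tnth_mktuple.
apply: measurable_funD.
  exact: (measurableT_comp (measurable_entry k a)).
by apply: measurable_funM.
Qed.

Lemma measurable_mshift (h : T) s : measurable_fun setT (mshift h s).
Proof. exact: (measurableT_comp (measurable_mshift2 h) (measurable_pair2 s)). Qed.

Lemma mshift0 (h x : T) : mshift h 0 x = x.
Proof.
apply/eq_from_tnth => k; apply/eq_from_tnth => a.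
by rewrite !tnth_mktuple mul0r addr0.
Qed.

Lemma integral_mshift (h : T) s (f : T -> R) : mleb.-integrable setT (EFin \o f) ->
  mleb.-integrable setT (EFin \o (fun x => f (mshift h s x))) /\
  (\int[mleb]_x (f (mshift h s x))%:E = \int[mleb]_x (f x)%:E)%E.
Proof.
move=> /integrableP[mf fi].
have pres := @ge0_integral_mshift h s.
have mfs := measurableT_comp mf (measurable_mshift h s).
split.
  apply/integrableP; split => //.
  by rewrite (pres (fun x => `|(f x)%:E|)%E)//; exact: measurableT_comp.
rewrite integralE [RHS]integralE.
congr (_ - _)%E.
  rewrite -[RHS](pres (fun x => ((EFin \o f)^\+ x)%E)) => [|| x].
  - by apply: eq_integral => x _; rewrite !funeposE.
  - exact: measurable_funepos.
  - by rewrite funeposE le_max lexx orbT.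
rewrite -[RHS](pres (fun x => ((EFin \o f)^\- x)%E)) => [|| x].
- by apply: eq_integral => x _; rewrite !funenegE.
- exact: measurable_funeneg.
- by rewrite funenegE le_max lexx orbT.
Qed.

(** Fubini for [F' (x + s h)] with [s] in [[0, 1]]: integrating over [s] first gives the integral of
    [F (x + h) - F x], which is zero by translation invariance; integrating over [x] first gives the
    integral of [F']. Integrability replaces any control of boundary terms. *)
Lemma integral_directional_derivative0 (h : T) (F F' : T -> R) :
  mleb.-integrable setT (EFin \o F) -> mleb.-integrable setT (EFin \o F') ->
  (forall x s, is_derive s (1 : R) (fun t => F (mshift h t x)) (F' (mshift h s x))) ->
  (forall x, continuous (fun s => F' (mshift h s x))) ->
  (\int[mleb]_x (F' x)%:E = 0)%E.
Proof.
move=> iF iF' dF cF'.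
pose g (p : T * measurableTypeR R) : R :=
  F' (mshift h p.2 p.1) * \1_(`[0, 1]%classic : set R) (p.2 : R).
have mF' : measurable_fun setT F'.
  by have /integrableP[/measurable_EFinP] := iF'.
have mg : measurable_fun setT g.
  apply: measurable_funM.
    exact: (measurableT_comp mF' (measurable_mshift2 h)).
  exact: measurableT_comp.
have gE (p : T * measurableTypeR R) : (`[0, 1]%classic : set R) p.2 -> g p = F' (mshift h p.2 p.1).
  by move=> p01; rewrite /g indicE mem_set// mulr1.
have gN (p : T * measurableTypeR R) : ~ (`[0, 1]%classic : set R) p.2 -> g p = 0.
  by move=> p01; rewrite /g indicE memNset// mulr0.
have restr (G : R -> \bar R) (G' : R -> \bar R) :
    (forall s, (`[0, 1]%classic : set R) s -> G s = G' s) ->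
    (forall s, ~ (`[0, 1]%classic : set R) s -> G s = 0%E) ->
    (\int[leb]_s G s = \int[leb]_(s in `[0%R, 1%R]) G' s)%E.
  move=> GG' G0; rewrite [RHS]integral_mkcond; apply: eq_integral => s _.
  rewrite patchE; case: ifPn => [/set_mem /GG'//|/negP sn].
  by apply: G0 => s01; apply: sn; exact: mem_set.
have cst01 (c : \bar R) : (\int[leb]_(s in `[0%R, 1%R]) c = c)%E.
  rewrite integral_cst//; transitivity (c * leb `[0%R, 1%R]%classic)%E => //.
  by rewrite lebesgue_measure_itv/= lte_fin ltr01 -EFinB subr0 mule1.
have ig : (mleb \x leb)%E.-integrable setT (EFin \o g).
  apply/integrable21ltyP; first exact/measurable_EFinP.
  rewrite (restr _ (fun=> \int[mleb]_x `|(F' x)%:E|)%E).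
  - by rewrite cst01; have /integrableP[] := iF'.
  - move=> s s01.
    have [iFs _] := integral_mshift h s iF'.
    rewrite -(ge0_integral_mshift h s (f := fun x => `|(F' x)%:E|)%E)//.
      by apply: eq_integral => x _; rewrite /= gE.
    by apply: measurableT_comp => //; exact/measurable_EFinP.
  - by move=> s s01; rewrite integral0_eq// => x _; rewrite /= gN// normr0.
have := Fubini ig.
have inner x : (\int[leb]_s (EFin \o g) (x, s) = (F (mshift h 1 x) - F x)%:E)%E.
  rewrite (restr _ (fun s => (F' (mshift h s x))%:E)).
  - rewrite (@continuous_FTC2 _ (fun s => F' (mshift h s x)) (fun s => F (mshift h s x)))//.
    + by rewrite mshift0 EFinB.
    + by apply: continuous_subspaceT; exact: cF'.
    + have cF s : {for s, continuous (fun t => F (mshift h t x))}.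
        apply: differentiable_continuous; apply/derivable1_diffP.
        exact: ex_derive.
      split.
      * by move=> s _; exact: ex_derive.
      * by apply: cvg_at_right_filter; exact: cF.
      * by apply: cvg_at_left_filter; exact: cF.
    + by move=> s _; rewrite derive1E; apply: derive_val.
  - by move=> s s01; rewrite /= gE.
  - by move=> s s01; rewrite /= gN.
under eq_integral do rewrite inner.
have [iF1 F1E] := integral_mshift h 1 iF.
under eq_integral do rewrite EFinB.
rewrite integralB_EFin// F1E subee; last exact: integrable_fin_num.
move=> ->.
rewrite (restr _ (fun=> \int[mleb]_x (F' x)%:E)%E).
- by rewrite cst01.
- move=> s s01; have [_ <-] := integral_mshift h s iF'.
  by apply: eq_integral => x _; rewrite /= gE.
- by move=> s s01; rewrite integral0_eq// => x _; rewrite /= gN.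
Qed.

End integration_by_parts.

(** * Integration by parts against a coercive weight *)

Section weighted_integral.
Context {R : realType} {m N : nat}.
Notation C := R[i].
Notation T := (mentries R m N).
Notation mleb := (@mleb R m N).
Notation dir := ('I_m -> 'M[C]_N).

Lemma measurable_sqnorm : measurable_fun setT (@sqnorm R m N).
Proof.
apply: measurable_sum => k; rewrite /herms.
by apply: measurable_trace_sqr_herm; exact: measurable_tnth.
Qed.

Lemma integrable_gaussian_sqnorm (d : R) : 0 < d ->
  mleb.-integrable setT (EFin \o (fun x => expR (- (d * sqnorm x)))).
Proof.
move=> d0.
have msq : measurable_fun setT (fun x : T => expR (- (d * sqnorm x)) : R).
  apply: measurableT_comp => //; apply: measurable_funN.
  by apply: measurable_funM => //; exact: measurable_sqnorm.
apply/integrableP; split; first exact/measurable_EFinP.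
pose rho1 (y : measurableTypeR R) : R := expR (- (d * y ^+ 2)).
have mrho1 : measurable_fun setT rho1.
  apply: measurableT_comp => //; apply: measurable_funN.
  by apply: measurable_funM => //; exact: measurable_funX.
pose rho2 (t : entries R N) : R := \prod_(a < N * N) rho1 (tnth t a).
have mrho2 : measurable_fun setT rho2 by exact: measurable_prod_tnth.
have rho20 t : 0 <= rho2 t by apply: prodr_ge0 => a _; exact: expR_ge0.
have h2 : (\int[tuple_measure (@lebesgue_measure R) (N * N)]_t (rho2 t)%:E < +oo)%E.
  apply: integral_prod_tnth_lty => // [x|]; first exact: expR_ge0.
  exact: integral_gaussian_lty.
have := integral_prod_tnth_lty m mrho2 rho20 h2.
apply: le_lt_trans; apply: ge0_le_integral => //.
- by apply/measurable_EFinP; exact: measurableT_comp.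
- by apply/measurable_EFinP; exact: measurable_prod_tnth.
move=> x _; rewrite /= lee_fin ger0_norm ?expR_ge0//.
rewrite /rho2 (eq_bigr (fun k => expR (- (d * \sum_a tnth (tnth x k) a ^+ 2)))); last first.
  by move=> k _; rewrite /rho1 -expR_sum; congr expR; rewrite mulr_sumr sumrN.
rewrite -expR_sum ler_expR sumrN lerN2 -mulr_sumr ler_pM2l//.
by apply: ler_sum => k _; exact: entries_le_trace_sqr.
Qed.

Variables (u : T -> C) (Du : T -> dir -> C).
Hypothesis pu : polyfun u Du.
Hypothesis u_real : forall x, complex.Im (u x) = 0.
Variables (delta K : R).
Hypothesis delta_gt0 : 0 < delta.
Hypothesis u_coercive : forall x, delta * sqnorm x - K <= complex.Re (u x).

Definition weight (x : T) : R := expR (- complex.Re (u x)).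

Definition wint (f : T -> C) : C :=
  (\int[mleb]_x (complex.Re (f x) * weight x)) +i*
  (\int[mleb]_x (complex.Im (f x) * weight x)).

Lemma measurable_weight : measurable_fun setT weight.
Proof.
apply: measurableT_comp => //; apply: measurable_funN.
by have [] := polyfun_measurable pu.
Qed.

(** Half of the coercivity absorbs the polynomial growth, the other half leaves an integrable
    Gaussian. *)
Lemma integrable_weight_growth (g : T -> R) (L : R) (p : nat) : 0 <= L ->
  measurable_fun setT g -> (forall x, `|g x| <= L * (1 + sqnorm x) ^+ p) ->
  mleb.-integrable setT (EFin \o (fun x => g x * weight x)).
Proof.
move=> L0 mg gL.
have d20 : 0 < delta / 2 by rewrite divr_gt0.
have [M [M0 Mexp]] := @poly_le_expR R p _ d20.
have := integrable_gaussian_sqnorm d20.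
move=> /(integrableZl measurableT (L * M * expR K)).
apply: le_integrable => //.
  apply/measurable_EFinP; apply: measurable_funM => //.
  exact: measurable_weight.
move=> x _; rewrite /= lee_fin.
have LM0 : 0 <= L * M * expR K by rewrite !mulr_ge0// expR_ge0.
rewrite [leRHS]ger0_norm ?mulr_ge0 ?expR_ge0//.
rewrite normrM (ger0_norm (expR_ge0 _)).
apply: le_trans (_ : L * (M * expR (delta / 2 * sqnorm x)) * expR (K - delta * sqnorm x) <= _).
  apply: ler_pM; rewrite ?expR_ge0//.
    apply: le_trans (gL x) _; rewrite ler_wpM2l// Mexp//; exact: sqnorm_ge0.
  by rewrite ler_expR; have := u_coercive x; lra.
rewrite -!mulrA -2!expRD; apply: ler_wpM2l => //; apply: ler_wpM2l => //.
by rewrite ler_expR; lra.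
Qed.

Lemma integrable_wint f : ispoly f ->
  mleb.-integrable setT (EFin \o (fun x => complex.Re (f x) * weight x)) /\
  mleb.-integrable setT (EFin \o (fun x => complex.Im (f x) * weight x)).
Proof.
move=> [Df pf]; have [m1 m2] := polyfun_measurable pf.
have [L [p [L0 hL]]] := polyfun_growth pf.
by split; apply: (@integrable_weight_growth _ L p) => // x; case: (hL x).
Qed.

Lemma wintD f g : ispoly f -> ispoly g ->
  wint (fun x => f x + g x) = wint f + wint g.
Proof.
move=> pf pg; have [f1 f2] := integrable_wint pf; have [g1 g2] := integrable_wint pg.
rewrite /wint; apply/eqP; rewrite eq_complex /=; apply/andP; split; apply/eqP.
  by rewrite -RintegralD//; apply: eq_Rintegral => x _; rewrite Re_add mulrDl.
by rewrite -RintegralD//; apply: eq_Rintegral => x _; rewrite Im_add mulrDl.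
Qed.

Lemma wintZ c f : ispoly f -> wint (fun x => c * f x) = c * wint f.
Proof.
move=> pf; have [f1 f2] := integrable_wint pf.
have iZ (a : R) (g : T -> R) : mleb.-integrable setT (EFin \o g) ->
    mleb.-integrable setT (EFin \o (fun x => a * g x)).
  by move=> ig; exact: (integrableZl measurableT a ig).
rewrite /wint; case: c => a b; apply/eqP; rewrite eq_complex /=; apply/andP; split; apply/eqP.
  rewrite -!RintegralZl// -RintegralB//; try exact: iZ.
  by apply: eq_Rintegral => x _; case: (f x) => s t /=; ring.
rewrite -!RintegralZl// -RintegralD//; try exact: iZ.
by apply: eq_Rintegral => x _; case: (f x) => s t /=; ring.
Qed.

Lemma wint0 : wint (fun=> 0) = 0.
Proof.
rewrite -[RHS](mul0r (wint (fun=> 0))) -(wintZ 0 (ispoly_cst 0)).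
by congr wint; apply/funext => x; rewrite mul0r.
Qed.

Lemma wint_sum (I : Type) (r : seq I) (P : pred I) (F : I -> T -> C) :
  (forall i, ispoly (F i)) ->
  wint (fun x => \sum_(i <- r | P i) F i x) = \sum_(i <- r | P i) wint (F i).
Proof.
move=> pF; elim: r => [|i r ih].
  by rewrite big_nil -[RHS]wint0; congr wint; apply/funext => x; rewrite big_nil.
rewrite big_cons -ih; case: ifPn => Pi; last first.
  by congr wint; apply/funext => x; rewrite big_cons (negbTE Pi).
rewrite -wintD//; last exact: ispoly_sum.
by congr wint; apply/funext => x; rewrite big_cons Pi.
Qed.

Lemma Im_Du x h : complex.Im (Du x (herms h)) = 0.
Proof.
have [_ h2] := polyfun_is_derive pu h x 0.
rewrite mshift0 in h2.
have h3 : is_derive (0 : R) (1 : R) (fun t => complex.Im (u (mshift h t x))) (0 : R).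
  by under eq_fun do rewrite u_real; exact: is_derive_cst.
by have := @derive_val _ _ _ _ _ _ _ h2; have := @derive_val _ _ _ _ _ _ _ h3; move=> -> <-.
Qed.

Lemma is_derive_mul_weight (g : R -> R) (dg s : R) (h x : T) :
  is_derive s (1 : R) g dg ->
  is_derive s (1 : R) (fun t => g t * weight (mshift h t x))
    ((dg - g s * complex.Re (Du (mshift h s x) (herms h))) * weight (mshift h s x)).
Proof.
move=> hg; have [hu _] := polyfun_is_derive pu h x s.
have hw : is_derive s (1 : R) (fun t => weight (mshift h t x))
    (- complex.Re (Du (mshift h s x) (herms h)) * weight (mshift h s x)).
  have hN : is_derive s (1 : R) (fun t => - complex.Re (u (mshift h t x)))
    (- complex.Re (Du (mshift h s x) (herms h))) by apply: is_deriveN.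
  have := is_derive1_comp (is_derive_expR _) hN.
  by rewrite mulrC.
apply: is_derive_eq; rewrite /GRing.scale/=; ring.
Qed.

Lemma herms_surj (H : 'I_m -> 'M[C]_N) :
  (forall k i j, H k j i = (H k i j)^*) -> exists h : T, H = herms h.
Proof.
move=> hH.
have ex k : exists t : entries R N, H k = herm t.
  have [x Hx] := (hermitian_ofP (H k)).1 (hH k).
  exists [tuple mxvec x 0 a | a < N * N]; rewrite Hx /herm.
  congr hermitian_of; apply/matrixP => i j.
  by rewrite mxE tnth_mktuple mxvecE.
exists [tuple sval (cid (ex k)) | k < m]; apply/funext => k.
by rewrite /herms tnth_mktuple; exact: svalP (cid (ex k)).
Qed.

Lemma dir_decomp (H : dir) : exists h1 h2 : T,
  H = (fun k => 'i%C *: herms h2 k + herms h1 k).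
Proof.
pose rh (z : C) := complex.Re z; pose ih (z : C) := complex.Im z.
pose A k : 'M[C]_N := \matrix_(i, j)
  (((rh (H k i j) + rh (H k j i)) / 2) +i* ((ih (H k i j) - ih (H k j i)) / 2)).
pose B k : 'M[C]_N := \matrix_(i, j)
  (((ih (H k i j) + ih (H k j i)) / 2) +i* ((rh (H k j i) - rh (H k i j)) / 2)).
have [h1 h1E] : exists h : T, A = herms h.
  apply: herms_surj => k i j; rewrite !mxE /=.
  by congr (_ +i* _); [congr (_ / 2); exact: addrC|rewrite -mulNr opprB].
have [h2 h2E] : exists h : T, B = herms h.
  apply: herms_surj => k i j; rewrite !mxE /=.
  by congr (_ +i* _); [congr (_ / 2); exact: addrC|rewrite -mulNr opprB].
exists h1, h2; rewrite -h1E -h2E; apply/funext => k; apply/matrixP => i j.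
rewrite !mxE /rh /ih; case: (H k i j) => a b; case: (H k j i) => c d.
by apply/eqP; rewrite eq_complex /=; apply/andP; split; apply/eqP; field.
Qed.

Lemma is_derive_continuous (g dg : R -> R) :
  (forall s, is_derive s (1 : R) g (dg s)) -> continuous g.
Proof.
move=> hg s; apply: differentiable_continuous; apply/derivable1_diffP.
by case: (hg s).
Qed.

(** Along a Hermitian direction the derivative of [f] times the weight is [(Df - f Du)] times the
    weight and integrates to zero. Both sides are complex linear in the direction, which gives the
    other ones. *)
Lemma wint_ibp f Df : polyfun f Df -> forall H : dir,
  wint (Df ^~ H) = wint (fun x => f x * Du x H).
Proof.
move=> pf.
have real_dir h : wint (Df ^~ (herms h)) = wint (fun x => f x * Du x (herms h)).
  pose H := herms h.
  have pDf : ispoly (Df ^~ H) by exact: ispoly_deriv pf.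
  have pDu : ispoly (fun x => f x * Du x H).
    by apply: ispolyM; [exists Df|exact: ispoly_deriv pu].
  have pq : ispoly (fun x => Df x H + (-1) * (f x * Du x H)).
    by apply: ispolyD => //; exact: ispolyZ.
  suff q0 : wint (fun x => Df x H + (-1) * (f x * Du x H)) = 0.
    apply/eqP; rewrite -subr_eq0 -q0 wintD ?wintZ ?mulN1r//.
    exact: ispolyZ.
  have [q1 q2] := integrable_wint pq; have [f1 f2] := @integrable_wint f (ex_intro _ _ pf).
  have [Dq pq'] := pq.
  have ReE x : complex.Re (Df x H + (-1) * (f x * Du x H)) =
      complex.Re (Df x H) - complex.Re (f x) * complex.Re (Du x H).
    by rewrite Re_add !Re_mul /= oppr0 mul0r Im_Du; ring.
  have ImE x : complex.Im (Df x H + (-1) * (f x * Du x H)) =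
      complex.Im (Df x H) - complex.Im (f x) * complex.Re (Du x H).
    by rewrite Im_add !Im_mul /= oppr0 mul0r Im_Du; ring.
  have e1 : (\int[mleb]_x
      (complex.Re (Df x H + (-1) * (f x * Du x H)) * weight x)%:E = 0)%E.
    apply: (integral_directional_derivative0 (h := h) f1 q1) => [x s|x].
      have [hs _] := polyfun_is_derive pf h x s.
      by rewrite ReE; exact: is_derive_mul_weight hs.
    apply: is_derive_continuous => s.
    have [hs _] := polyfun_is_derive pq' h x s.
    exact: is_derive_mul_weight hs.
  have e2 : (\int[mleb]_x
      (complex.Im (Df x H + (-1) * (f x * Du x H)) * weight x)%:E = 0)%E.
    apply: (integral_directional_derivative0 (h := h) f2 q2) => [x s|x].
      have [_ hs] := polyfun_is_derive pf h x s.
      by rewrite ImE; exact: is_derive_mul_weight hs.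
    apply: is_derive_continuous => s.
    have [_ hs] := polyfun_is_derive pq' h x s.
    exact: is_derive_mul_weight hs.
  by rewrite /wint /Rintegral e1 e2.
move=> H; have [h1 [h2 ->]] := dir_decomp H.
under eq_fun do rewrite (polyfun_linear pf).
rewrite wintD ?wintZ ?real_dir; try exact: ispolyZ (ispoly_deriv _ pf);
  try exact: ispoly_deriv pf.
have pDu h : ispoly (fun x => f x * Du x (herms h)).
  by apply: ispolyM; [exists Df|exact: ispoly_deriv pu].
rewrite -wintZ// -wintD//; last exact: ispolyZ.
congr wint; apply/funext => x; rewrite (polyfun_linear pu); ring.
Qed.

End weighted_integral.

(** * Loop equations *)

Section words.
Context {R : realType} {m : nat}.
Notation C := R[i].
Implicit Types (w v : word m) (W : seq (word m)).

(** One pair for each occurrence of [i], the words before and after it: the tensor terms of the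
    difference quotient [ncdiff]. *)
Fixpoint splits (i : 'I_m) w : seq (word m * word m) :=
  if w is j :: w' then
    (if j == i then [:: ([::] : word m, w')] else [::]) ++
    [seq ((j :: p.1 : word m), p.2) | p <- splits i w']
  else [::].

(** What arises when a trace of [W] is differentiated and contracted with the word [v]: the word hit
    by the derivative is opened at an occurrence of [i] and merged with [v]. *)
Fixpoint corrections (i : 'I_m) (v : word m) W : seq (seq (word m)) :=
  if W is w :: W' then
    [seq (v ++ s.2 ++ s.1) :: W' | s <- splits i w] ++
    [seq w :: r | r <- corrections i v W']
  else [::].

(** A potential is encoded as a list of coefficients with words, repetitions allowed; this is its
    cyclic derivative in the same encoding. *)
Definition cyclic_terms (i : 'I_m) (V : seq (C * word m)) : seq (C * word m) :=
  flatten [seq [seq (cv.1, s.2 ++ s.1) | s <- splits i cv.2] | cv <- V].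

Lemma size_splits i w p : p \in splits i w -> (size p.1 + size p.2).+1 = size w.
Proof.
elim: w p => // j w ih p /=; rewrite mem_cat => /orP[|/mapP[q /ih qw ->/=]].
  by case: ifP => // _; rewrite inE => /eqP ->.
by rewrite addSn qw.
Qed.

End words.

(** * Traces of matrix words and their derivatives *)

Section matrix_words.
Context {R : realType} {m N : nat}.
Notation C := R[i].
Implicit Types (A H : 'I_m -> 'M[C]_N) (w v : word m) (W : seq (word m)).

Definition wmx A w : 'M[C]_N := \big[mulmx/1%:M]_(i <- w) A i.

Lemma wmx_cons A i w : wmx A (i :: w) = A i *m wmx A w.
Proof. by rewrite /wmx big_cons. Qed.

Lemma wmx_nil A : wmx A [::] = 1%:M. Proof. by rewrite /wmx big_nil. Qed.

Lemma wmx_cat A w v : wmx A (w ++ v) = wmx A w *m wmx A v.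
Proof.
elim: w => [|i w ih]; first by rewrite wmx_nil mul1mx.
by rewrite cat_cons !wmx_cons ih mulmxA.
Qed.

Fixpoint dwmx A H w : 'M[C]_N :=
  if w is i :: w' then H i *m wmx A w' + A i *m dwmx A H w' else 0.

Definition slot (i : 'I_m) (M : 'M[C]_N) : 'I_m -> 'M[C]_N :=
  fun k => if k == i then M else 0.

Lemma dwmx_slot A i M w :
  dwmx A (slot i M) w = \sum_(p <- splits i w) wmx A p.1 *m M *m wmx A p.2.
Proof.
elim: w => [|j w ih] /=; first by rewrite big_nil.
rewrite big_cat /= big_map ih mulmx_sumr; congr (_ + _).
  rewrite /slot; case: ifP => _; last by rewrite big_nil mul0mx.
  by rewrite big_seq1 /= wmx_nil mul1mx.
by apply: eq_bigr => p _; rewrite /= wmx_cons !mulmxA.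
Qed.

Lemma tr_dwmx_slot A i M w : \tr (dwmx A (slot i M) w) =
  \sum_(p <- splits i w) \tr (M *m wmx A (p.2 ++ p.1)).
Proof.
rewrite dwmx_slot raddf_sum; apply: eq_bigr => p _ /=.
by rewrite -mulmxA mxtrace_mulC wmx_cat mulmxA.
Qed.

Lemma polyfun_wmx w a b : @polyfun R m N (fun x => wmx (herms x) w a b)
  (fun x H => dwmx (herms x) H w a b).
Proof.
elim: w a b => [|i w ih] a b.
  apply: eq_polyfun (polyfun_cst (1%:M a b)) _ _ => [x|x H].
    by rewrite wmx_nil.
  by rewrite mxE.
have := polyfun_sum (index_enum 'I_N) xpredT
   (fun c => polyfunM (polyfun_entry i a c) (ih c b)).
move=> h; apply: eq_polyfun h _ _ => [x|x H] /=.
  by rewrite wmx_cons mxE.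
by rewrite !mxE big_split.
Qed.

Lemma polyfun_tr_wmx w : @polyfun R m N (fun x => \tr (wmx (herms x) w))
  (fun x H => \tr (dwmx (herms x) H w)).
Proof. exact: polyfun_sum (fun a => polyfun_wmx w a a). Qed.

Definition ntr A w : C := N%:R^-1 * \tr (wmx A w).

Definition pntr A W : C := \prod_(w <- W) ntr A w.

Fixpoint dpntr A H W : C :=
  if W is w :: W' then
    N%:R^-1 * \tr (dwmx A H w) * pntr A W' + ntr A w * dpntr A H W'
  else 0.

Lemma pntr_cons A w W : pntr A (w :: W) = ntr A w * pntr A W.
Proof. by rewrite /pntr big_cons. Qed.

Lemma polyfun_pntr W : @polyfun R m N (fun x => pntr (herms x) W)
  (fun x H => dpntr (herms x) H W).
Proof.
elim: W => [|w W ih].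
  by apply: eq_polyfun (polyfun_cst 1) _ _ => // x; rewrite /pntr big_nil.
apply: eq_polyfun (polyfunM (polyfunZ N%:R^-1 (polyfun_tr_wmx w)) ih) _ _ => // x.
by rewrite pntr_cons.
Qed.

Lemma mul_delta_mxE (M : 'M[C]_N) (a b c d : 'I_N) :
  (M *m (delta_mx a b : 'M[C]_N)) c d = M c a * (d == b)%:R.
Proof.
rewrite mxE (bigD1 a)//= mxE eqxx /= eq_sym big1 ?addr0 1?eq_sym// => k ka.
by rewrite mxE (negbTE ka) mulr0.
Qed.

Lemma tr_delta_mul (M : 'M[C]_N) (a b : 'I_N) : \tr (delta_mx a b *m M) = M b a.
Proof.
rewrite mxtrace_mulC /mxtrace (bigD1 b)//= mul_delta_mxE eqxx mulr1 big1 ?addr0// => k kb.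
by rewrite mul_delta_mxE (negbTE kb) mulr0.
Qed.

(** The entry [(a, b)] of [P E_ab Q] is [P_aa Q_bb], so this contraction cuts one word into two
    traces. *)
Lemma sum_dwmx_delta A i w :
  \sum_a \sum_b dwmx A (slot i (delta_mx a b)) w a b =
  \sum_(p <- splits i w) \tr (wmx A p.1) * \tr (wmx A p.2).
Proof.
under eq_bigr do under eq_bigr do rewrite dwmx_slot summxE.
under eq_bigr do rewrite exchange_big.
rewrite exchange_big; apply: eq_bigr => p _.
rewrite mulr_suml; apply: eq_bigr => a _; rewrite mulr_sumr; apply: eq_bigr => b _.
rewrite mxE (bigD1 b)//= mul_delta_mxE eqxx mulr1 big1 ?addr0// => k kb.
by rewrite mul_delta_mxE (negbTE kb) mulr0 mul0r.
Qed.

Lemma sum_tr_delta (P Q : 'M[C]_N) :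
  \sum_a \sum_b P a b * \tr (delta_mx a b *m Q) = \tr (P *m Q).
Proof.
apply: eq_bigr => a _; rewrite mxE; apply: eq_bigr => b _.
by rewrite tr_delta_mul.
Qed.

(** Contracting [v] with the derivative of a trace merges two traces into one. Two factors [1 / N]
    thus become one and a sum over [N^2] entries is saved, which is why these terms are of lower
    order. *)
Lemma sum_dpntr_delta A i v W :
  \sum_a \sum_b wmx A v a b * dpntr A (slot i (delta_mx a b)) W =
  \sum_(r <- corrections i v W) pntr A r.
Proof.
elim: W => [|w W ih] /=.
  by rewrite big_nil big1 // => a _; rewrite big1 // => b _; rewrite mulr0.
rewrite big_cat /= !big_map.
under [X in _ = _ + X]eq_bigr do rewrite pntr_cons.
rewrite -mulr_sumr -ih mulr_sumr.
under [X in _ = X + _]eq_bigr do rewrite pntr_cons.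
rewrite -mulr_suml.
have -> : \sum_(s <- splits i w) ntr A (v ++ s.2 ++ s.1) =
    \sum_a \sum_b wmx A v a b * (N%:R^-1 * \tr (dwmx A (slot i (delta_mx a b)) w)).
  under [RHS]eq_bigr do under eq_bigr do rewrite tr_dwmx_slot 2!mulr_sumr.
  under [RHS]eq_bigr do rewrite exchange_big.
  rewrite [RHS]exchange_big; apply: eq_bigr => s _ /=.
  under [RHS]eq_bigr do under eq_bigr do rewrite mulrCA.
  under [RHS]eq_bigr do rewrite -mulr_sumr.
  by rewrite -mulr_sumr sum_tr_delta /ntr wmx_cat.
rewrite mulr_suml -big_split; apply: eq_bigr => a _ /=.
rewrite mulr_suml mulr_sumr -big_split; apply: eq_bigr => b _ /=.
ring.
Qed.

End matrix_words.

(** * The potential of the model and its loop equation *)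

Section model.
Context {R : realType} {m N : nat}.
Notation C := R[i].
Notation T := (mentries R m N).
Variable V : seq (C * word m).

Definition vtrace (A : 'I_m -> 'M[C]_N) : C :=
  \sum_(cv <- V) cv.1 * \tr (wmx A cv.2).

Definition dvtrace (A H : 'I_m -> 'M[C]_N) : C :=
  \sum_(cv <- V) cv.1 * \tr (dwmx A H cv.2).

Definition upot (x : T) : C :=
  N%:R * (vtrace (herms x) + 2^-1 * \sum_k \tr (herms x k *m herms x k)).

Definition dupot (x : T) (H : 'I_m -> 'M[C]_N) : C :=
  N%:R * (dvtrace (herms x) H + \sum_k \tr (H k *m herms x k)).

(** Cyclic gradient of [V] plus the Gaussian term; up to the factor [N] it is the gradient of
    [upot], as [dupot_slot] shows. *)
Definition ugrad (A : 'I_m -> 'M[C]_N) i : 'M[C]_N :=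
  \sum_(cv <- cyclic_terms i V) cv.1 *: wmx A cv.2 + A i.

Lemma polyfun_upot : polyfun upot dupot.
Proof.
have p1 := polyfun_sum V xpredT (fun cv => polyfunZ cv.1 (@polyfun_tr_wmx R m N cv.2)).
have p2 := polyfun_sum (index_enum 'I_m) xpredT (fun k => @polyfun_tr_wmx R m N [:: k; k]).
have p3 := polyfunZ N%:R (polyfunD p1 (polyfunZ 2^-1 p2)).
apply: eq_polyfun p3 _ _ => [x|x H].
  congr (_ * (_ + _ * _)); apply: eq_bigr => k _.
  by rewrite !wmx_cons wmx_nil mulmx1.
congr (_ * (_ + _)); rewrite mulr_sumr; apply: eq_bigr => k _ /=.
rewrite !wmx_cons wmx_nil !mulmx1 mulmx0 addr0 raddfD /=.
by rewrite [X in _ + X]mxtrace_mulC; field.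
Qed.

Lemma dvtrace_slot A i (M : 'M[C]_N) :
  dvtrace A (slot i M) = \sum_(cv <- cyclic_terms i V) cv.1 * \tr (M *m wmx A cv.2).
Proof.
rewrite /dvtrace /cyclic_terms big_flatten /= big_map; apply: eq_bigr => cv _.
by rewrite big_map /= tr_dwmx_slot mulr_sumr.
Qed.

Lemma dupot_slot (x : T) i (M : 'M[C]_N) :
  dupot x (slot i M) = N%:R * \tr (M *m ugrad (herms x) i).
Proof.
rewrite /dupot dvtrace_slot /ugrad mulmxDr raddfD /=; congr (_ * (_ + _)).
  rewrite mulmx_sumr raddf_sum; apply: eq_bigr => cv _ /=.
  by rewrite -scalemxAr linearZ.
rewrite (bigD1 i)//= /slot eqxx big1 ?addr0// => k /negbTE ->.
by rewrite mul0mx raddf0.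
Qed.

Lemma dwmx_slots (A H : 'I_m -> 'M[C]_N) w :
  dwmx A H w = \sum_k dwmx A (slot k (H k)) w.
Proof.
elim: w => [|i w ih] /=; first by rewrite big1.
rewrite big_split /= -mulmx_sumr -ih -mulmx_suml; congr (_ *m _ + _).
by rewrite (bigD1 i)//= /slot eqxx big1 ?addr0// => k; rewrite eq_sym => /negbTE ->.
Qed.

Lemma dvtrace_slots (A H : 'I_m -> 'M[C]_N) :
  dvtrace A H = \sum_k dvtrace A (slot k (H k)).
Proof.
rewrite /dvtrace exchange_big; apply: eq_bigr => cv _ /=.
by rewrite -mulr_sumr dwmx_slots raddf_sum.
Qed.

Lemma dwmx_commutator (A : 'I_m -> 'M[C]_N) (E : 'M[C]_N) w :
  dwmx A (fun k => E *m A k - A k *m E) w = E *m wmx A w - wmx A w *m E.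
Proof.
elim: w => [|i w ih] /=; first by rewrite wmx_nil mulmx1 mul1mx subrr.
by rewrite ih wmx_cons mulmxBl mulmxBr !mulmxA addrA subrK.
Qed.

(* Infinitesimal form of the invariance of the traces under simultaneous
   conjugation. *)
Lemma sum_commutator_ugrad (A : 'I_m -> 'M[C]_N) :
  \sum_k (A k *m ugrad A k - ugrad A k *m A k) = 0.
Proof.
apply/matrixP => a b; pose E : 'M[C]_N := delta_mx b a.
have trE (M : 'M[C]_N) : M a b = \tr (E *m M) by rewrite tr_delta_mul.
rewrite trE mulmx_sumr raddf_sum mxE /=.
transitivity (\sum_k \tr ((E *m A k - A k *m E) *m ugrad A k)).
  apply: eq_bigr => k _; rewrite mulmxBr mulmxBl !raddfB /= !mulmxA; congr (_ - _).
  by rewrite -mulmxA mxtrace_mulC -!mulmxA mxtrace_mulC -!mulmxA.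
transitivity (dvtrace A (fun k => E *m A k - A k *m E) +
  \sum_k \tr ((E *m A k - A k *m E) *m A k)).
  rewrite dvtrace_slots -big_split; apply: eq_bigr => k _ /=.
  rewrite dvtrace_slot /ugrad mulmxDr raddfD /=; congr (_ + _).
  rewrite mulmx_sumr raddf_sum; apply: eq_bigr => cv _ /=.
  by rewrite -scalemxAr linearZ.
rewrite [X in _ + X]big1 ?addr0; last first.
  by move=> k _; rewrite mulmxBl raddfB/= -[A k *m E *m A k]mulmxA
    [X in _ - X]mxtrace_mulC subrr.
rewrite /dvtrace big1// => cv _.
by rewrite dwmx_commutator raddfB /= mxtrace_mulC subrr mulr0.
Qed.

Hypothesis N_gt0 : (0 < N)%N.
Hypothesis u_real : forall x, complex.Im (upot x) = 0.
Variables (delta K : R).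
Hypothesis delta_gt0 : 0 < delta.
Hypothesis u_coercive : forall x, delta * sqnorm x - K <= complex.Re (upot x).

Let N0 : N%:R != 0 :> C. Proof. by rewrite pnatr_eq0 -lt0n. Qed.

Notation wint := (wint upot).

(** Integration by parts for the entry [(a, b)] of the matrix of [v] times the traces of [W], along
    the elementary matrix [(a, b)] in slot [i], summed over [a] and [b] and divided by [N^2].
    Differentiating [v] cuts it in two, differentiating [W] gives the corrections, and
    differentiating the weight gives the right-hand side. *)
Lemma loop_equation_wint i v W :
  \sum_(p <- splits i v) wint (fun x => pntr (herms x) (p.1 :: p.2 :: W)) +
  (N%:R ^+ 2)^-1 * \sum_(r <- corrections i v W) wint (fun x => pntr (herms x) r) =
  wint (fun x => pntr (herms x) ((i :: v) :: W)) +
  \sum_(cv <- cyclic_terms i V) cv.1 * wint (fun x => pntr (herms x) ((cv.2 ++ v) :: W)).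
Proof.
have ipn r : ispoly (fun x : T => pntr (herms x) r) by exists (fun x H => dpntr (herms x) H r); exact: polyfun_pntr.
have N20 : N%:R ^+ 2 != 0 :> C by rewrite expf_neq0.
have trN w (A : 'I_m -> 'M[C]_N) : \tr (wmx A w) = N%:R * ntr A w.
  by rewrite /ntr mulVKf.
apply: (mulfI N20); rewrite !mulrDr mulVKf// !mulr_sumr.
pose f a b := fun x : T => wmx (herms x) v a b * pntr (herms x) W.
pose Df (a b : 'I_N) (x : T) (H : 'I_m -> 'M[C]_N) := dwmx (herms x) H v a b * pntr (herms x) W + wmx (herms x) v a b * dpntr (herms x) H W.
have pf a b : polyfun (f a b) (Df a b) := polyfunM (polyfun_wmx v a b) (polyfun_pntr W).
have ibp a b := wint_ibp polyfun_upot u_real delta_gt0 u_coercive (pf a b) (slot i (delta_mx a b)).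
have pD a b : ispoly ((Df a b) ^~ (slot i (delta_mx a b))) by exact: ispoly_deriv (pf a b).
have pU a b : ispoly (fun x => f a b x * dupot x (slot i (delta_mx a b))).
  by apply: ispolyM; [exists (Df a b)|exact: ispoly_deriv polyfun_upot].
have : wint (fun x => \sum_a \sum_b Df a b x (slot i (delta_mx a b))) =
   wint (fun x => \sum_a \sum_b f a b x * dupot x (slot i (delta_mx a b))).
  have ws := wint_sum polyfun_upot delta_gt0 u_coercive.
  rewrite (ws _ (index_enum 'I_N) xpredT
    (fun a x => \sum_b Df a b x (slot i (delta_mx a b)))); last first.
    by move=> a; apply: ispoly_sum => b; exact: pD.
  rewrite (ws _ (index_enum 'I_N) xpredT
    (fun a x => \sum_b f a b x * dupot x (slot i (delta_mx a b)))); last first.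
    by move=> a; apply: ispoly_sum => b; exact: pU.
  apply: eq_bigr => a _.
  by rewrite !ws//; apply: eq_bigr => b _; exact: ibp.
have -> : (fun x : T => \sum_a \sum_b Df a b x (slot i (delta_mx a b))) =
  (fun x => N%:R ^+ 2 * \sum_(p <- splits i v) pntr (herms x) (p.1 :: p.2 :: W) +
     \sum_(r <- corrections i v W) pntr (herms x) r).
  apply/funext => x; rewrite -sum_dpntr_delta.
  transitivity ((\sum_a \sum_b dwmx (herms x) (slot i (delta_mx a b)) v a b) * pntr (herms x) W +
    \sum_a \sum_b wmx (herms x) v a b * dpntr (herms x) (slot i (delta_mx a b)) W).
    rewrite mulr_suml -big_split; apply: eq_bigr => a _.
    by rewrite mulr_suml -big_split.
  congr (_ + _); rewrite sum_dwmx_delta mulr_suml mulr_sumr; apply: eq_bigr => p _.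
  by rewrite !trN !pntr_cons; ring.
have -> : (fun x : T => \sum_a \sum_b f a b x * dupot x (slot i (delta_mx a b))) =
  (fun x => N%:R ^+ 2 * pntr (herms x) ((i :: v) :: W) +
     \sum_(cv <- cyclic_terms i V) (N%:R ^+ 2 * cv.1) * pntr (herms x) ((cv.2 ++ v) :: W)).
  apply/funext => x.
  transitivity (N%:R * pntr (herms x) W * \tr (wmx (herms x) v *m ugrad (herms x) i)).
    rewrite -sum_tr_delta mulr_sumr; apply: eq_bigr => a _.
    rewrite mulr_sumr; apply: eq_bigr => b _.
    by rewrite dupot_slot /f; ring.
  rewrite /ugrad mulmxDr raddfD /= addrC mulrDr; congr (_ + _).
    by rewrite mxtrace_mulC -wmx_cons trN pntr_cons; ring.
  rewrite mulmx_sumr raddf_sum mulr_sumr; apply: eq_bigr => cv _ /=.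
  by rewrite -scalemxAr linearZ /= mxtrace_mulC -wmx_cat trN pntr_cons; ring.
have iS (I : Type) (r : seq I) (c : I -> C) (F : I -> seq (word m)) :
    ispoly (fun x : T => \sum_(i <- r) c i * pntr (herms x) (F i)).
  by apply: ispoly_sum => j; exact: ispolyZ.
have iS1 (I : Type) (r : seq I) (F : I -> seq (word m)) :
    ispoly (fun x : T => \sum_(i <- r) pntr (herms x) (F i)).
  by apply: ispoly_sum => j.
rewrite !(wintD polyfun_upot delta_gt0 u_coercive)//; try exact: ispolyZ.
rewrite !(wintZ polyfun_upot delta_gt0 u_coercive)// !(wint_sum polyfun_upot delta_gt0 u_coercive)//.
  rewrite mulr_sumr => ->; congr (_ + _); apply: eq_bigr => cv _.
  by rewrite (wintZ polyfun_upot delta_gt0 u_coercive)// mulrA.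
by move=> cv; exact: ispolyZ.
Qed.

End model.

(** The chord inequality between [0] and [1], divided by [s] as [s] decreases to [0]. *)
Lemma convex_derive_at0 (R : realType) (g : R -> R) (d : R) :
  is_derive (0 : R) (1 : R) g d ->
  (forall s, 0 <= s <= 1 -> g s <= s * g 1 + (1 - s) * g 0) -> d <= g 1 - g 0.
Proof.
move=> [dg dE] cg; rewrite -dE.
have h : h^-1 *: (g (h *: (1 : R^o) + 0) - g 0) @[h --> 0^'] --> 'D_1 g 0 by exact: dg.
have {}h := cvg_dnbhs_at_right h.
rewrite -(cvg_lim _ h)//; apply: limr_le; first by apply/cvg_ex; eexists; exact: h.
near=> s.
have s0 : 0 < s by [].
have s1 : s <= 1 by near: s; exact: nbhs_right_le.
rewrite addr0 /GRing.scale/= mulr1 mulrC ler_pdivrMr//.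
have := cg s; rewrite (ltW s0) s1 => /(_ isT); lra.
Unshelve. all: by end_near. Qed.

Lemma convex_derive_at1 (R : realType) (g : R -> R) (d : R) :
  is_derive (1 : R) (1 : R) g d ->
  (forall s, 0 <= s <= 1 -> g s <= s * g 1 + (1 - s) * g 0) -> g 1 - g 0 <= d.
Proof.
move=> dg cg; pose k s := g (1 + s * -1).
have dk : is_derive (0 : R) (1 : R) k (d * -1).
  apply: is_derive1_comp; last exact: is_derive_affine.
  by rewrite mul0r addr0.
have := convex_derive_at0 dk; rewrite /k mul0r addr0 mul1r subrr.
move=> h; suff : d * -1 <= g 0 - g 1 by lra.
apply: h => s /andP[s0 s1]; have := cg (1 + s * -1).
have -> : 0 <= 1 + s * -1 <= 1 by lra.
move=> /(_ isT); lra.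
Qed.

Lemma sum_kronecker (F : pzSemiRingType) (I J : finType) (f : I -> J -> F) l e (b : F) :
  \sum_k \sum_c (l == k)%:R * b * (e == c)%:R * f k c = b * f l e.
Proof.
rewrite (bigD1 l)//= [X in _ + X]big1; last first.
  by move=> k kl; rewrite big1// => c _; rewrite eq_sym (negbTE kl) !mul0r.
rewrite addr0 (bigD1 e)//= !eqxx big1; last first.
  by move=> c ce; rewrite [e == c]eq_sym (negbTE ce) mulr0 mul0r.
by rewrite addr0 mul1r mulr1.
Qed.

(** * Means of the matrix entries *)

Section mean_values.
Context {R : realType} {m N : nat}.
Notation C := R[i].
Notation T := (mentries R m N).
Variable V : seq (C * word m).
Notation upot := (@upot R m N V).
Hypothesis u_real : forall x, complex.Im (upot x) = 0.
Variables (delta K : R).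
Hypothesis delta_gt0 : 0 < delta.
Hypothesis u_coercive : forall x, delta * sqnorm x - K <= complex.Re (upot x).
Notation wint := (wint upot).

Let ws := wint_sum (polyfun_upot V) delta_gt0 u_coercive.
Let wD := wintD (polyfun_upot V) delta_gt0 u_coercive.
Let wZ := wintZ (polyfun_upot V) delta_gt0 u_coercive.

Lemma ispoly_entry k a b : ispoly (fun x : T => herms x k a b).
Proof. exact: (ex_intro _ _ (polyfun_entry k a b)). Qed.

(** The matrix of means commutes with the elementary matrix [delta_mx e d]; this is its entry
    [(a, b)]. Instead of integrating over the unitary group, the commutator identity for [ugrad],
    multiplied by the entry [(d, e)] of the matrix [l], is integrated by parts. *)
Lemma wint_entry_exchange l (a b d e : 'I_N) :
  (d == b)%:R * wint (fun x => herms x l a e) =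
  (e == a)%:R * wint (fun x => herms x l d b).
Proof.
have ent := ispoly_entry.
have t1 : true%:R = 1 :> C by [].
have f0 : false%:R = 0 :> C by [].
have z0 (i j : 'I_N) : (0 : 'M[C]_N) i j = 0 by rewrite mxE.
have dE (a1 b1 c1 d1 : 'I_N) :
    (delta_mx a1 b1 : 'M[C]_N) c1 d1 = (c1 == a1)%:R * (d1 == b1)%:R.
  by rewrite mxE -mulnb natrM.
pose f1 k c (x : T) := herms x k a c * herms x l d e.
pose f2 k c (x : T) := herms x k c b * herms x l d e.
have pf1 k c := polyfunM (@polyfun_entry R m N k a c) (polyfun_entry l d e).
have pf2 k c := polyfunM (@polyfun_entry R m N k c b) (polyfun_entry l d e).
have ibp1 k c := wint_ibp (polyfun_upot V) u_real delta_gt0 u_coercive (pf1 k c) (slot k (delta_mx b c)).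
have ibp2 k c := wint_ibp (polyfun_upot V) u_real delta_gt0 u_coercive (pf2 k c) (slot k (delta_mx c a)).
(* Differentiating the first factor contributes this same term on both sides, where it cancels. *)
pose w0 := (a == b)%:R * wint (fun x => herms x l d e).
have e1 k c : wint (fun x => slot k (delta_mx b c) k a c * herms x l d e +
     herms x k a c * slot k (delta_mx b c) l d e) =
   w0 + (l == k)%:R * (d == b)%:R * (e == c)%:R * wint (fun x => herms x k a c).
  rewrite /w0 -!wZ// -wD; try exact: ispolyZ.
  congr wint; apply/funext => x; rewrite /slot eqxx dE eqxx.
  by case: (l == k); rewrite ?dE ?z0 ?t1 ?f0; ring.
have e2 k c : wint (fun x => slot k (delta_mx c a) k c b * herms x l d e +
     herms x k c b * slot k (delta_mx c a) l d e) =
   w0 + (l == k)%:R * (d == c)%:R * (e == a)%:R * wint (fun x => herms x k c b).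
  rewrite /w0 -!wZ// -wD; try exact: ispolyZ.
  congr wint; apply/funext => x; rewrite /slot eqxx dE eqxx (eq_sym b a).
  by case: (l == k); rewrite ?dE ?z0 ?t1 ?f0; ring.
have rhs : \sum_k \sum_c wint (fun x => f1 k c x * dupot V x (slot k (delta_mx b c))) =
    \sum_k \sum_c wint (fun x => f2 k c x * dupot V x (slot k (delta_mx c a))).
  have pg k M : ispoly (fun x : T => dupot V x (slot k M)).
    exact: (ispoly_deriv _ (polyfun_upot V)).
  have p1 k c : ispoly (fun x => f1 k c x * dupot V x (slot k (delta_mx b c))).
    by apply: ispolyM => //; apply: ispolyM.
  have p2 k c : ispoly (fun x => f2 k c x * dupot V x (slot k (delta_mx c a))).
    by apply: ispolyM => //; apply: ispolyM.
  have dsum (F : 'I_m -> 'I_N -> T -> C) : (forall k c, ispoly (F k c)) ->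
      wint (fun x => \sum_k \sum_c F k c x) = \sum_k \sum_c wint (F k c).
    move=> pF; rewrite (ws _ xpredT (F := fun k x => \sum_c F k c x)); last first.
      by move=> k; exact: ispoly_sum.
    by apply: eq_bigr => k _; rewrite ws.
  pose F1 k c (x : T) := f1 k c x * dupot V x (slot k (delta_mx b c)).
  pose F2 k c (x : T) := f2 k c x * dupot V x (slot k (delta_mx c a)).
  apply: etrans (esym (dsum F1 p1)) _; apply: etrans (dsum F2 p2).
  congr wint; apply/funext => x.
  have := congr1 (fun M : 'M[C]_N => N%:R * herms x l d e * M a b) (sum_commutator_ugrad V (herms x)).
  have mE (M P : 'M[C]_N) : (M *m P - P *m M) a b = \sum_c (M a c * P c b - M c b * P a c).
    rewrite sumrB !mxE; congr (_ - _); apply: eq_bigr => c _; exact: mulrC.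
  rewrite z0 mulr0 summxE => h; apply/eqP; rewrite -subr_eq0 -sumrB -[X in _ == X]h mulr_sumr.
  apply/eqP; apply: eq_bigr => k _; rewrite mE mulr_sumr -sumrB.
  apply: eq_bigr => c _; rewrite /F1 /F2 !dupot_slot !tr_delta_mul /f1 /f2; ring.
have l1 : \sum_k \sum_c wint (fun x => f1 k c x * dupot V x (slot k (delta_mx b c))) =
    \sum_(k < m) \sum_(c < N) w0 + \sum_k \sum_c
    ((l == k)%:R * (d == b)%:R * (e == c)%:R * wint (fun x => herms x k a c)).
  rewrite -big_split; apply: eq_bigr => k _; rewrite -big_split.
  by apply: eq_bigr => c _; exact: etrans (esym (ibp1 k c)) (e1 k c).
have l2 : \sum_k \sum_c wint (fun x => f2 k c x * dupot V x (slot k (delta_mx c a))) =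
    \sum_(k < m) \sum_(c < N) w0 + \sum_k \sum_c
    ((l == k)%:R * (d == c)%:R * (e == a)%:R * wint (fun x => herms x k c b)).
  rewrite -big_split; apply: eq_bigr => k _; rewrite -big_split.
  by apply: eq_bigr => c _; exact: etrans (esym (ibp2 k c)) (e2 k c).
have /addrI key := etrans (esym l1) (etrans rhs l2).
pose g1 k c := wint (fun x : T => herms x k a c).
pose g2 k c := wint (fun x : T => herms x k c b).
apply: etrans (esym (sum_kronecker g1 l e (d == b)%:R)) _.
apply: etrans key _; apply: etrans (sum_kronecker g2 l d (e == a)%:R).
apply: eq_bigr => k _; apply: eq_bigr => c _.
exact: (congr1 (fun z : C => z * g2 k c) (mulrAC _ _ _)).
Qed.

End mean_values.

(** * Consequences of convexity *)

Section complex_modulus.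
Context {R : realType}.
Implicit Types x y : R[i].
Notation nc := (@Normc.normc R).

Lemma ncE x : nc x = Num.sqrt (csqr x).
Proof. by case: x. Qed.

Lemma nc_ge0 x : 0 <= nc x. Proof. by rewrite ncE sqrtr_ge0. Qed.

Lemma nc_sqr x : nc x ^+ 2 = csqr x.
Proof. by rewrite ncE sqr_sqrtr// csqr_ge0. Qed.

Lemma ncD x y : nc (x + y) <= nc x + nc y. Proof. exact: le_normcD. Qed.

Lemma ncM x y : nc (x * y) = nc x * nc y. Proof. exact: Normc.normcM. Qed.

Lemma nc0 : nc 0 = 0. Proof. exact: Normc.normc0. Qed.

Lemma ncN x : nc (- x) = nc x. Proof. exact: normcN. Qed.

Lemma ncB x y : nc (x - y) <= nc x + nc y.
Proof. by rewrite -(ncN y) ncD. Qed.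

Lemma nc1 : nc 1 = 1. Proof. exact: Normc.normc1. Qed.

Lemma nc_real (r : R) : nc r%:C = `|r|.
Proof. by rewrite /= expr0n /= addr0 sqrtr_sqr. Qed.

Lemma nc_sum (I : Type) (r : seq I) (P : pred I) (F : I -> R[i]) :
  nc (\sum_(i <- r | P i) F i) <= \sum_(i <- r | P i) nc (F i).
Proof.
elim/big_rec2: _ => [|i y1 y2 _ h]; first by rewrite nc0.
by apply: le_trans (ncD _ _) _; rewrite lerD2l.
Qed.

Lemma Re_le_nc x : `|complex.Re x| <= nc x.
Proof.
by rewrite ncE -sqrtr_sqr ler_wsqrtr// /csqr lerDl sqr_ge0.
Qed.

Lemma Im_le_nc x : `|complex.Im x| <= nc x.
Proof.
by rewrite ncE -sqrtr_sqr ler_wsqrtr// /csqr lerDr sqr_ge0.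
Qed.

Lemma nc_le_ReIm x : nc x <= `|complex.Re x| + `|complex.Im x|.
Proof.
have h0 : 0 <= `|complex.Re x| + `|complex.Im x| by rewrite addr_ge0.
rewrite -(@ler_pXn2r _ 2)// ?nnegrE ?nc_ge0// nc_sqr /csqr.
rewrite -[complex.Re x ^+ 2]real_normK ?num_real// -[complex.Im x ^+ 2]real_normK ?num_real//.
rewrite sqrrD; have : 0 <= `|complex.Re x| * `|complex.Im x| by rewrite mulr_ge0.
lra.
Qed.

Lemma nc_le_amean x (e : R) : 0 < e -> nc x <= e * csqr x + (4 * e)^-1.
Proof.
move=> e0; rewrite -nc_sqr; have h := sqr_ge0 (2 * e * nc x - 1).
have e4 : 0 < (4 * e)^-1 by rewrite invr_gt0 mulr_gt0.
have E : e * nc x ^+ 2 + (4 * e)^-1 - nc x = (4 * e)^-1 * (2 * e * nc x - 1) ^+ 2.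
  by field; rewrite lt0r_neq0.
by rewrite -subr_ge0 E mulr_ge0// ltW.
Qed.

End complex_modulus.

(** * Coercivity from convexity *)

Section convex_model.
Context {R : realType} {m N : nat}.
Notation C := R[i].
Notation T := (mentries R m N).
Notation nc := (@Normc.normc R).
Variable V : seq (C * word m).
Variable a : R.

Definition mconv (s : R) (x y : T) : T :=
  [tuple [tuple (s * tnth (tnth x k) i + (1 - s) * tnth (tnth y k) i : measurableTypeR R)
    | i < N * N] | k < m].

Lemma herms_mconv s x y k :
  herms (mconv s x y) k = s%:C *: herms x k + (1 - s)%:C *: herms y k.
Proof.
apply/matrixP => i j; rewrite !mxE /mconv !tnth_mktuple.
case: ltngtP => _; rewrite ?mxE /=; apply/eqP; rewrite eq_complex /=; apply/andP;
  split; apply/eqP; ring.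
Qed.

Definition mzero : T := [tuple [tuple (0 : measurableTypeR R) | i < N * N] | k < m].

Lemma herms_mzero k : herms mzero k = 0.
Proof.
apply/matrixP => i j; rewrite !mxE /mzero !tnth_mktuple.
by case: ltngtP => _; rewrite ?mxE //= oppr0.
Qed.

Definition phi (x : T) : R := complex.Re (vtrace V (herms x)) + a / 2 * sqnorm x.

(** Only the one-letter words of [V] have a nonzero derivative at the origin; this quantity controls
    the slope of [phi] there. *)
Definition lincoef : R := \sum_(cv <- V | size cv.2 == 1) nc cv.1.

Hypothesis V_real : forall x : T, complex.Im (vtrace V (herms x)) = 0.
Hypothesis phi_convex : forall s x y, 0 <= s <= 1 ->
  phi (mconv s x y) <= s * phi x + (1 - s) * phi y.
Hypothesis a_lt1 : a < 1.
Hypothesis lincoef_le1 : lincoef <= 1.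
Hypothesis N_gt0 : (0 < N)%N.

Local Notation c := (1 - a).
Let c_gt0 : 0 < c. Proof. by rewrite subr_gt0. Qed.

Lemma Im_herm_diag (x : entries R N) i : complex.Im (herm x i i) = 0.
Proof. by rewrite !mxE ltnn. Qed.

Lemma Im_trace_sqr (x : entries R N) : complex.Im (\tr (herm x *m herm x)) = 0.
Proof.
rewrite /mxtrace raddf_sum big1// => i _; rewrite mxE raddf_sum big1// => j _ /=.
by rewrite (herm_conj x i j); case: (herm x i j) => u v /=; ring.
Qed.

Lemma half_complex (z : C) : 2^-1 * z = (complex.Re z / 2) +i* (complex.Im z / 2).
Proof.
by case: z => u v; apply/eqP; rewrite eq_complex /=; apply/andP; split; apply/eqP; field.
Qed.

Lemma natC (k : nat) : k%:R = (k%:R : R)%:C :> C.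
Proof. by rewrite rmorph_nat. Qed.

Lemma Im_upot (x : T) : complex.Im (upot V x) = 0.
Proof.
rewrite /upot natC Im_mul /= mul0r addr0 Im_add V_real half_complex /= raddf_sum.
by rewrite big1 ?mul0r ?addr0 ?mulr0// => k _; exact: Im_trace_sqr.
Qed.

Lemma Re_upot (x : T) : complex.Re (upot V x) = N%:R * (phi x + c / 2 * sqnorm x).
Proof.
rewrite /upot natC Re_mul /= mul0r subr0 Re_add half_complex /=.
have -> : complex.Re (\sum_k \tr (herms x k *m herms x k)) = sqnorm x.
  by rewrite raddf_sum.
by rewrite /phi; congr (_ * _); field.
Qed.

Lemma dwmx0 (A H : 'I_m -> 'M[C]_N) w : (forall k, A k = 0) ->
  dwmx A H w = if size w == 1 then wmx H w else 0.
Proof.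
case: w => [|i [|j w]]//= A0; rewrite ?A0 ?mul0mx ?addr0 ?wmx_cons ?wmx_nil//.
by rewrite (A0 j) mul0mx mulmx0.
Qed.

Definition phi_deriv (x h : T) : R :=
  complex.Re (dvtrace V (herms x) (herms h)) + a * complex.Re (\sum_k \tr (herms h k *m herms x k)).

Lemma phi_is_derive (x h : T) s : is_derive s (1 : R) (fun t => phi (mshift h t x))
  (phi_deriv (mshift h s x) h).
Proof.
have p1 := polyfun_sum V xpredT (fun cv => polyfunZ cv.1 (@polyfun_tr_wmx R m N cv.2)).
have p2 := polyfun_sum (index_enum 'I_m) xpredT (fun k => @polyfun_tr_wmx R m N [:: k; k]).
have [h1 _] := polyfun_is_derive p1 h x s.
have [h2 _] := polyfun_is_derive p2 h x s.
rewrite /phi /phi_deriv.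
have -> : (fun t => complex.Re (vtrace V (herms (mshift h t x))) + a / 2 * sqnorm (mshift h t x)) =
  (fun t => complex.Re (\sum_(cv <- V) cv.1 * \tr (wmx (herms (mshift h t x)) cv.2)) +
   a / 2 * complex.Re (\sum_k \tr (wmx (herms (mshift h t x)) [:: k; k]))).
  apply/funext => t; congr (_ + _ * _); rewrite raddf_sum; apply: eq_bigr => k _.
  by rewrite !wmx_cons wmx_nil mulmx1.
apply: is_derive_eq; rewrite /GRing.scale/=; congr (_ + _).
rewrite -mulrA; congr (_ * _).
rewrite !raddf_sum mulr_sumr; apply: eq_bigr => k _ /=.
rewrite !wmx_cons wmx_nil !mulmx1 mulmx0 addr0 raddfD Re_add /=.
by rewrite [X in _ + complex.Re X]mxtrace_mulC; field.
Qed.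

Lemma mconv_mzero s x : mconv s x mzero = mshift x s mzero.
Proof.
apply/eq_from_tnth => k; apply/eq_from_tnth => i.
by rewrite !tnth_mktuple mulr0 addr0 add0r.
Qed.

Lemma phi_segment x s : 0 <= s <= 1 ->
  phi (mshift x s mzero) <= s * phi (mshift x 1 mzero) + (1 - s) * phi (mshift x 0 mzero).
Proof.
move=> s01; rewrite -mconv_mzero; apply: le_trans (phi_convex _ _ s01) _.
rewrite mshift0; suff -> : mshift x 1 mzero = x by [].
apply/eq_from_tnth => k; apply/eq_from_tnth => i.
by rewrite !tnth_mktuple add0r mul1r.
Qed.

Lemma mshift1_mzero x : mshift x 1 mzero = x.
Proof.
apply/eq_from_tnth => k; apply/eq_from_tnth => i.
by rewrite !tnth_mktuple add0r mul1r.
Qed.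

Lemma phi_ge_tangent x : phi mzero + phi_deriv mzero x <= phi x.
Proof.
have := convex_derive_at0 (phi_is_derive mzero x 0) (phi_segment x).
by rewrite mshift0 mshift1_mzero; lra.
Qed.

Lemma phi_deriv_ge x : phi_deriv mzero x <= phi_deriv x x.
Proof.
have := convex_derive_at0 (phi_is_derive mzero x 0) (phi_segment x).
have := convex_derive_at1 (phi_is_derive mzero x 1) (phi_segment x).
by rewrite mshift0 mshift1_mzero => h1 h2; exact: le_trans h2 h1.
Qed.

Lemma nc_trace_herm (x : T) k (e : R) : 0 < e ->
  nc (\tr (herms x k)) <= e * sqnorm x + N%:R / (4 * e).
Proof.
move=> e0; apply: le_trans (nc_sum _ _ _) _.
apply: (@le_trans _ _ (\sum_(i < N) (e * csqr (herms x k i i) + (4 * e)^-1))).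
  by apply: ler_sum => i _; exact: nc_le_amean.
rewrite big_split /= sumr_const card_ord -[X in _ + X <= _]mulr_natl; apply: lerD => //.
rewrite -mulr_sumr ler_pM2l//.
apply: (@le_trans _ _ (trace_sqr (herms x k))).
  rewrite trace_sqr_hermE; apply: ler_sum => i _.
  by apply: (ler_term_sum (F := fun j => csqr (herms x k i j))) => j; exact: csqr_ge0.
apply: (ler_term_sum (F := fun k => trace_sqr (herms x k))) => l.
by rewrite trace_sqr_hermE; apply: sumr_ge0 => ? _; apply: sumr_ge0 => ? _; exact: csqr_ge0.
Qed.

(** At the origin each one-letter word contributes its coefficient times a trace, and [c / 4] times
    [sqnorm] absorbs the trace. The condition [lincoef <= 1] makes the bound independent of [V]. *)
Lemma phi_deriv0_ge x : - (c / 4 * sqnorm x + N%:R / c) <= phi_deriv mzero x.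
Proof.
have c4 : 0 < c / 4 by rewrite divr_gt0.
have B0 : 0 <= c / 4 * sqnorm x + N%:R / c.
  by rewrite addr_ge0 ?mulr_ge0 ?sqnorm_ge0 ?invr_ge0// ltW.
rewrite /phi_deriv [X in _ * complex.Re X]big1 ?mulr0 ?addr0; last first.
  by move=> k _; rewrite herms_mzero mulmx0 raddf0.
rewrite lerNl; apply: le_trans (_ : nc (dvtrace V (herms mzero) (herms x)) <= _).
  by apply: le_trans (Re_le_nc _); rewrite -normrN ler_norm.
apply: le_trans (nc_sum _ _ _) _.
apply: (@le_trans _ _ (\sum_(cv <- V | size cv.2 == 1) nc cv.1 * (c / 4 * sqnorm x + N%:R / c))).
  rewrite big_mkcond [leRHS]big_mkcond; apply: ler_sum => cv _ /=.
  rewrite ncM dwmx0; last by move=> k; exact: herms_mzero.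
  case: ifPn => [|_]; last by rewrite raddf0 nc0 mulr0.
  case: cv.2 => [|k [|]]// _; apply: ler_wpM2l; first exact: nc_ge0.
  rewrite wmx_cons wmx_nil mulmx1; apply: le_trans (nc_trace_herm _ _ c4) _.
  rewrite lerD2l le_eqVlt; apply/orP; left; apply/eqP; field; exact: lt0r_neq0.
by rewrite -mulr_suml -[leRHS]mul1r ler_wpM2r.
Qed.

(** [phi] lies above its tangent at the origin, and half of the quadratic surplus [c / 2] pays for
    the slope of this tangent. *)
Lemma upot_coercive (x : T) : N%:R * (c / 4) * sqnorm x - N%:R * (N%:R / c - phi mzero) <=
  complex.Re (upot V x).
Proof.
rewrite Re_upot -mulrA -mulrBr; apply: ler_wpM2l => //.
by have := phi_ge_tangent x; have := phi_deriv0_ge x; lra.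
Qed.

(** Along the ray from the origin to [x] the derivative of the convex function [phi] increases, so
    it is at least the slope at the origin. The surplus [c * sqnorm x] loses a quarter to that
    slope. *)
Lemma trace_ugrad_ge (x : T) : c * 3 / 4 * sqnorm x - N%:R / c <=
  complex.Re (\sum_k \tr (herms x k *m ugrad V (herms x) k)).
Proof.
have -> : \sum_k \tr (herms x k *m ugrad V (herms x) k) =
    dvtrace V (herms x) (herms x) + \sum_k \tr (herms x k *m herms x k).
  rewrite dvtrace_slots -big_split; apply: eq_bigr => k _ /=.
  rewrite dvtrace_slot /ugrad mulmxDr raddfD /=; congr (_ + _).
  rewrite mulmx_sumr raddf_sum; apply: eq_bigr => cv _ /=.
  by rewrite -scalemxAr linearZ.
have := phi_deriv_ge x; have := phi_deriv0_ge x; rewrite Re_add /phi_deriv.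
have -> : complex.Re (\sum_k \tr (herms x k *m herms x k)) = sqnorm x.
  by rewrite raddf_sum.
have -> : c * 3 / 4 * sqnorm x = 3 / 4 * sqnorm x - 3 / 4 * (a * sqnorm x) by field.
have -> : c / 4 * sqnorm x = 1 / 4 * sqnorm x - 1 / 4 * (a * sqnorm x) by field.
by lra.
Qed.

End convex_model.

Lemma tuple_measure_setT_gt0 d (T : measurableType d) (R : realType)
    (mu : {sigma_finite_measure set T -> \bar R}) k :
  (0 < mu setT)%E -> (0 < tuple_measure mu k setT)%E.
Proof.
move=> mu0; elim: k => [|k ih]; first by rewrite /= diracT.
have -> : tuple_measure mu k.+1 setT = (\int[tuple_measure mu k.+1]_t 1)%E.
  by rewrite integral_cst// mul1e.
rewrite ge0_integral_tuple_measureS//.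
under eq_integral do rewrite integral_cst// mul1e.
by rewrite integral_cst// mule_gt0.
Qed.

(** * Second moment and mean *)

Section moment_bounds.
Context {R : realType} {m N : nat}.
Notation C := R[i].
Notation T := (mentries R m N).
Notation nc := (@Normc.normc R).
Notation mleb := (@mleb R m N).
Variable V : seq (C * word m).
Variable a : R.
Hypothesis V_real : forall x : T, complex.Im (vtrace V (herms x)) = 0.
Hypothesis phi_convex : forall s (x y : T), 0 <= s <= 1 ->
  phi V a (mconv s x y) <= s * phi V a x + (1 - s) * phi V a y.
Hypothesis a_lt1 : a < 1.
Hypothesis lincoef_le1 : lincoef V <= 1.
Hypothesis N_gt0 : (0 < N)%N.

Local Notation c := (1 - a).
Local Notation upot := (@upot R m N V).
Local Notation wint := (wint upot).
Local Notation weight := (weight upot).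

Lemma c_gt0 : 0 < c. Proof. by rewrite subr_gt0. Qed.

Lemma NR_gt0 : 0 < N%:R :> R. Proof. by rewrite ltr0n. Qed.

Let u_real : forall x, complex.Im (upot x) = 0 := Im_upot V_real.
Let pu := @polyfun_upot R m N V.

Lemma delta_gt0 : 0 < N%:R * (c / 4).
Proof. by rewrite mulr_gt0 ?NR_gt0// divr_gt0// c_gt0. Qed.

Let coer := upot_coercive phi_convex a_lt1 lincoef_le1.
Let iw := integrable_wint pu delta_gt0 coer.
Let wD := wintD pu delta_gt0 coer.
Let wZ := wintZ pu delta_gt0 coer.
Let ws := wint_sum pu delta_gt0 coer.

Definition partition : R := \int[mleb]_x weight x.

Lemma weight_gt0 x : 0 < weight x. Proof. exact: expR_gt0. Qed.

Lemma integrable_weight : mleb.-integrable setT (EFin \o weight).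
Proof.
have [h _] := iw (ispoly_cst 1).
by apply: eq_integrable h => // x _ /=; rewrite mul1r.
Qed.

Lemma partitionE : (partition%:E = \int[mleb]_x (weight x)%:E)%E.
Proof. by rewrite /partition /Rintegral fineK//; exact: integrable_fin_num integrable_weight. Qed.

Lemma partition_gt0 : 0 < partition.
Proof.
rewrite -lte_fin partitionE lt_neqAle; apply/andP; split; last first.
  by apply: integral_ge0 => x _; rewrite lee_fin ltW// weight_gt0.
apply/eqP => /esym h.
have mw : measurable_fun setT (EFin \o weight).
  by have /integrableP[] := integrable_weight.
have : (\int[mleb]_x `|(EFin \o weight) x| = 0)%E.
  apply: etrans h; apply: eq_integral => x _ /=.
  by rewrite ger0_norm// ltW// weight_gt0.
move/(ae_eq_integral_abs _ measurableT mw) => [A [mA A0 hA]].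
have AT : A = setT.
  apply/seteqP; split => // x _; apply: hA => /= /(_ I) [] w0.
  by have := weight_gt0 x; rewrite w0 ltxx.
have leb0 : (0 < @lebesgue_measure R setT)%E.
  have -> : [set: measurableTypeR R] = [set` `]-oo, +oo[] :> set R by rewrite set_itvNyy.
  by rewrite lebesgue_measure_itv/= ltry.
have := tuple_measure_setT_gt0 m (tuple_measure_setT_gt0 (N * N) leb0).
by rewrite -AT; move: A0; rewrite /mleb => ->; rewrite ltxx.
Qed.

Lemma wint1 : wint (fun=> 1) = partition%:C.
Proof.
rewrite /wint /partition; apply/eqP; rewrite eq_complex /=; apply/andP; split; apply/eqP.
  by apply: eq_Rintegral => x _; rewrite mul1r.
under eq_Rintegral do rewrite mul0r.
by rewrite /Rintegral integral0.
Qed.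

Lemma ispoly_sqnorm : ispoly (fun x : T => \sum_k \tr (herms x k *m herms x k)).
Proof.
apply: ispoly_sum => k; exists (fun x H => \tr (dwmx (herms x) H [:: k; k])).
apply: eq_polyfun (polyfun_tr_wmx [:: k; k]) _ _ => // x.
by rewrite !wmx_cons wmx_nil mulmx1.
Qed.

Lemma integrable_sqnorm_weight :
  mleb.-integrable setT (EFin \o (fun x => sqnorm x * weight x)).
Proof.
have [h _] := iw ispoly_sqnorm.
by apply: eq_integrable h => // x _ /=; rewrite raddf_sum.
Qed.

Lemma ispoly_trace_ugrad k : ispoly (fun x : T => \tr (herms x k *m ugrad V (herms x) k)).
Proof.
apply: ispoly_sum => i.
have iE (w : word m) p j : ispoly (fun x : T => wmx (herms x) w p j).
  exact: (ex_intro _ _ (polyfun_wmx w p j)).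
rewrite (_ : (fun x => _) = (fun x : T => \sum_j wmx (herms x) [:: k] i j *
   (\sum_(cv <- cyclic_terms k V) cv.1 * wmx (herms x) cv.2 j i + wmx (herms x) [:: k] j i))); last first.
  apply/funext => x; rewrite mxE; apply: eq_bigr => j _.
  rewrite !wmx_cons wmx_nil !mulmx1 /ugrad; congr (_ * _).
  rewrite [LHS]mxE; congr (_ + _); rewrite summxE; apply: eq_bigr => cv _.
  by rewrite [LHS]mxE.
apply: ispoly_sum => j; apply: ispolyM => //; apply: ispolyD => //.
by apply: ispoly_sum => cv; exact: ispolyZ.
Qed.

(** The loop equation for the word [[:: k]] without further traces, summed over [k]; its only split
    is into two empty words, of normalized trace [1]. *)
Lemma wint_trace_ugrad :
  wint (fun x => \sum_k \tr (herms x k *m ugrad V (herms x) k)) = (m * N)%:R * wint (fun=> 1).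
Proof.
have N0 : N%:R != 0 :> C by rewrite pnatr_eq0 -lt0n.
have ipn r : ispoly (fun x : T => pntr (herms x) r).
  by exists (fun x H => dpntr (herms x) H r); exact: polyfun_pntr.
have trk k : wint (fun x => N%:R^-1 * \tr (herms x k *m ugrad V (herms x) k)) = wint (fun=> 1).
  have := loop_equation_wint N_gt0 u_real delta_gt0 coer k [:: k] [::].
  rewrite /= eqxx /= big_seq1 big_nil mulr0 addr0 /=.
  have -> : (fun x : T => pntr (herms x) [:: [::]; [::]]) = (fun=> 1).
    apply/funext => x; rewrite /pntr !big_cons big_nil /ntr wmx_nil mxtrace1.
    by rewrite mulVf// !mulr1.
  move=> ->.
  have iS : ispoly (fun x : T => \sum_(cv <- cyclic_terms k V) cv.1 * pntr (herms x) [:: cv.2 ++ [:: k]]).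
    by apply: ispoly_sum => cv; exact: ispolyZ.
  transitivity (wint (fun x => pntr (herms x) [:: [:: k; k]] +
    \sum_(cv <- cyclic_terms k V) cv.1 * pntr (herms x) [:: cv.2 ++ [:: k]])).
    congr wint; apply/funext => x.
    rewrite /ugrad mulmxDr raddfD /= addrC mulrDr; congr (_ + _).
      by rewrite /pntr big_seq1 /ntr !wmx_cons wmx_nil mulmx1.
    rewrite mulmx_sumr raddf_sum mulr_sumr; apply: eq_bigr => cv _ /=.
    rewrite -scalemxAr linearZ /= mxtrace_mulC /pntr big_seq1 /ntr wmx_cat wmx_cons wmx_nil mulmx1.
    by rewrite mulrCA.
  rewrite wD// ws; last by move=> cv; exact: ispolyZ.
  by congr (_ + _); apply: eq_bigr => cv _; rewrite wZ.
have iT := ispoly_trace_ugrad.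
rewrite ws//.
transitivity (\sum_(k < m) N%:R * wint (fun=> 1)); last first.
  by rewrite sumr_const card_ord -[LHS]mulr_natl mulrA -natrM.
apply: eq_bigr => k _; apply: etrans (congr1 (fun z => N%:R * z) (trk k)).
by rewrite wZ// mulVKf.
Qed.

(** The solution [x] of [c * 3 / 4 * x - 1 / c = m]: the mean of [tr (A_k ugrad_k)] summed over [k]
    is [m * N] and dominates [c * 3 / 4 * sqnorm - N / c], so [x] bounds the mean of
    [sqnorm / N]. *)
Definition mbound : R := (m%:R + c^-1) * 4 / (3 * c).

Lemma mbound_ge0 : 0 <= mbound.
Proof.
have := c_gt0 => c0.
by rewrite /mbound !mulr_ge0 ?addr_ge0 ?invr_ge0 ?mulr_ge0// ltW.
Qed.

Lemma second_moment :
  \int[mleb]_x (sqnorm x * weight x) <= N%:R * mbound * partition.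
Proof.
have c0 := c_gt0.
have := congr1 (@complex.Re R) wint_trace_ugrad.
rewrite wint1 natC -rmorphM /= => E.
have iT : ispoly (fun x : T => \sum_k \tr (herms x k *m ugrad V (herms x) k)).
  by apply: ispoly_sum => k; exact: ispoly_trace_ugrad.
have [i1 _] := iw iT; have i2 := integrable_sqnorm_weight; have i3 := integrable_weight.
have i2' : mleb.-integrable setT (EFin \o (fun x => (c * 3 / 4) * (sqnorm x * weight x))).
  exact: (integrableZl measurableT (c * 3 / 4) i2).
have i3' : mleb.-integrable setT (EFin \o (fun x => (N%:R / c) * weight x)).
  exact: (integrableZl measurableT (N%:R / c) i3).
have : \int[mleb]_x (c * 3 / 4 * (sqnorm x * weight x) - N%:R / c * weight x) <= (m * N)%:R * partition.
  rewrite -E; apply: le_Rintegral => //.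
    by apply: eq_integrable (integrableB measurableT i2' i3').
  move=> x _; rewrite mulrA -mulrBl; apply: ler_wpM2r; first by rewrite ltW// weight_gt0.
  exact: (trace_ugrad_ge phi_convex a_lt1 lincoef_le1).
rewrite RintegralB// !RintegralZl// -/partition => h.
have p0 := partition_gt0.
have -> : N%:R * mbound * partition =
  ((m * N)%:R * partition + N%:R / c * partition) * (4 / (3 * c)).
  by rewrite /mbound natrM; field; rewrite lt0r_neq0.
rewrite -ler_pdivrMr ?divr_gt0 ?mulr_gt0//.
apply: le_trans (_ : c * 3 / 4 * \int[mleb]_x (sqnorm x * weight x) <= _); last by lra.
by rewrite le_eqVlt; apply/orP; left; apply/eqP; field; rewrite lt0r_neq0.
Qed.

(** A matrix that commutes with all elementary matrices is scalar, so [N * alpha] is the integral of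
    the trace, and the trace is at most [N + sqnorm x] in modulus. *)
Lemma mean_bound l : exists2 alpha : C, nc alpha <= (1 + mbound) * partition &
  forall a1 b1, wint (fun x => herms x l a1 b1) = (a1 == b1)%:R * alpha.
Proof.
pose i0 : 'I_N := Ordinal N_gt0.
have ex := wint_entry_exchange u_real delta_gt0 coer l.
pose alpha := wint (fun x => herms x l i0 i0).
have alphaE a1 b1 : wint (fun x => herms x l a1 b1) = (a1 == b1)%:R * alpha.
  have := ex a1 i0 i0 b1; rewrite eqxx mul1r => ->.
  exact: (congr1 (fun b : bool => b%:R * alpha) (eq_sym b1 a1)).
exists alpha => //.
have Re_alpha : N%:R * complex.Re alpha =
    \int[mleb]_x (\sum_i complex.Re (herms x l i i) * weight x).
  have iE i : ispoly (fun x : T => herms x l i i) by exact: ispoly_entry.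
  have e : wint (fun x => \sum_i herms x l i i) = N%:R * alpha.
    rewrite ws//; transitivity (\sum_(i < N) alpha).
      by apply: eq_bigr => i _; apply: etrans (alphaE i i) _; rewrite eqxx mul1r.
    by rewrite sumr_const card_ord mulr_natl.
  have := congr1 (@complex.Re R) e; rewrite natC Re_mul /= mul0r subr0 => <-.
  by apply: eq_Rintegral => x _; rewrite raddf_sum mulr_suml.
have Im_alpha : complex.Im alpha = 0.
  rewrite /alpha /wint /=; transitivity (\int[mleb]_x (cst 0 x : R)).
    by apply: eq_Rintegral => x _; rewrite Im_herm_diag mul0r.
  by rewrite /Rintegral integral0.
have -> : nc alpha = `|complex.Re alpha|.
  by rewrite ncE /csqr Im_alpha expr0n /= addr0 sqrtr_sqr.
have iS : ispoly (fun x : T => \sum_i herms x l i i).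
  by apply: ispoly_sum => i; exact: ispoly_entry.
have [i1 _] := iw iS.
have i1' : mleb.-integrable setT (EFin \o (fun x => \sum_i complex.Re (herms x l i i) * weight x)).
  by apply: eq_integrable i1 => // x _ /=; rewrite raddf_sum mulr_suml.
rewrite -(ler_pM2l NR_gt0) -[X in X * `|_|]ger0_norm ?ler0n// -normrM Re_alpha.
apply: le_trans (le_normr_Rintegral _ i1') _ => //.
have p0 := partition_gt0; have sm := second_moment.
have i2 := integrable_sqnorm_weight; have i3 := integrable_weight.
have i3' : mleb.-integrable setT (EFin \o (fun x => N%:R * weight x)).
  exact: (integrableZl measurableT N%:R i3).
apply: (@le_trans _ _ (\int[mleb]_x (N%:R * weight x + sqnorm x * weight x))).
  apply: le_Rintegral => //.
  - by have := integrable_abse i1'.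
  - by apply: eq_integrable (integrableD measurableT i3' i2).
  move=> x _; have w0 := weight_gt0 x.
  rewrite -mulr_suml normrM (gtr0_norm w0) -mulrDl.
  apply: ler_wpM2r; first exact: ltW.
  apply: le_trans (ler_norm_sum _ _ _) _.
  apply: (@le_trans _ _ (\sum_(i < N) (1 + csqr (herms x l i i)))).
    apply: ler_sum => i _; apply: le_trans (Re_le_nc _) _.
    apply: le_trans (@nc_le_amean R _ 1 ltr01) _; rewrite mul1r addrC lerD2r.
    by rewrite invf_le1//; lra.
  rewrite big_split /= sumr_const card_ord; apply: lerD => //.
  apply: (@le_trans _ _ (trace_sqr (herms x l))).
    rewrite trace_sqr_hermE; apply: ler_sum => i _.
    by apply: (ler_term_sum (F := fun j => csqr (herms x l i j))) => j; exact: csqr_ge0.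
  apply: (ler_term_sum (F := fun k => trace_sqr (herms x k))) => k.
  by rewrite trace_sqr_hermE; apply: sumr_ge0 => ? _; apply: sumr_ge0 => ? _; exact: csqr_ge0.
rewrite RintegralD// RintegralZl// -/partition.
by apply: le_trans (lerD (lexx _) sm) _; rewrite le_eqVlt; apply/orP; left; apply/eqP; ring.
Qed.

End moment_bounds.

(** * Sub-Gaussian linear forms and the operator norm *)

Section subgaussian.
Context {R : realType} {m N : nat}.
Notation C := R[i].
Notation T := (mentries R m N).
Notation nc := (@Normc.normc R).
Notation mleb := (@mleb R m N).
Variable V : seq (C * word m).
Variable a : R.
Hypothesis V_real : forall x : T, complex.Im (vtrace V (herms x)) = 0.
Hypothesis phi_convex : forall s (x y : T), 0 <= s <= 1 ->
  phi V a (mconv s x y) <= s * phi V a x + (1 - s) * phi V a y.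
Hypothesis a_lt1 : a < 1.
Hypothesis lincoef_le1 : lincoef V <= 1.
Hypothesis N_gt0 : (0 < N)%N.

Local Notation c := (1 - a).
Local Notation upot := (@upot R m N V).
Local Notation wint := (wint upot).
Local Notation weight := (weight upot).
Local Notation partition := (@partition R m N V).
Local Notation mbound := (@mbound R m a).

Definition bilin (A : 'M[C]_N) (u v : 'I_N -> C) : C :=
  \sum_i \sum_j (u i)^* * A i j * v j.

Definition csq (u : 'I_N -> C) : R := \sum_i csqr (u i).

Lemma nc_conj (z : C) : nc z^* = nc z.
Proof. by rewrite !ncE /csqr; case: z => p q /=; rewrite sqrrN. Qed.

Lemma bilinB (A B : 'M[C]_N) u v : bilin (A - B) u v = bilin A u v - bilin B u v.
Proof.
rewrite /bilin -sumrB; apply: eq_bigr => i _; rewrite -sumrB; apply: eq_bigr => j _.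
by rewrite !mxE; ring.
Qed.

(** Entrywise, [s p r q <= s^2 p^2 q^2 / (4 e) + e r^2]; the first terms sum to at most
    [s^2 / (4 e)] because [csq u * csq v <= 1]. *)
Lemma Re_bilin_amgm (D : 'M[C]_N) u v (s e : R) : csq u <= 1 -> csq v <= 1 -> 0 <= s -> 0 < e ->
  s * complex.Re (bilin D u v) <= s ^+ 2 / (4 * e) + e * \sum_i \sum_j csqr (D i j).
Proof.
move=> u1 v1 s0 e0.
have e4 : 0 < 4 * e by rewrite mulr_gt0.
apply: (@le_trans _ _ (\sum_i \sum_j (s * (nc (u i) * nc (D i j) * nc (v j))))).
  apply: (@le_trans _ _ (s * nc (bilin D u v))).
    by apply: ler_wpM2l => //; apply: le_trans (ler_norm _) (Re_le_nc _).
  under eq_bigr do rewrite -mulr_sumr.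
  rewrite -mulr_sumr; apply: ler_wpM2l => //.
  apply: le_trans (nc_sum _ _ _) _; apply: ler_sum => i _.
  apply: le_trans (nc_sum _ _ _) _; apply: ler_sum => j _.
  by rewrite !ncM nc_conj.
apply: (@le_trans _ _ (\sum_i \sum_j (s ^+ 2 / (4 * e) * (csqr (u i) * csqr (v j)) + e * csqr (D i j)))).
  apply: ler_sum => i _; apply: ler_sum => j _.
  rewrite -!nc_sqr; move: (nc_ge0 (u i)) (nc_ge0 (v j)) (nc_ge0 (D i j)).
  move: (nc (u i)) (nc (v j)) (nc (D i j)) => p q r p0 q0 r0.
  rewrite -subr_ge0.
  have -> : s ^+ 2 / (4 * e) * (p ^+ 2 * q ^+ 2) + e * r ^+ 2 - s * (p * r * q) =
     (s * (p * q) - 2 * e * r) ^+ 2 / (4 * e) by field; rewrite lt0r_neq0.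
  by rewrite divr_ge0 ?sqr_ge0 ?ltW.
under eq_bigr do rewrite big_split /= -!mulr_sumr.
rewrite big_split /=; apply: lerD; last by rewrite mulr_sumr.
rewrite -mulr_sumr -[leRHS]mulr1; apply: ler_wpM2l.
  by rewrite divr_ge0 ?sqr_ge0// ltW.
rewrite -mulr_suml mulr_ile1//; apply: sumr_ge0 => i _; exact: csqr_ge0.
Qed.

Definition mmid (x y : T) : T :=
  [tuple [tuple ((tnth (tnth x k) i + tnth (tnth y k) i) / 2 : measurableTypeR R)
    | i < N * N] | k < m].

Lemma mmidE x y : mmid x y = mconv 2^-1 x y.
Proof.
apply/eq_from_tnth => k; apply/eq_from_tnth => i.
by rewrite !tnth_mktuple; field.
Qed.

Lemma prekopa_leindler_mleb : prekopa_leindler mleb mmid.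
Proof.
have pl1 := @prekopa_leindler_tuple _ _ R _ _ (N * N) (@prekopa_leindler_lebesgue R).
have pl2 := @prekopa_leindler_tuple _ _ R _ _ m pl1.
exact: pl2.
Qed.

(** Parallelogram identity for the Hilbert-Schmidt norm; the subtracted term is the gain from strict
    convexity. *)
Lemma sqnorm_mid x y : sqnorm (mmid x y) = (sqnorm x + sqnorm y) / 2 -
  (\sum_k \sum_i \sum_j csqr ((herms x k - herms y k) i j)) / 4.
Proof.
rewrite /sqnorm -big_split /= !mulr_suml -sumrB; apply: eq_bigr => k _.
rewrite !trace_sqr_hermE -big_split /= !mulr_suml -sumrB; apply: eq_bigr => i _.
rewrite -big_split /= !mulr_suml -sumrB; apply: eq_bigr => j _.
have -> : herm (tnth (mmid x y) k) i j = 2^-1 * (herms x k i j + herms y k i j).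
  have := congr1 (fun A : 'M[C]_N => A i j) (herms_mconv 2^-1 x y k).
  rewrite -mmidE /herms => ->; rewrite [LHS]mxE [X in X + _]mxE [X in _ + X]mxE.
  have -> : 1 - 2^-1 = 2^-1 :> R by field.
  by rewrite -mulrDr fmorphV rmorph_nat.
have subE (A B : 'M[C]_N) : (A - B) i j = A i j - B i j by rewrite !mxE.
rewrite half_complex subE /herms.
move: (herm (tnth x k) i j) (herm (tnth y k) i j) => [p q] [r s].
by rewrite /csqr /=; field.
Qed.

Lemma upot_mid x y : 2 * complex.Re (upot (mmid x y)) <=
  complex.Re (upot x) + complex.Re (upot y) -
  N%:R * c / 4 * \sum_k \sum_i \sum_j csqr ((herms x k - herms y k) i j).
Proof.
rewrite (Re_upot V a (mmid x y)) (Re_upot V a x) (Re_upot V a y) sqnorm_mid mmidE.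
have h01 : 0 <= (2^-1 : R) <= 1 by rewrite invr_ge0 ler0n invf_le1// ler1n.
have := phi_convex x y h01.
have -> : 1 - 2^-1 = 2^-1 :> R by field.
move: (phi V a x) (phi V a y) (phi V a (mconv 2^-1 x y)) => p q r h.
have N0 : 0 <= N%:R :> R by [].
have : N%:R * r <= N%:R * (2^-1 * p + 2^-1 * q) by apply: ler_wpM2l.
set S := \sum_k _; move: (sqnorm x) (sqnorm y) => Sx Sy hN.
rewrite -subr_ge0.
have -> : N%:R * (p + c / 2 * Sx) + N%:R * (q + c / 2 * Sy) - N%:R * c / 4 * S -
  2 * (N%:R * (r + c / 2 * ((Sx + Sy) / 2 - S / 4))) =
  2 * (N%:R * (2^-1 * p + 2^-1 * q) - N%:R * r) by field.
by rewrite mulr_ge0// subr_ge0.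
Qed.

Definition ell k (u v : 'I_N -> C) (x : T) : R := complex.Re (bilin (herms x k) u v).

Lemma ispoly_bilin k u v : ispoly (fun x : T => bilin (herms x k) u v).
Proof.
apply: ispoly_sum => i; apply: ispoly_sum => j.
apply: ispolyM; last exact: ispoly_cst.
by apply: ispolyZ; exact: ispoly_entry.
Qed.

Lemma measurable_ell k u v : measurable_fun setT (ell k u v).
Proof. by have [Df /polyfun_measurable[]] := ispoly_bilin k u v. Qed.

Definition laplace k u v (s : R) : \bar R :=
  (\int[mleb]_x (expR (s * ell k u v x) * weight x)%:E)%E.

Lemma measurable_exp_ell k u v s :
  measurable_fun setT (fun x : T => expR (s * ell k u v x) * weight x).
Proof.
apply: measurable_funM; last exact: measurable_weight (polyfun_upot V).
by apply: measurableT_comp => //; apply: measurable_funM => //; exact: measurable_ell.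
Qed.

(** The two integrands at [x] and [y] produce the exponent [s * (l x - l y)]. It is at most
    [s^2 / (N c)] plus [N c / 4] times the squared distance of [x] and [y], and strict convexity of
    the potential at the midpoint gains exactly this last term. *)
Lemma laplace_PL k u v s : csq u <= 1 -> csq v <= 1 -> 0 <= s ->
  (laplace k u v s * laplace k u v (- s) <=
   (expR (s ^+ 2 / (N%:R * c)))%:E * (partition%:E * partition%:E))%E.
Proof.
move=> u1 v1 s0.
have c0 : 0 < c := c_gt0 a_lt1.
have Nc : 0 < N%:R * c by rewrite mulr_gt0// ltr0n.
(* Half of the exponent, since the function at the midpoint enters squared. *)
pose e := s ^+ 2 / (N%:R * c) / 2.
have we0 x : 0 <= weight x by exact: expR_ge0.
have mw : measurable_fun setT (EFin \o weight).
  by apply/measurable_EFinP; exact: measurable_weight (polyfun_upot V).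
have hI : (\int[mleb]_x ((expR e)%:E * (weight x)%:E) = (expR e)%:E * partition%:E)%E.
  rewrite ge0_integralZl ?lee_fin ?expR_ge0//; last by move=> x _; rewrite lee_fin.
  by rewrite -(partitionE phi_convex a_lt1 lincoef_le1 N_gt0).
have ee : e + e = s ^+ 2 / (N%:R * c) by rewrite /e -splitr.
apply: (@le_trans _ _ ((\int[mleb]_x ((expR e)%:E * (weight x)%:E)) *
  (\int[mleb]_x ((expR e)%:E * (weight x)%:E)))%E); last first.
  by rewrite hI muleACA -EFinM -expRD ee.
apply: prekopa_leindler_mleb.
- by apply/measurable_EFinP; exact: measurable_exp_ell.
- by apply/measurable_EFinP; exact: measurable_exp_ell.
- exact: measurable_funeM.
- by move=> x; rewrite lee_fin mulr_ge0// expR_ge0.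
- by move=> x; rewrite lee_fin mulr_ge0// expR_ge0.
- by move=> x; rewrite mule_ge0// lee_fin// expR_ge0.
move=> x y.
have hE (p q r t : R) : p * q <= r * t * (r * t) ->
  (p%:E * q%:E <= r%:E * t%:E * (r%:E * t%:E))%E by rewrite -!EFinM lee_fin.
apply: hE; move: x y => /= x y.
rewrite /weight -!expRD ler_expR.
have := upot_mid x y.
have Nc4 : 0 < N%:R * c / 4 by rewrite divr_gt0.
have := Re_bilin_amgm (herms x k - herms y k) u1 v1 s0 Nc4.
rewrite bilinB Re_add raddfN /= -/(ell k u v x) -/(ell k u v y).
have -> : s ^+ 2 / (4 * (N%:R * c / 4)) = s ^+ 2 / (N%:R * c).
  by congr (_ / _); field.
have : \sum_i \sum_j csqr ((herms x k - herms y k) i j) <=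
    \sum_k \sum_i \sum_j csqr ((herms x k - herms y k) i j).
  apply: (ler_term_sum (F := fun k => \sum_i \sum_j csqr ((herms x k - herms y k) i j))).
  by move=> l; apply: sumr_ge0 => ? _; apply: sumr_ge0 => ? _; exact: csqr_ge0.
move=> /(ler_wpM2l (ltW Nc4)).
rewrite /e; set S1 := _ * \sum_k _; set S2 := _ * \sum_i _.
generalize (complex.Re (upot x)) (complex.Re (upot y)) (complex.Re (upot (mmid x y))) => p q r.
move: (s ^+ 2 / (N%:R * c)) (ell k u v x) (ell k u v y) => t l1 l2; lra.
Qed.

(** The matrix of means being [alpha] times the identity, the integral of the form is the real part
    of [alpha] times the inner product of [u] and [v]. *)
Lemma Rintegral_ell_bound k u v : csq u <= 1 -> csq v <= 1 ->
  `|\int[mleb]_x (ell k u v x * weight x)| <= (1 + mbound) * partition.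
Proof.
move=> u1 v1.
have [alpha alpha_le alphaE] :=
  mean_bound V_real phi_convex a_lt1 lincoef_le1 N_gt0 k.
have coer := upot_coercive phi_convex a_lt1 lincoef_le1.
have d0 := delta_gt0 a_lt1 N_gt0.
have wZ := wintZ (polyfun_upot V) d0 coer.
have ws := wint_sum (polyfun_upot V) d0 coer.
have -> : \int[mleb]_x (ell k u v x * weight x) =
    complex.Re (wint (fun x : T => bilin (herms x k) u v)) by [].
have -> : wint (fun x : T => bilin (herms x k) u v) = (\sum_i (u i)^* * v i) * alpha.
  have pe i j : ispoly (fun x : T => herms x k i j) by exact: ispoly_entry.
  have pf i j : ispoly (fun x : T => ((u i)^* * v j) * herms x k i j) by exact: ispolyZ.
  transitivity (wint (fun x : T => \sum_i \sum_j ((u i)^* * v j) * herms x k i j)).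
    congr wint; apply/funext => x; apply: eq_bigr => i _; apply: eq_bigr => j _.
    by ring.
  rewrite ws; last by move=> i; exact: ispoly_sum.
  rewrite mulr_suml; apply: eq_bigr => i _.
  rewrite ws//; transitivity (\sum_j ((u i)^* * v j) * ((i == j)%:R * alpha)).
    apply: eq_bigr => j _; rewrite wZ//; congr (_ * _); exact: alphaE.
  rewrite (bigD1 i)//= eqxx mul1r big1 ?addr0// => j; rewrite eq_sym => /negbTE ->.
  by rewrite mul0r mulr0.
apply: le_trans (Re_le_nc _) _; rewrite ncM.
apply: le_trans (_ : 1 * nc alpha <= _); last by rewrite mul1r.
apply: ler_wpM2r; first exact: nc_ge0.
apply: le_trans (nc_sum _ _ _) _.
apply: (@le_trans _ _ (\sum_i (csqr (u i) + csqr (v i)) / 2)).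
  apply: ler_sum => i _; rewrite ncM nc_conj -!nc_sqr.
  have := sqr_ge0 (nc (u i) - nc (v i)); nra.
rewrite -mulr_suml big_split /=.
have -> : \sum_i csqr (u i) + \sum_i csqr (v i) = csq u + csq v by [].
lra.
Qed.

(** Jensen bounds the transform at [- s] from below by [expR (- s * mu)] times the partition
    function, with [mu] the mean of the form; dividing the product inequality by it isolates the
    transform at [s]. *)
Lemma laplace_bound k u v s : csq u <= 1 -> csq v <= 1 -> 0 <= s ->
  (laplace k u v s <=
   (expR (s * (1 + mbound) + s ^+ 2 / (N%:R * c)) * partition)%:E)%E.
Proof.
move=> u1 v1 s0.
have c0 : 0 < c := c_gt0 a_lt1.
have Z0 : 0 < partition := partition_gt0 phi_convex a_lt1 lincoef_le1 N_gt0.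
have we0 x : 0 <= weight x by exact: expR_ge0.
have coer := upot_coercive phi_convex a_lt1 lincoef_le1.
have d0 := delta_gt0 a_lt1 N_gt0.
have [ie _] := integrable_wint (polyfun_upot V) d0 coer (ispoly_bilin k u v).
have iw := integrable_weight phi_convex a_lt1 lincoef_le1 N_gt0.
have lap0 s' : (0 <= laplace k u v s')%E.
  by apply: integral_ge0 => x _; rewrite lee_fin mulr_ge0// expR_ge0.
pose mu := (\int[mleb]_x (ell k u v x * weight x)) / partition.
have jensen : ((expR (- s * mu) * partition)%:E <= laplace k u v (- s))%E.
  have [->|lfin] := eqVneq (laplace k u v (- s)) +oo%E; first exact: leey.
  pose e1 := expR (- s * mu).
  have i1 : mleb.-integrable setT (EFin \o (fun x => e1 * (1 + s * mu) * weight x)).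
    exact: (integrableZl measurableT (e1 * (1 + s * mu)) iw).
  have i2 : mleb.-integrable setT (EFin \o (fun x => e1 * s * (ell k u v x * weight x))).
    exact: (integrableZl measurableT (e1 * s) ie).
  have i3 : mleb.-integrable setT (EFin \o (fun x => expR (- s * ell k u v x) * weight x)).
    apply/integrableP; split; first by apply/measurable_EFinP; exact: measurable_exp_ell.
    rewrite (eq_integral (fun x => (expR (- s * ell k u v x) * weight x)%:E)).
      by rewrite ltey.
    by move=> x _ /=; rewrite ger0_norm// mulr_ge0// expR_ge0.
  have -> : laplace k u v (- s) =
      (\int[mleb]_x (expR (- s * ell k u v x) * weight x))%:E.
    by rewrite /Rintegral fineK//; exact: integrable_fin_num i3.
  rewrite lee_fin.
  apply: (@le_trans _ _ (\int[mleb]_x (e1 * (1 + s * mu) * weight x -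
     e1 * s * (ell k u v x * weight x)))).
    rewrite RintegralB// !RintegralZl//.
    have -> : \int[mleb]_x (ell k u v x * weight x) = mu * partition.
      by rewrite /mu divfK// lt0r_neq0.
    by rewrite -/partition le_eqVlt; apply/orP; left; apply/eqP; rewrite /e1; ring.
  apply: le_Rintegral => //.
    by apply: eq_integrable (integrableB measurableT i1 i2).
  move=> x _.
  have -> : e1 * (1 + s * mu) * weight x - e1 * s * (ell k u v x * weight x) =
     e1 * (1 + (- s * ell k u v x + s * mu)) * weight x by ring.
  apply: ler_wpM2r => //.
  have -> : expR (- s * ell k u v x) = e1 * expR (- s * ell k u v x + s * mu).
    by rewrite -expRD; congr expR; ring.
  by apply: ler_wpM2l; [exact: expR_ge0|exact: expR_ge1Dx].
have PL := laplace_PL k u1 v1 s0.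
have key : (laplace k u v s * (expR (- s * mu) * partition)%:E <=
   (expR (s ^+ 2 / (N%:R * c)))%:E * (partition%:E * partition%:E))%E.
  by apply: le_trans PL; exact: lee_wpmul2l.
have eZ0 : 0 < expR (- s * mu) * partition by rewrite mulr_gt0// expR_gt0.
have lfin : laplace k u v s \is a fin_num.
  rewrite ge0_fin_numE// ltey; apply/eqP => loo.
  by move: key; rewrite loo gt0_mulye ?lte_fin// -!EFinM leye_eq.
rewrite -(fineK lfin) in key *.
rewrite -!EFinM !lee_fin in key *.
rewrite -(ler_pM2r eZ0); apply: le_trans key _.
have mu_le : - mu <= 1 + mbound.
  have := Rintegral_ell_bound k u1 v1.
  rewrite ler_norml => /andP[h _]; rewrite /mu -mulNr ler_pdivrMr//; lra.
have mu_ge : mu <= 1 + mbound.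
  have := Rintegral_ell_bound k u1 v1.
  rewrite ler_norml => /andP[_ h]; rewrite /mu ler_pdivrMr//; lra.
have -> : expR (s * (1 + mbound) + s ^+ 2 / (N%:R * c)) * partition * (expR (- s * mu) * partition)
  = expR (s ^+ 2 / (N%:R * c)) * expR (s * (1 + mbound - mu)) * (partition * partition).
  by rewrite mulrACA -!expRD; congr (expR _ * _); ring.
apply: ler_wpM2r; first by rewrite mulr_ge0// ltW.
rewrite -[leLHS]mulr1; apply: ler_wpM2l; first exact: expR_ge0.
by rewrite -[leLHS]expR0 ler_expR mulr_ge0// subr_ge0.
Qed.

End subgaussian.

(** * Bilinear forms and the operator norm *)

Section bilinear_forms.
Context {R : realType} {N : nat}.
Notation C := R[i].
Notation nc := (@Normc.normc R).
Implicit Types (A : 'M[C]_N) (u v : 'I_N -> C).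

Lemma csq_ge0 u : 0 <= csq u.
Proof. by apply: sumr_ge0 => i _; exact: csqr_ge0. Qed.

Lemma csqrZ (t : R) (z : C) : csqr (t%:C * z) = t ^+ 2 * csqr z.
Proof. by case: z => p q; rewrite /csqr /=; ring. Qed.

Lemma csqZ (t : R) u : csq (fun i => t%:C * u i) = t ^+ 2 * csq u.
Proof. by rewrite /csq mulr_sumr; apply: eq_bigr => i _; exact: csqrZ. Qed.

Lemma csqr_le_csq u i : csqr (u i) <= csq u.
Proof. by apply: (ler_term_sum (F := fun i => csqr (u i))) => j; exact: csqr_ge0. Qed.

Lemma bilinZl A (t : R) u v : bilin A (fun i => t%:C * u i) v = t%:C * bilin A u v.
Proof.
rewrite /bilin mulr_sumr; apply: eq_bigr => i _; rewrite mulr_sumr.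
apply: eq_bigr => j _; rewrite rmorphM -!mulrA; congr (_ * _).
exact: conjc_real.
Qed.

Lemma bilinZr A (t : R) u v : bilin A u (fun i => t%:C * v i) = t%:C * bilin A u v.
Proof.
rewrite /bilin mulr_sumr; apply: eq_bigr => i _; rewrite mulr_sumr.
by apply: eq_bigr => j _; ring.
Qed.

Lemma bilin_split A u v u' v' : bilin A u v =
  bilin A u' v' + (bilin A (fun i => u i - u' i) v + bilin A u' (fun i => v i - v' i)).
Proof.
rewrite /bilin -!big_split /=; apply: eq_bigr => i _; rewrite -!big_split /=.
by apply: eq_bigr => j _; rewrite rmorphB; ring.
Qed.

Definition form_le A (b : R) :=
  forall u v, csq u <= 1 -> csq v <= 1 -> complex.Re (bilin A u v) <= b.

Lemma ReM (t : R) (z : C) : complex.Re (t%:C * z) = t * complex.Re z.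
Proof. by case: z => p q /=; ring. Qed.

(* Approximating both arguments up to 1/4 turns a bound [b] of the form into
   the bound [x + b / 2], so that the least bound is at most [2 * x]. *)
Lemma form_le_of_net A (x : R) (net : ('I_N -> C) -> Prop) :
  (forall u, csq u <= 1 -> exists u', [/\ net u', csq u' <= 1 &
     csq (fun i => u i - u' i) <= 16^-1]) ->
  (forall u v, net u -> net v -> csq u <= 1 -> csq v <= 1 ->
     complex.Re (bilin A u v) <= x) ->
  form_le A (2 * x).
Proof.
move=> happ hx.
pose S : set R := [set y | exists u v, [/\ csq u <= 1, csq v <= 1 &
  y = complex.Re (bilin A u v)]].
have S0 : S !=set0.
  exists (complex.Re (bilin A (fun=> 0) (fun=> 0))); exists (fun=> 0), (fun=> 0).
  by rewrite /csq big1 ?ler01// => i _; rewrite /csqr /= expr0n addr0.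
have Sub : has_ubound S.
  exists (1 ^+ 2 / (4 * 1) + 1 * \sum_i \sum_j csqr (A i j)) => _ [u [v [u1 v1 ->]]].
  by rewrite -[leLHS]mul1r; exact: Re_bilin_amgm.
have hb : form_le A (sup S).
  by move=> u v u1 v1; apply: (ub_le_sup Sub); exists u, v.
suff h : sup S <= 2 * x by move=> u v u1 v1; exact: le_trans (hb _ _ u1 v1) h.
suff : sup S <= x + sup S / 2 by lra.
apply: ge_sup => // _ [u [v [u1 v1 ->]]].
have [u' [nu' u'1 du]] := happ _ u1.
have [v' [nv' v'1 dv]] := happ _ v1.
rewrite (bilin_split A u v u' v') !Re_add; apply: lerD; first exact: hx.
have scal (w : 'I_N -> C) : csq w <= 16^-1 -> csq (fun i => (4 : R)%:C * w i) <= 1.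
  by rewrite csqZ => h; move: h; move: (csq w) => t; lra.
have h1 := hb _ _ (scal _ du) v1.
have h2 := hb _ _ u'1 (scal _ dv).
rewrite bilinZl ReM in h1; rewrite bilinZr ReM in h2.
move: h1 h2; set p := complex.Re _; set q := complex.Re _; lra.
Qed.

(** The form is tested on the normalized vectors [A v] and [v], where its value is real, so a bound
    on real parts is enough. *)
Lemma form_le_opnorm A (b : R) : form_le A b -> forall v,
  csq (fun i => \sum_j A i j * v j) <= b ^+ 2 * csq v.
Proof.
move=> hb v; set w := fun i => _.
have [w0|w0] := eqVneq (csq w) 0; first by rewrite w0 mulr_ge0 ?sqr_ge0 ?csq_ge0.
have v0 : csq v != 0.
  apply: contra_neq w0 => v0; rewrite /csq big1// => i _; rewrite /w big1 ?/csqr/= ?expr0n ?addr0// => j _.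
  have : csqr (v j) <= 0 by rewrite -v0; exact: csqr_le_csq.
  by move: (csqr_ge0 (v j)) => h1 h2; have /eqP := le_anti (introT andP (conj h2 h1));
    rewrite -nc_sqr sqrf_eq0 => /eqP /Normc.eq0_normc ->; rewrite mulr0.
have wp : 0 < csq w by rewrite lt_neqAle eq_sym w0 csq_ge0.
have vp : 0 < csq v by rewrite lt_neqAle eq_sym v0 csq_ge0.
set q := Num.sqrt (csq w); set p := Num.sqrt (csq v).
have q0 : 0 < q by rewrite sqrtr_gt0.
have p0 : 0 < p by rewrite sqrtr_gt0.
have qE : q ^+ 2 = csq w by rewrite sqr_sqrtr// ltW.
have pE : p ^+ 2 = csq v by rewrite sqr_sqrtr// ltW.
have h := hb (fun i => (q^-1)%:C * w i) (fun i => (p^-1)%:C * v i).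
rewrite !csqZ -pE -qE !exprVn !mulVf ?expf_neq0 ?lt0r_neq0// lexx in h.
have {}h := h isT isT.
rewrite bilinZl bilinZr !ReM in h.
have wE : complex.Re (bilin A w v) = csq w.
  rewrite /bilin /csq raddf_sum; apply: eq_bigr => i _.
  under eq_bigr do rewrite -mulrA.
  rewrite -mulr_sumr -/(w i); case: (w i) => s t; rewrite /csqr /=; ring.
rewrite wE -qE in h.
have {}h : q <= b * p.
  rewrite -ler_pdivrMr//; apply: le_trans h; rewrite le_eqVlt; apply/orP; left; apply/eqP.
  by field; rewrite !lt0r_neq0.
by rewrite -qE -pE -exprMn ler_sqr ?nnegrE ?(le_trans (ltW q0) h)// ltW.
Qed.

End bilinear_forms.

Section operator_bound.
Context {R : realType} {m N : nat}.
Notation C := R[i].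
Notation nc := (@Normc.normc R).
Variables (A : 'I_m -> 'M[C]_N) (b : R).
Hypothesis b0 : 0 <= b.
Hypothesis Ab : forall k v, csq (fun i => \sum_j A k i j * v j) <= b ^+ 2 * csq v.

Lemma wmx_opnorm w v :
  csq (fun i => \sum_j wmx A w i j * v j) <= (b ^+ size w) ^+ 2 * csq v.
Proof.
elim: w => [|k w ih].
  rewrite wmx_nil expr0 expr1n mul1r le_eqVlt; apply/orP; left; apply/eqP.
  rewrite /csq; apply: eq_bigr => i _; congr csqr.
  rewrite (bigD1 i)//= mxE eqxx mul1r big1 ?addr0// => j ji.
  by rewrite mxE eq_sym (negbTE ji) mul0r.
rewrite wmx_cons.
have -> : (fun i => \sum_j (A k *m wmx A w) i j * v j) =
    (fun i => \sum_l A k i l * (\sum_j wmx A w l j * v j)).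
  apply/funext => i; under eq_bigr do rewrite mxE mulr_suml.
  rewrite exchange_big; apply: eq_bigr => l _ /=; rewrite mulr_sumr.
  by apply: eq_bigr => j _; rewrite mulrA.
apply: le_trans (Ab k _) _; have -> : (b ^+ size (k :: w)) ^+ 2 * csq v = b ^+ 2 * ((b ^+ size w) ^+ 2 * csq v).
  change (size (k :: w)) with (size w).+1; rewrite (exprS b (size w)); ring.
by apply: ler_wpM2l => //; exact: sqr_ge0.
Qed.

Lemma wmx_diag_le w i : nc (wmx A w i i) <= b ^+ size w.
Proof.
have bw : 0 <= b ^+ size w by exact: exprn_ge0.
rewrite -ler_sqr ?nnegrE ?nc_ge0// nc_sqr.
have := wmx_opnorm w (fun j => (j == i)%:R).
have -> : csq (fun j => (j == i)%:R : C) = 1.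
  rewrite /csq (bigD1 i)//= eqxx big1.
    by rewrite /csqr /= expr0n expr1n !addr0.
  by move=> j /negbTE ->; rewrite /csqr /= expr0n addr0.
rewrite mulr1; apply: le_trans.
apply: le_trans (csqr_le_csq _ i); rewrite (bigD1 i)//= eqxx mulr1 big1 ?addr0//.
by move=> j /negbTE ->; rewrite mulr0.
Qed.

Lemma ntr_le w : (0 < N)%N -> nc (ntr A w) <= b ^+ size w.
Proof.
move=> N0; rewrite /ntr /mxtrace ncM.
have -> : nc N%:R^-1 = N%:R^-1 :> R.
  have -> : N%:R^-1 = (N%:R^-1 : R)%:C by rewrite fmorphV rmorph_nat.
  by rewrite nc_real ger0_norm.
rewrite mulrC ler_pdivrMr ?ltr0n// mulr_natr.
apply: le_trans (nc_sum _ _ _) _.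
apply: (@le_trans _ _ (\sum_(i < N) b ^+ size w)).
  by apply: ler_sum => i _; exact: wmx_diag_le.
by rewrite sumr_const card_ord.
Qed.

Lemma pntr_le W : (0 < N)%N -> nc (pntr A W) <= b ^+ size (flatten W).
Proof.
move=> N0; elim: W => [|w W ih]; first by rewrite /pntr big_nil nc1.
rewrite pntr_cons ncM /= size_cat exprD.
by apply: ler_pM; rewrite ?nc_ge0//; exact: ntr_le.
Qed.

End operator_bound.

(** * A finite net of the unit ball *)

Section grid.
Context {R : realType} {N : nat}.
Notation C := R[i].
Hypothesis N_gt0 : (0 < N)%N.

Local Notation B := (32 * N)%N.
(** With step [1 / mesh] each of the [2 * N] real coordinates has squared error at most
    [1 / (32 * N)], hence [1 / 16] in all, a distance of [1 / 4]. *)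
Definition mesh : R := Num.sqrt (32 * N%:R).

(** Sign and absolute value of an integral coordinate. Zero occurs twice, which is harmless for an
    upper bound on the cardinality; absolute values up to [32 * N] suffice because
    [mesh <= 32 * N]. *)
Definition grid_coord : finType := (bool * 'I_B.+1)%type.
Definition coordval (c : grid_coord) : R := (-1) ^+ c.1 * c.2%:R / mesh.
Definition grid : finType := {ffun 'I_N * bool -> grid_coord}.
Definition gridval (f : grid) (i : 'I_N) : C :=
  coordval (f (i, false)) +i* coordval (f (i, true)).

Lemma mesh_sqr : mesh ^+ 2 = 32 * N%:R.
Proof. by rewrite sqr_sqrtr// mulr_ge0. Qed.

Lemma mesh_ge1 : 1 <= mesh.
Proof.
rewrite -ler_sqr ?nnegrE ?sqrtr_ge0// mesh_sqr expr1n.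
have : 1 <= N%:R :> R by rewrite ler1n. lra.
Qed.

Lemma mesh_gt0 : 0 < mesh. Proof. exact: lt_le_trans ltr01 mesh_ge1. Qed.

Lemma mesh_le : mesh <= B%:R.
Proof.
rewrite natrM -mesh_sqr expr2 -[leLHS]mulr1 ler_wpM2l ?mesh_ge1// ltW// mesh_gt0//.
Qed.

(** Rounds toward zero, so that the rounded vector stays in the unit ball. *)
Definition round_coord (r : R) : grid_coord := (r < 0, inord (Num.trunc (`|r| * mesh))).

Lemma round_coordP (r : R) : `|r| <= 1 ->
  coordval (round_coord r) ^+ 2 <= r ^+ 2 /\
  (r - coordval (round_coord r)) ^+ 2 <= (32 * N%:R)^-1.
Proof.
move=> r1.
have rm0 : 0 <= `|r| * mesh by rewrite mulr_ge0// ltW// mesh_gt0.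
have rmB : `|r| * mesh <= B%:R.
  by apply: le_trans mesh_le; rewrite -[leRHS]mul1r ler_wpM2r// ltW// mesh_gt0.
have [kle klt] := andP (truncn_itv rm0).
rewrite /coordval /round_coord /= inordK; last first.
  by rewrite ltnS -(ler_nat R); exact: le_trans kle rmB.
set k := Num.trunc _ in kle klt *.
have mg := mesh_gt0.
set t := k%:R / mesh.
have tr : t <= `|r| by rewrite ler_pdivrMr.
have t0 : 0 <= t by rewrite divr_ge0// ltW.
have rt : `|r| - t <= mesh^-1.
  rewrite -(ler_pM2r mg) mulVf ?lt0r_neq0// mulrBl divfK ?lt0r_neq0//.
  by rewrite lerBlDr -natr1 addrC in klt *; exact: ltW.
rewrite -mulrA -/t -mesh_sqr -exprVn.
have -> : r - (-1) ^+ (r < 0)%R * t = (-1) ^+ (r < 0)%R * (`|r| - t).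
  rewrite mulrBr; congr (_ - _); case: ltrP => r0.
    by rewrite ltr0_norm// expr1 mulN1r opprK.
  by rewrite ger0_norm// expr0 mul1r.
have sq (x : R) : ((-1) ^+ (r < 0)%R * x) ^+ 2 = x ^+ 2 by rewrite exprMn sqrr_sign mul1r.
rewrite !sq; split.
  by rewrite -(real_normK (num_real r)) ler_sqr ?nnegrE.
by rewrite ler_sqr ?nnegrE ?subr_ge0// invr_ge0 ltW.
Qed.

Lemma grid_approx (u : 'I_N -> C) : csq u <= 1 -> exists f : grid,
  csq (gridval f) <= 1 /\ csq (fun i => u i - gridval f i) <= 16^-1.
Proof.
move=> u1.
pose f : grid := [ffun ib => round_coord (if ib.2 then complex.Im (u ib.1) else complex.Re (u ib.1))].
have sml i : `|complex.Re (u i)| <= 1 /\ `|complex.Im (u i)| <= 1.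
  have := le_trans (csqr_le_csq u i) u1; rewrite /csqr => h.
  by split; rewrite -ler_sqr ?nnegrE// expr1n real_normK ?num_real//;
    apply: le_trans h; rewrite ?lerDl ?lerDr sqr_ge0.
exists f; split.
  apply: le_trans u1; apply: ler_sum => i _.
  have [/round_coordP[h1 _] /round_coordP[h2 _]] := sml i.
  by rewrite /csqr /gridval !ffunE /=; exact: lerD.
apply: (@le_trans _ _ (\sum_(i < N) (2 * (32 * N%:R)^-1))).
  apply: ler_sum => i _.
  have [/round_coordP[_ h1] /round_coordP[_ h2]] := sml i.
  rewrite /csqr /gridval !ffunE.
  move: h1 h2; case: (u i) => p q /=; lra.
rewrite sumr_const card_ord -mulr_natr.
have : N%:R != 0 :> R by rewrite pnatr_eq0 -lt0n.
by move=> N0; rewrite le_eqVlt; apply/orP; left; apply/eqP; field.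
Qed.

Definition net := [pred f : grid | csq (gridval f) <= 1].

Lemma geometric_half (k : nat) : \sum_(j < k) (2^-1 : R) ^+ j <= 2.
Proof.
have : \sum_(j < k) (2^-1 : R) ^+ j = 2 - 2 * 2^-1 ^+ k.
  elim: k => [|k ih]; first by rewrite big_ord0 expr0; ring.
  by rewrite big_ord_recr /= ih exprS; field.
move=> ->; rewrite lerBlDr lerDl mulr_ge0// exprn_ge0// invr_ge0//.
Qed.

(* A point of the net has [\sum k_j <= \sum k_j ^ 2 <= 32 N], where the [k_j]
   are the absolute values of its integral coordinates. *)
Lemma card_net : #|net|%:R <= (2 ^+ (36 * N) : R).
Proof.
(* Counting by weights: [2^-k], summed over both signs, is at most [4] per coordinate, so the
   products over the whole grid sum to at most [4^(2 N)], while each point of the net has weight at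
   least [2^-(32 N)]. This gives [36 = 32 + 4]. *)
pose p (c : grid_coord) : R := 2^-1 ^+ (c.2 : nat).
have sum_p : \sum_(f : grid) \prod_j p (f j) <= 4 ^+ (2 * N).
  rewrite -(bigA_distr_bigA (fun _ c => p c)) prodr_const card_prod card_ord card_bool mulnC.
  apply: lerXn2r; rewrite ?nnegrE//.
    by apply: sumr_ge0 => c _; rewrite exprn_ge0// invr_ge0.
  rewrite -(pair_bigA _ (fun s k => p (s, k))) /= big_bool /p /=.
  have := geometric_half B.+1; lra.
have net_p f : f \in net -> 1 <= 2 ^+ (32 * N) * \prod_j p (f j).
  rewrite inE => f1.
  have hk : (\sum_j ((f j).2 : nat) <= 32 * N)%N.
    rewrite -(ler_nat R) natr_sum natrM -mesh_sqr.
    apply: (@le_trans _ _ (mesh ^+ 2 * csq (gridval f))); last first.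
      by rewrite -[leRHS]mulr1 ler_wpM2l// sqr_ge0.
    rewrite /csq mulr_sumr.
    have -> : \sum_j ((f j).2)%:R = \sum_i \sum_b ((f (i, b)).2)%:R :> R.
      by rewrite pair_bigA; apply: eq_bigr => -[].
    apply: ler_sum => i _; rewrite big_bool /= /csqr /gridval /= mulrDr addrC.
    have hc c : ((c : grid_coord).2)%:R <= mesh ^+ 2 * coordval c ^+ 2.
      rewrite /coordval !exprMn exprVn mulrCA divff ?mulr1 ?expf_neq0 ?lt0r_neq0 ?mesh_gt0//.
      rewrite sqrr_sign mul1r.
      by case: (c.2 : nat) => [|k]; rewrite ?expr0n// -natrX ler_nat leq_pmulr.
    by apply: lerD; exact: hc.
  rewrite /p prodrXr exprVn -[leLHS](@mulfV _ (2 ^+ (\sum_j ((f j).2 : nat)))) ?expf_neq0//.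
  by rewrite ler_wpM2r ?invr_ge0 ?exprn_ge0// ler_eXn2l// ltr1n.
rewrite -sum1_card natr_sum.
apply: (@le_trans _ _ (\sum_(f in net) 2 ^+ (32 * N) * \prod_j p (f j))).
  by apply: ler_sum => f; exact: net_p.
rewrite -mulr_sumr.
have -> : (36 * N = 32 * N + 2 * (2 * N))%N by rewrite mulnA -mulnDl.
rewrite exprD ler_wpM2l ?exprn_ge0//.
have -> : (2 : R) ^+ (2 * (2 * N)) = 4 ^+ (2 * N) by rewrite exprM; congr (_ ^+ _); ring.
apply: le_trans sum_p; rewrite [leRHS](bigID net) /= lerDl.
by apply: sumr_ge0 => f _; apply: prodr_ge0 => j _; rewrite exprn_ge0// invr_ge0.
Qed.

End grid.

(** * Exponential moment of the operator norm *)

Section moments.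
Context {R : realType} {m N : nat}.
Notation C := R[i].
Notation T := (mentries R m N).
Notation nc := (@Normc.normc R).
Notation mleb := (@mleb R m N).
Variable V : seq (C * word m).
Variable a : R.
Hypothesis V_real : forall x : T, complex.Im (vtrace V (herms x)) = 0.
Hypothesis phi_convex : forall s (x y : T), 0 <= s <= 1 ->
  phi V a (mconv s x y) <= s * phi V a x + (1 - s) * phi V a y.
Hypothesis a_lt1 : a < 1.
Hypothesis lincoef_le1 : lincoef V <= 1.
Hypothesis N_gt0 : (0 < N)%N.

Local Notation c := (1 - a).
Local Notation upot := (@upot R m N V).
Local Notation wint := (wint upot).
Local Notation weight := (weight upot).
Local Notation partition := (@partition R m N V).
Local Notation mbound := (@mbound R m a).

Let netindex : finType := ('I_m * (@grid N * @grid N))%type.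
Let netpairs : {pred netindex} := [predX 'I_m & [predX (@net R N) & (@net R N)]].

Let net_ell (i : netindex) : T -> R := ell i.1 (gridval i.2.1) (gridval i.2.2).

(** [ln (net_sum x) / N] bounds all the operator norms at once. The exponent is [2 * N] because
    passing from the net to the ball loses a factor [2]; the term [1] keeps the logarithm
    nonnegative. *)
Definition net_sum (x : T) : R :=
  1 + \sum_(i <- enum netpairs) expR (2 * N%:R * net_ell i x).

(** Rate of growth of the mean of [net_sum]: [m] accounts for the choice of the matrix and the term
    [1], [72] for a pair of points of the net, each among at most [2^(36 N)], and the rest is the
    exponent of [laplace_bound] at [s = 2 * N], divided by [N]. *)
Definition mrate : R := m%:R + 72 + (2 * (1 + mbound) + 4 / c).

Let N0 : 0 < N%:R :> R. Proof. by rewrite ltr0n. Qed.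
Let we0 x : 0 <= weight x. Proof. exact: expR_ge0. Qed.

Lemma mrate_ge1 : 1 <= mrate.
Proof.
have c0 : 0 < c := c_gt0 a_lt1.
have : 0 <= 4 / c by rewrite divr_ge0// ltW.
have := @mbound_ge0 _ m _ a_lt1; have : 0 <= m%:R :> R by [].
rewrite /mrate; lra.
Qed.

Lemma net_sum_ge1 x : 1 <= net_sum x.
Proof. by rewrite lerDl; apply: sumr_ge0 => i _; exact: expR_ge0. Qed.

Lemma net_sum_gt0 x : 0 < net_sum x.
Proof. exact: lt_le_trans ltr01 (net_sum_ge1 x). Qed.

Lemma net_sum_opnorm x k v : csq (fun i => \sum_j herms x k i j * v j) <=
  (ln (net_sum x) / N%:R) ^+ 2 * csq v.
Proof.
apply: form_le_opnorm.
have -> : ln (net_sum x) / N%:R = 2 * (ln (net_sum x) / (2 * N%:R)).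
  by field; rewrite lt0r_neq0.
apply: (form_le_of_net (net := fun u => exists2 f, f \in @net R N & u = gridval f)).
  move=> u /(grid_approx N_gt0)[f [f1 df]]; exists (gridval f); split => //.
  by exists f; rewrite // inE.
move=> _ _ [f nf ->] [g ng ->] _ _.
have N2 : 0 < 2 * N%:R :> R by rewrite mulr_gt0.
rewrite ler_pdivlMr// mulrC -[leLHS]expRK ler_ln ?posrE ?expR_gt0 ?net_sum_gt0//.
have kfg : (k, (f, g)) \in enum netpairs by rewrite mem_enum !inE; apply/and3P.
rewrite /net_sum (big_rem _ kfg) /= addrCA lerDl addr_ge0//.
by apply: sumr_ge0 => i _; exact: expR_ge0.
Qed.

(** Let [b] be the bound on the operator norms. If [b] exceeds [mrate], then [(b / mrate)^p <= expR
    (p * (b / mrate - 1))], and the condition on the length [p] makes this at most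
    [expR (N * (b - mrate))]; otherwise [b^p <= mrate^p]. *)
Lemma pntr_net_sum x W : (size (flatten W))%:R <= mrate * N%:R ->
  nc (pntr (herms x) W) <=
    mrate ^+ size (flatten W) * (1 + expR (- (N%:R * mrate)) * net_sum x).
Proof.
set p := size _ => pK.
have K0 : 0 < mrate := lt_le_trans ltr01 mrate_ge1.
have Kp : 0 <= mrate ^+ p by rewrite exprn_ge0// ltW.
set b := ln (net_sum x) / N%:R.
have b0 : 0 <= b by rewrite divr_ge0 ?ln_ge0 ?net_sum_ge1.
have GE : net_sum x = expR (N%:R * b).
  by rewrite mulrC divfK ?lt0r_neq0// lnK// posrE net_sum_gt0.
apply: le_trans (pntr_le b0 (net_sum_opnorm x) _ N_gt0) _.
rewrite -/p GE -expRD.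
have [bK|Kb] := leP b mrate.
  apply: (@le_trans _ _ (mrate ^+ p * 1)); last first.
    by rewrite ler_wpM2l// lerDl expR_ge0.
  by rewrite mulr1; apply: lerXn2r; rewrite ?nnegrE// ltW.
apply: (@le_trans _ _ (mrate ^+ p * expR (- (N%:R * mrate) + N%:R * b))); last first.
  by rewrite ler_wpM2l// lerDr.
have -> : b ^+ p = mrate ^+ p * (b / mrate) ^+ p.
  by rewrite -exprMn mulrC divfK// lt0r_neq0.
rewrite ler_wpM2l//.
have bm0 : 0 <= b / mrate by apply: divr_ge0 => //; exact: ltW.
apply: (@le_trans _ _ (expR (b / mrate - 1) ^+ p)).
  apply: lerXn2r; rewrite ?nnegrE ?expR_ge0//.
  by have := expR_ge1Dx (b / mrate - 1); rewrite addrC subrK.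
rewrite -expRM_natl ler_expR.
have -> : p%:R * (b / mrate - 1) = p%:R / mrate * (b - mrate).
  by field; rewrite lt0r_neq0.
have -> : - (N%:R * mrate) + N%:R * b = N%:R * (b - mrate) by ring.
by rewrite ler_wpM2r ?subr_ge0 ?(ltW Kb)// ler_pdivrMr// mulrC.
Qed.

Lemma expR1_ge2 : 2 <= expR (1 : R).
Proof. by have := expR_ge1Dx (1 : R). Qed.

Lemma integral_net_sum :
  (\int[mleb]_x (net_sum x * weight x)%:E <= (expR (N%:R * mrate) * partition)%:E)%E.
Proof.
have c0 : 0 < c := c_gt0 a_lt1.
have Z0 : 0 < partition := partition_gt0 phi_convex a_lt1 lincoef_le1 N_gt0.
pose X : R := expR (N%:R * (2 * (1 + mbound) + 4 / c)).
have mw : measurable_fun setT (EFin \o weight).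
  by apply/measurable_EFinP; exact: measurable_weight (polyfun_upot V).
have me i : measurable_fun setT (fun x => (expR (2 * N%:R * net_ell i x) * weight x)%:E).
  by apply/measurable_EFinP; exact: measurable_exp_ell.
have e0 i x : (0 <= (expR (2 * N%:R * net_ell i x) * weight x)%:E)%E.
  by rewrite lee_fin mulr_ge0// expR_ge0.
have -> : (\int[mleb]_x (net_sum x * weight x)%:E = partition%:E +
    \sum_(i <- enum netpairs) laplace V i.1 (gridval i.2.1) (gridval i.2.2) (2 * N%:R))%E.
  transitivity (\int[mleb]_x ((EFin \o weight) x +
     \sum_(i <- enum netpairs) (expR (2 * N%:R * net_ell i x) * weight x)%:E))%E.
    apply: eq_integral => x _; rewrite /net_sum mulrDl mul1r mulr_suml EFinD sumEFin.
    by [].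
  rewrite ge0_integralD//.
  - by rewrite -(partitionE phi_convex a_lt1 lincoef_le1 N_gt0) ge0_integral_sum.
  - by move=> x _; rewrite lee_fin.
  - by move=> x _; apply: sume_ge0 => i _.
  - exact: emeasurable_sum.
apply: (@le_trans _ _ (partition%:E + \sum_(i <- enum netpairs) (X * partition)%:E)%E).
  apply: leeD2l; rewrite big_seq [leRHS]big_seq; apply: lee_sum => i.
  rewrite mem_enum !inE /= => /andP[f1 g1].
  apply: le_trans (laplace_bound V_real phi_convex a_lt1 lincoef_le1 N_gt0 _ f1 g1 _) _.
    by rewrite mulr_ge0.
  rewrite lee_fin /X ler_wpM2r ?(ltW Z0)// ler_expR le_eqVlt; apply/orP; left; apply/eqP.
  by field; rewrite !lt0r_neq0.
rewrite sumEFin -EFinD lee_fin.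
have -> : \sum_(i <- enum netpairs) X * partition = #|netpairs|%:R * X * partition.
  by rewrite big_const_seq count_predT -cardE iter_addr_0 -mulrA mulr_natl.
apply: (@le_trans _ _ ((1 + #|netpairs|%:R * X) * partition)); first by rewrite mulrDl mul1r.
apply: ler_wpM2r; first exact: ltW.
have X1 : 1 <= X.
  have h1 : 0 <= 4 / c by rewrite divr_ge0// ltW.
  have h2 : 0 <= 2 * (1 + mbound) by rewrite mulr_ge0// addr_ge0// mbound_ge0.
  by rewrite -[leLHS]expR0 ler_expR mulr_ge0// addr_ge0.
have cardE : #|netpairs|%:R <= m%:R * 2 ^+ (72 * N) :> R.
  rewrite /netpairs !cardX card_ord !natrM ler_wpM2l//.
  have -> : (72 * N = 36 * N + 36 * N)%N by rewrite -mulnDl.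
  by rewrite exprD; apply: ler_pM => //; exact: card_net.
apply: (@le_trans _ _ ((1 + m%:R) * 2 ^+ (72 * N) * X)).
  have P1 : 1 <= (2 : R) ^+ (72 * N) by rewrite exprn_ege1// ler1n.
  rewrite mulrDl mulrDl mul1r; apply: lerD; first by rewrite mulr_ege1.
  by rewrite ler_wpM2r// (le_trans ler01).
have -> : expR (N%:R * mrate) = expR (N%:R * m%:R) * expR (N%:R * 72) * X.
  by rewrite /X -!expRD; congr expR; rewrite /mrate; ring.
apply: ler_wpM2r; first exact: expR_ge0.
apply: ler_pM; rewrite ?addr_ge0 ?exprn_ge0//.
  apply: le_trans (expR_ge1Dx _) _; rewrite ler_expR -[leLHS]mul1r ler_wpM2r// ler1n.
  by [].
have -> : N%:R * 72 = (72 * N)%:R * 1 :> R by rewrite natrM; ring.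
rewrite expRM_natl.
apply: lerXn2r; rewrite ?nnegrE ?expR_ge0//; exact: expR1_ge2.
Qed.

Lemma integrable_net_sum :
  mleb.-integrable setT (EFin \o (fun x => net_sum x * weight x)).
Proof.
apply/integrableP; split.
  apply/measurable_EFinP; apply: measurable_funM; last exact: measurable_weight (polyfun_upot V).
  apply: measurable_funD => //; apply: measurable_sum => i.
  apply: measurableT_comp => //; apply: measurable_funM => //; exact: measurable_ell.
rewrite (eq_integral (fun x => (net_sum x * weight x)%:E)).
  by apply: le_lt_trans integral_net_sum _; rewrite ltry.
by move=> x _ /=; rewrite ger0_norm// mulr_ge0// ltW// net_sum_gt0.
Qed.

(** The factor [4] is [2 * 2]: real and imaginary parts, and the two summands [1] and
    [expR (- N * mrate) * net_sum], each of mean at most [1]. *)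
Lemma moment_bound W : (size (flatten W))%:R <= mrate * N%:R ->
  nc (wint (fun x => pntr (herms x) W)) <= 4 * mrate ^+ size (flatten W) * partition.
Proof.
move=> pK; set p := size _.
have K0 : 0 < mrate := lt_le_trans ltr01 mrate_ge1.
have iw := integrable_weight phi_convex a_lt1 lincoef_le1 N_gt0.
have coer := upot_coercive phi_convex a_lt1 lincoef_le1.
have d0 := delta_gt0 a_lt1 N_gt0.
have Z0 : 0 < partition := partition_gt0 phi_convex a_lt1 lincoef_le1 N_gt0.
pose H x := mrate ^+ p * weight x + mrate ^+ p * expR (- (N%:R * mrate)) * (net_sum x * weight x).
have i1 : mleb.-integrable setT (EFin \o (fun x => mrate ^+ p * weight x)).
  exact: (integrableZl measurableT (mrate ^+ p) iw).
have i2 : mleb.-integrable setT (EFin \o (fun x => mrate ^+ p * expR (- (N%:R * mrate)) * (net_sum x * weight x))).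
  exact: (integrableZl measurableT (mrate ^+ p * expR (- (N%:R * mrate))) integrable_net_sum).
have iH : mleb.-integrable setT (EFin \o H).
  exact: eq_integrable (integrableD measurableT i1 i2).
have intH : \int[mleb]_x H x <= 2 * mrate ^+ p * partition.
  rewrite /H RintegralD// !RintegralZl//; last exact: integrable_net_sum.
  rewrite -/partition.
  have : \int[mleb]_x (net_sum x * weight x) <= expR (N%:R * mrate) * partition.
    have := integral_net_sum; rewrite /Rintegral.
    have := integrable_fin_num measurableT integrable_net_sum => /fineK <-.
    by rewrite lee_fin.
  move=> /(ler_wpM2l (expR_ge0 (- (N%:R * mrate)))).
  rewrite mulrA -expRD addNr expR0 mul1r => /(ler_wpM2l (exprn_ge0 p (ltW K0))).
  rewrite mulrA; set u := _ * partition; set v := _ * \int[_]_x _.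
  have -> : 2 * mrate ^+ p * partition = u + u by rewrite /u; ring.
  lra.
have ipn : ispoly (fun x : T => pntr (herms x) W).
  by exists (fun x H => dpntr (herms x) H W); exact: polyfun_pntr.
have [ire iim] := integrable_wint (polyfun_upot V) d0 coer ipn.
have hb (f : T -> R) : mleb.-integrable setT (EFin \o (fun x => f x * weight x)) ->
    (forall x, `|f x| <= nc (pntr (herms x) W)) ->
    `|\int[mleb]_x (f x * weight x)| <= 2 * mrate ^+ p * partition.
  move=> fi fle; apply: le_trans intH; apply: le_trans (le_normr_Rintegral measurableT fi) _.
  apply: le_Rintegral => //; first exact: (integrable_norm fi).
  move=> x _; rewrite normrM (ger0_norm (we0 x)).
  have -> : H x = mrate ^+ p * (1 + expR (- (N%:R * mrate)) * net_sum x) * weight x.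
    by rewrite /H; ring.
  by rewrite ler_wpM2r//; apply: le_trans (fle x) _; exact: pntr_net_sum.
apply: le_trans (nc_le_ReIm _) _.
have -> : 4 * mrate ^+ p * partition = 2 * mrate ^+ p * partition + 2 * mrate ^+ p * partition.
  by ring.
apply: lerD; apply: hb => // x; [exact: Re_le_nc|exact: Im_le_nc].
Qed.

End moments.

(** * Contraction and the limit law *)

Section weights.
Context {R : realType} {m : nat}.
Notation C := R[i].
Notation nc := (@Normc.normc R).
Implicit Types (w v : word m) (W : seq (word m)).

Lemma sum_splits_le (g : nat -> nat -> R) i v : (forall j l, 0 <= g j l) ->
  \sum_(p <- splits i v) g (size p.1) (size p.2) <=
  \sum_(j < size v) g j (size v - j.+1)%N.
Proof.
elim: v g => [|k v ih] g g0; first by rewrite /= big_nil big_ord0.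
rewrite /= big_cat /= big_map big_ord_recl /= subn1 /=; apply: lerD.
  by case: ifP => _; rewrite ?big_nil// big_seq1.
by apply: le_trans (ih (fun j l => g j.+1 l) _) _.
Qed.

(** Telescoping, from [1 / (l + 2)^2 <= 1 / (l + 1) - 1 / (l + 2)]. *)
Lemma sum_inv_sqr_le n : \sum_(j < n) (j.+1%:R ^+ 2)^-1 <= 2 :> R.
Proof.
suff h l : \sum_(j < l.+1) (j.+1%:R ^+ 2)^-1 <= 2 - l.+1%:R^-1 :> R.
  case: n => [|n]; first by rewrite big_ord0.
  by apply: le_trans (h n) _; rewrite lerBlDr lerDl.
elim: l => [|l ih]; first by rewrite big_ord1 expr1n invr1; lra.
rewrite big_ord_recr /=.
have p1 : 0 < l.+1%:R :> R by []. have p2 : 0 < l.+2%:R :> R by [].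
suff : (l.+2%:R ^+ 2)^-1 <= l.+1%:R^-1 - l.+2%:R^-1 :> R.
  by move=> h; apply: le_trans (lerD ih h) _; rewrite addrA subrK.
rewrite -subr_ge0.
have E2 : l.+2%:R = l.+1%:R + 1 :> R by rewrite -natr1.
rewrite E2 in p2 *; move: p1 p2; move: (l.+1%:R : R) => t p1 p2.
have -> : t^-1 - (t + 1)^-1 - ((t + 1) ^+ 2)^-1 = (t * (t + 1) ^+ 2)^-1.
  by field; rewrite !lt0r_neq0.
by rewrite invr_ge0 mulr_ge0 ?sqr_ge0// ltW.
Qed.

(* [1 / (j l) = (1 / j + 1 / l) / (j + l)] *)
Lemma convolution_inv_sqr n :
  \sum_(j < n) ((j.+1%:R ^+ 2)^-1 * ((n - j.+1).+1%:R ^+ 2)^-1) <=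
  32 * (n.+2%:R ^+ 2)^-1 :> R.
Proof.
pose s (j : nat) : R := (j.+1%:R ^+ 2)^-1.
have n1 : 0 < n.+1%:R :> R by [].
apply: (@le_trans _ _ (\sum_(j < n) (2 * (n.+1%:R ^+ 2)^-1 * (s j + s (n - j.+1)%N)))).
  apply: ler_sum => j _; rewrite /s.
  have -> : (n.+1%:R : R) = j.+1%:R + (n - j.+1).+1%:R.
    by rewrite -natrD addnS subnKC.
  have p1 : 0 < j.+1%:R :> R by []. have p2 : 0 < (n - j.+1).+1%:R :> R by [].
  move: p1 p2; move: (j.+1%:R : R) ((n - j.+1).+1%:R : R) => p q p0 q0.
  rewrite -subr_ge0.
  have -> : 2 * ((p + q) ^+ 2)^-1 * ((p ^+ 2)^-1 + (q ^+ 2)^-1) - (p ^+ 2)^-1 * (q ^+ 2)^-1 =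
     ((p - q) / ((p + q) * (p * q))) ^+ 2.
    by field; rewrite !lt0r_neq0// addr_gt0.
  exact: sqr_ge0.
rewrite -mulr_sumr big_split /=.
have -> : \sum_(j < n) s (n - j.+1)%N = \sum_(j < n) s j.
  by rewrite [RHS](reindex_inj rev_ord_inj).
have h := sum_inv_sqr_le n.
apply: (@le_trans _ _ (8 * (n.+1%:R ^+ 2)^-1)).
  have -> : 8 * (n.+1%:R ^+ 2)^-1 = 2 * (n.+1%:R ^+ 2)^-1 * 4 :> R by ring.
  apply: ler_wpM2l; first by rewrite mulr_ge0// invr_ge0 sqr_ge0.
  by move: h; rewrite -/(s _); set S := \sum_(j < n) _; rewrite /s -/S; lra.
have E2 : n.+2%:R = n.+1%:R + 1 :> R by rewrite -natr1.
have n1' : 1 <= n.+1%:R :> R by rewrite ler1n.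
rewrite E2; move: n1' n1; move: (n.+1%:R : R) => t t1 t0.
rewrite -subr_ge0.
have -> : 32 * ((t + 1) ^+ 2)^-1 - 8 * (t ^+ 2)^-1 =
  8 * ((t - 1) * (3 * t + 1)) * (t ^+ 2 * (t + 1) ^+ 2)^-1.
  by field; rewrite !lt0r_neq0// addr_gt0.
have t2 : 0 <= 3 * t + 1 by lra.
apply: mulr_ge0; first by rewrite mulr_ge0// mulr_ge0 ?subr_ge0.
by rewrite invr_ge0; apply: mulr_ge0; exact: sqr_ge0.
Qed.

Lemma partial_sum_le (f : nat -> R) l l' : (forall j, 0 <= f j) -> (l <= l')%N ->
  \sum_(j < l) f j <= \sum_(j < l') f j.
Proof.
move=> f0 ll'; rewrite -[l'](subnKC ll') big_split_ord /= lerDl.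
by apply: sumr_ge0 => j _; exact: f0.
Qed.

(** The pairs of indices with [j + l + 1 < L] form part of the square. *)
Lemma convolution_le_square (f : nat -> R) L : (forall j, 0 <= f j) ->
  \sum_(n < L) \sum_(j < n) f j * f (n - j.+1)%N <= (\sum_(j < L) f j) ^+ 2.
Proof.
move=> f0.
suff -> : \sum_(n < L) \sum_(j < n) f j * f (n - j.+1)%N =
    \sum_(j < L) f j * \sum_(l < L - j.+1) f l.
  rewrite expr2 mulr_suml; apply: ler_sum => j _; apply: ler_wpM2l => //.
  by apply: partial_sum_le => //; exact: leq_subr.
elim: L => [|L ih]; first by rewrite !big_ord0.
rewrite big_ord_recr /= ih [RHS]big_ord_recr /= subnn big_ord0 mulr0 addr0 -big_split.
apply: eq_bigr => j _ /=; rewrite -mulrDr subSn// big_ord_recr.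
by [].
Qed.

Variable V : seq (C * word m).
Variables (r rho delta : R) (D : nat).
Hypothesis r_gt2 : 2 < r.
Hypothesis rho_ge12 : 12 <= rho.
Hypothesis degree_le : forall i cv, cv \in cyclic_terms i V -> (size cv.2 <= D)%N.
Hypothesis coef_le : forall i, \sum_(cv <- cyclic_terms i V) nc cv.1 <= delta.
Hypothesis small_rho : 16 * rho ^+ D * delta <= 1.
Hypothesis small_r : 4 / r ^+ 2 + 2 * m%:R * delta * r ^+ D <= 1.

Let rho_gt0 : 0 < rho. Proof. exact: lt_le_trans rho_ge12. Qed.
Let r_gt0 : 0 < r. Proof. exact: lt_trans r_gt2. Qed.

Definition lweight (l : nat) : R := rho ^+ l / l.+1%:R ^+ 2.

Lemma lweight_ge0 l : 0 <= lweight l.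
Proof. by rewrite divr_ge0 ?exprn_ge0 ?sqr_ge0 ?(ltW rho_gt0). Qed.

(** Each sum takes a quarter. The splits give [32 / rho^2], below [1 / 4] because [12^2 >= 128]. The
    terms of [V] give [4 * rho^D * delta], where [4] bounds the change of the denominator when the
    word gets shorter by one letter. *)
Lemma lweight_contract i v :
  \sum_(p <- splits i v) lweight (size p.1) * lweight (size p.2) +
  \sum_(cv <- cyclic_terms i V) nc cv.1 * lweight (size (cv.2 ++ v)) <=
  2^-1 * lweight (size v).+1.
Proof.
set n := size v.
have lw : 0 <= lweight n.+1 := lweight_ge0 _.
have h1 : \sum_(p <- splits i v) lweight (size p.1) * lweight (size p.2) <= 4^-1 * lweight n.+1.
  apply: le_trans (sum_splits_le (g := fun j l => lweight j * lweight l) _ _ _) _.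
    by move=> j l; rewrite mulr_ge0 ?lweight_ge0.
  rewrite -/n; have [n0|n0] := posnP n.
    by rewrite n0 big_ord0 mulr_ge0// -n0.
  have -> : \sum_(j < n) lweight j * lweight (n - j.+1) =
    rho ^+ n.-1 * \sum_(j < n) ((j.+1%:R ^+ 2)^-1 * ((n - j.+1).+1%:R ^+ 2)^-1).
    rewrite mulr_sumr; apply: eq_bigr => j _; rewrite /lweight mulrACA -exprD.
    by rewrite subnS -subn1 addnBA ?subn_gt0// subnKC ?subn1// ltnW.
  apply: (@le_trans _ _ (rho ^+ n.-1 * (32 * (n.+2%:R ^+ 2)^-1))).
    by rewrite ler_wpM2l ?exprn_ge0 ?(ltW rho_gt0)// convolution_inv_sqr.
  rewrite /lweight; have q0 : 0 <= (n.+2%:R ^+ 2)^-1 :> R by rewrite invr_ge0 sqr_ge0.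
  rewrite !mulrA ler_wpM2r//.
  apply: (@le_trans _ _ (rho ^+ n.-1 * (4^-1 * rho ^+ 2))).
    rewrite ler_wpM2l ?exprn_ge0 ?(ltW rho_gt0)//; have := rho_ge12; nra.
  by rewrite mulrCA -exprD addn2 prednK.
have h2 : \sum_(cv <- cyclic_terms i V) nc cv.1 * lweight (size (cv.2 ++ v)) <= 4^-1 * lweight n.+1.
  apply: (@le_trans _ _ (\sum_(cv <- cyclic_terms i V) nc cv.1 * (4 * rho ^+ D * lweight n.+1))).
    rewrite big_seq [leRHS]big_seq; apply: ler_sum => cv /degree_le dcv.
    apply: ler_wpM2l; first exact: nc_ge0.
    rewrite size_cat -/n /lweight.
    have -> : 4 * rho ^+ D * (rho ^+ n.+1 / n.+2%:R ^+ 2) =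
       (rho ^+ D * rho ^+ n.+1) * (4 / n.+2%:R ^+ 2) by ring.
    apply: ler_pM; rewrite ?exprn_ge0 ?invr_ge0 ?sqr_ge0 ?(ltW rho_gt0)//.
      rewrite -exprD ler_weXn2l//; first by apply: le_trans rho_ge12; lra.
      by rewrite addnS leqW// leq_add2r.
    have n0 : 0 < n.+2%:R :> R by [].
    have s0 : 0 < (size cv.2 + n).+1%:R :> R by [].
    rewrite ler_pdivlMr ?exprn_gt0// mulrC ler_pdivrMr ?exprn_gt0//.
    have -> : 4 * (size cv.2 + n).+1%:R ^+ 2 = (2 * (size cv.2 + n).+1%:R) ^+ 2 :> R by ring.
    rewrite ler_sqr ?nnegrE ?mulr_ge0// -natrM ler_nat mul2n -addnn.
    by rewrite -[n.+2]add1n leq_add// ltnS leq_addl.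
  rewrite -mulr_suml.
  apply: (@le_trans _ _ (delta * (4 * rho ^+ D * lweight n.+1))).
    by rewrite ler_wpM2r// mulr_ge0// mulr_ge0// exprn_ge0// ltW.
  have -> : delta * (4 * rho ^+ D * lweight n.+1) = (16 * rho ^+ D * delta) * (4^-1 * lweight n.+1).
    by field.
  by rewrite -[leRHS]mul1r ler_wpM2r// mulr_ge0// invr_ge0.
move: h1 h2 lw; move: (\sum_(p <- _) _) (\sum_(cv <- _) _) (lweight n.+1) => p q t; lra.
Qed.

(** Uses [(l + 1)^2 <= 4^l]. *)
Lemma expr_le_lweight (K : R) l : 0 <= K -> 4 * K <= rho -> K ^+ l <= lweight l.
Proof.
move=> K0 Krho.
rewrite ler_pdivlMr ?exprn_gt0//.
apply: (@le_trans _ _ ((4 * K) ^+ l)); last first.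
  by apply: lerXn2r; rewrite ?nnegrE ?mulr_ge0// ltW.
rewrite exprMn mulrC ler_wpM2r ?exprn_ge0//.
have -> : 4 = 2 ^+ 2 :> R by ring.
rewrite -exprM mulnC exprM; apply: lerXn2r; rewrite ?nnegrE ?exprn_ge0//.
by rewrite -natrX ler_nat ltn_expl.
Qed.

(** The recursion for one word with absolute values, iterated [k] times from the values [1] at
    length [0] and [0] elsewhere. Without potential it is the recursion of the moments of the
    semicircle law; summing over all letters makes it depend on lengths only. *)
Fixpoint majorant (k l : nat) : R :=
  if l is n.+1 then
    if k is k'.+1 then
      \sum_(j < n) majorant k' j * majorant k' (n - j.+1)%N +
      \sum_i \sum_(cv <- cyclic_terms i V) nc cv.1 * majorant k' (size cv.2 + n)%N
    else 0
  else 1.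

Lemma majorantS k n : majorant k.+1 n.+1 =
  \sum_(j < n) majorant k j * majorant k (n - j.+1)%N +
  \sum_i \sum_(cv <- cyclic_terms i V) nc cv.1 * majorant k (size cv.2 + n)%N.
Proof. by []. Qed.

Lemma majorant0 k : majorant k 0 = 1. Proof. by case: k. Qed.

Lemma majorant_ge0 k l : 0 <= majorant k l.
Proof.
elim: k l => [|k ih] [|n] //; rewrite majorantS addr_ge0//.
  by apply: sumr_ge0 => j _; rewrite mulr_ge0.
by apply: sumr_ge0 => j _; apply: sumr_ge0 => cv _; rewrite mulr_ge0 ?nc_ge0.
Qed.

Lemma majorant_nondecreasing k l : majorant k l <= majorant k.+1 l.
Proof.
elim: k l => [|k ih] [|n] //; first exact: majorant_ge0.
rewrite majorantS [leRHS]majorantS; apply: lerD.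
  by apply: ler_sum => j _; apply: ler_pM; rewrite ?majorant_ge0.
apply: ler_sum => i _; apply: ler_sum => cv _.
by apply: ler_wpM2l; rewrite ?nc_ge0.
Qed.

Lemma majorant_step k i v :
  \sum_(p <- splits i v) majorant k (size p.1) * majorant k (size p.2) +
  \sum_(cv <- cyclic_terms i V) nc cv.1 * majorant k (size (cv.2 ++ v)) <=
  majorant k.+1 (size v).+1.
Proof.
rewrite majorantS; apply: lerD.
  apply: (sum_splits_le (g := fun j l => majorant k j * majorant k l)) => j l.
  by rewrite mulr_ge0 ?majorant_ge0.
under eq_bigr do rewrite size_cat.
apply: (ler_term_sum (F := fun i => \sum_(cv <- cyclic_terms i V) nc cv.1 * majorant k (size cv.2 + size v)%N)).
by move=> l; apply: sumr_ge0 => cv _; rewrite mulr_ge0 ?nc_ge0 ?majorant_ge0.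
Qed.

(** If the generating function at [1 / r] is at most [2], then after one more iteration it is at
    most [1 + 4 / r^2 + 2 m delta r^D], which [small_r] keeps below [2]. For small [delta] this is
    possible exactly because [r > 2]. *)
Lemma majorant_series k L : \sum_(l < L) majorant k l * r^-1 ^+ l <= 2.
Proof.
have z0 : 0 < r^-1 by rewrite invr_gt0.
have z1 : r^-1 <= 1 by rewrite invf_le1//; have := r_gt2; lra.
pose f k l := majorant k l * r^-1 ^+ l.
have f0 k' l : 0 <= f k' l by rewrite mulr_ge0 ?majorant_ge0 ?exprn_ge0 ?ltW.
rewrite -/(f k _) (_ : \sum_(l < L) _ = \sum_(l < L) f k l)//.
elim: k L => [|k ih] [|L]; rewrite ?big_ord0//.
  rewrite big_ord_recl /f /= mulr1 big1 ?addr0 ?ler1n// => l _.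
  by rewrite mul0r.
rewrite big_ord_recl /= {1}/f majorant0 expr0 mulr1.
have -> : \sum_(n < L) f k.+1 (lift ord0 n) =
    r^-1 ^+ 2 * (\sum_(n < L) \sum_(j < n) f k j * f k (n - j.+1)%N) +
    \sum_i \sum_(cv <- cyclic_terms i V) nc cv.1 * (r^-1 * r ^+ size cv.2 * \sum_(n < L) f k (size cv.2 + n)%N).
  transitivity (\sum_(n < L) ((\sum_(j < n) r^-1 ^+ 2 * (f k j * f k (n - j.+1)%N)) +
     \sum_i \sum_(cv <- cyclic_terms i V) nc cv.1 * (r^-1 * r ^+ size cv.2 * f k (size cv.2 + n)%N))).
    apply: eq_bigr => n _; rewrite /f lift0 majorantS mulrDl; congr (_ + _).
      rewrite mulr_suml; apply: eq_bigr => j _.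
      have -> : r^-1 ^+ n.+1 = r^-1 ^+ 2 * (r^-1 ^+ j * r^-1 ^+ (n - j.+1)).
        by rewrite -!exprD !addSn add0n -addSn subnKC.
      ring.
    rewrite mulr_suml; apply: eq_bigr => i _; rewrite mulr_suml; apply: eq_bigr => cv _.
    have rd : r ^+ size cv.2 * r^-1 ^+ size cv.2 = 1.
      by rewrite exprVn mulfV// expf_neq0// lt0r_neq0.
    rewrite exprS exprD -[LHS]mulr1 -rd; ring.
  rewrite big_split /=; congr (_ + _).
    by rewrite mulr_sumr; apply: eq_bigr => n _; rewrite mulr_sumr.
  rewrite exchange_big; apply: eq_bigr => i _; rewrite exchange_big /=.
  by apply: eq_bigr => cv _; rewrite -!mulr_sumr.
have h1 : r^-1 ^+ 2 * (\sum_(n < L) \sum_(j < n) f k j * f k (n - j.+1)%N) <= 4 / r ^+ 2.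
  rewrite mulrC -exprVn ler_wpM2r ?sqr_ge0//.
  apply: le_trans (convolution_le_square _ _) _ => //.
  have -> : 4 = 2 ^+ 2 :> R by ring.
  by apply: lerXn2r; rewrite ?nnegrE// sumr_ge0.
have h2 : \sum_i \sum_(cv <- cyclic_terms i V) nc cv.1 * (r^-1 * r ^+ size cv.2 * \sum_(n < L) f k (size cv.2 + n)%N)
    <= 2 * m%:R * delta * r ^+ D.
  apply: (@le_trans _ _ (\sum_(i < m) (delta * (2 * r ^+ D)))).
    apply: ler_sum => i _.
    apply: (@le_trans _ _ (\sum_(cv <- cyclic_terms i V) nc cv.1 * (2 * r ^+ D))); last first.
      by rewrite -mulr_suml ler_wpM2r// mulr_ge0// exprn_ge0// ltW.
    rewrite big_seq [leRHS]big_seq; apply: ler_sum => cv /degree_le dcv.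
    apply: ler_wpM2l; first exact: nc_ge0.
    rewrite [leRHS]mulrC; apply: ler_pM.
    - by rewrite mulr_ge0 ?exprn_ge0// ltW.
    - by apply: sumr_ge0.
    - rewrite -[leRHS]mul1r; apply: ler_pM; rewrite ?exprn_ge0 ?(ltW r_gt0) ?(ltW z0)//.
      by rewrite ler_weXn2l//; have := r_gt2; lra.
    (* The words of [V] shift the index, so the induction hypothesis is used for a longer partial
       sum. *)
    apply: le_trans (ih (size cv.2 + L)%N).
    rewrite big_split_ord /= lerDr; apply: sumr_ge0 => j _; exact: f0.
  by rewrite sumr_const card_ord -mulr_natr le_eqVlt; apply/orP; left; apply/eqP; ring.
by move: h1 h2 small_r; set p := _ * _; set q := \sum_i _; lra.
Qed.

(** The term of length [0] already uses [1] of the total [2], so any other term is at most [1]. *)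
Lemma majorant_le k l : majorant k l <= r ^+ l.
Proof.
case: l => [|l]; first by rewrite majorant0 expr0.
have := majorant_series k l.+2.
rewrite big_ord_recr big_ord_recl /= majorant0 expr0 mulr1.
set S := \sum_(i < l) _ => h1.
have S0 : 0 <= S.
  by apply: sumr_ge0 => i _; rewrite mulr_ge0 ?majorant_ge0// exprn_ge0// invr_ge0 ltW.
have h : majorant k l.+1 * r^-1 ^+ l.+1 <= 1.
  by move: h1 S0; move: S (_ * _) => p q; lra.
by move: h; rewrite exprVn ler_pdivrMr ?mul1r// exprn_gt0.
Qed.

Definition pweight W : R := \prod_(w <- W) lweight (size w).
Definition pmajorant k W : R := \prod_(w <- W) majorant k (size w).

Lemma pweight_cons w W : pweight (w :: W) = lweight (size w) * pweight W.
Proof. by rewrite /pweight big_cons. Qed.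

Lemma pmajorant_cons k w W : pmajorant k (w :: W) = majorant k (size w) * pmajorant k W.
Proof. by rewrite /pmajorant big_cons. Qed.

Lemma pweight_ge0 W : 0 <= pweight W.
Proof. by apply: prodr_ge0 => w _; exact: lweight_ge0. Qed.

Lemma pmajorant_ge0 k W : 0 <= pmajorant k W.
Proof. by apply: prodr_ge0 => w _; exact: majorant_ge0. Qed.

Lemma pmajorant_nondecreasing k W : pmajorant k W <= pmajorant k.+1 W.
Proof.
elim: W => [|w W ih]; first by rewrite /pmajorant !big_nil.
by rewrite !pmajorant_cons; apply: ler_pM; rewrite ?majorant_ge0 ?pmajorant_ge0 ?majorant_nondecreasing.
Qed.

Lemma expr_le_pweight (K : R) W : 0 <= K -> 4 * K <= rho ->
  K ^+ size (flatten W) <= pweight W.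
Proof.
move=> K0 Krho; elim: W => [|w W ih]; first by rewrite /pweight big_nil.
rewrite /= size_cat exprD pweight_cons; apply: ler_pM; rewrite ?exprn_ge0//.
exact: expr_le_lweight.
Qed.

Section stability.
Context {I : Type} {F : set_system I} {FF : Filter F}.
Variables (X : I -> seq (word m) -> C) (kappa A : R).
Hypothesis kappa_ge0 : 0 <= kappa.
Hypothesis A_ge0 : 0 <= A.
Hypothesis X_empty : forall e, 0 < e -> \forall x \near F, nc (X x [::]) <= kappa + e.
Hypothesis X_nil : forall W, \forall x \near F, nc (X x ([::] :: W)) <= nc (X x W).
Hypothesis X_bound : forall W, \forall x \near F, nc (X x W) <= A * pweight W.
Hypothesis X_step : forall i v W e, 0 < e -> \forall x \near F,
  nc (X x ((i :: v) :: W)) <=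
  \sum_(p <- splits i v) nc (X x (p.1 :: p.2 :: W)) +
  \sum_(cv <- cyclic_terms i V) nc cv.1 * nc (X x ((cv.2 ++ v) :: W)) + e.

Lemma near_seq (T : eqType) (s : seq T) (P : T -> I -> Prop) :
  (forall t, t \in s -> \forall x \near F, P t x) ->
  \forall x \near F, forall t, t \in s -> P t x.
Proof.
elim: s => [|t s ih] h; first by near=> x.
have h1 := h t (mem_head _ _).
have h2 : \forall x \near F, forall u, u \in s -> P u x.
  by apply: ih => u us; apply: h; rewrite inE us orbT.
near=> x => u; rewrite inE => /orP[/eqP ->|us].
  by near: x.
by move: u us; near: x.
Unshelve. all: by end_near. Qed.

(** One use of the recursion turns the majorant of depth [k] into that of depth [k + 1] and halves
    the weight term. The filter covers both pairs of dimensions and a constant family. [kappa]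
    bounds the value on the empty list: [0] for differences of solutions, [1] for a solution
    itself. *)
Lemma stability k W e : 0 < e -> \forall x \near F,
  nc (X x W) <= kappa * pmajorant k W + A * 2^-1 ^+ k * pweight W + e.
Proof.
elim: k W e => [|k ihk] W e e0.
  have := X_bound W; apply: filterS => x h; apply: le_trans h _.
  rewrite expr0 mulr1 -addrA addrCA lerDl addr_ge0 ?(ltW e0)//.
  by rewrite mulr_ge0 ?pmajorant_ge0.
(* This inner induction only removes leading empty words; a first word with a letter uses the
   hypothesis for [k]. *)
elim: W e e0 => [|w W ihW] e e0.
  have := X_empty e0; apply: filterS => x h; apply: le_trans h _.
  rewrite /pmajorant /pweight !big_nil !mulr1 lerD2r lerDl.
  by rewrite mulr_ge0// exprn_ge0// invr_ge0.
case: w => [|i v].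
  have := ihW e e0; have := X_nil W; apply: filterS2 => x h1 h2.
  apply: le_trans h1 _; apply: le_trans h2 _.
  by rewrite pmajorant_cons pweight_cons majorant0 mul1r /lweight expr0 expr1n divr1 mul1r.
pose c := \sum_(cv <- cyclic_terms i V) nc cv.1.
have c0 : 0 <= c by apply: sumr_ge0 => cv _; exact: nc_ge0.
(* The error is shared between the splits, the terms of [V] with their coefficients, and the error
   of the step itself. *)
pose e' := e / ((size (splits i v))%:R + c + 1).
have d0 : 0 < (size (splits i v))%:R + c + 1 by rewrite ltr_wpDl// addr_ge0.
have e'0 : 0 < e' by rewrite divr_gt0.
have ee : (size (splits i v))%:R * e' + c * e' + e' = e.
  rewrite -[X in _ + X]mul1r -!mulrDl /e' mulrC divfK// lt0r_neq0//.
clearbody e'.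
have n1 := near_seq (s := splits i v) (P := fun p x => nc (X x (p.1 :: p.2 :: W)) <=
  kappa * pmajorant k (p.1 :: p.2 :: W) + A * 2^-1 ^+ k * pweight (p.1 :: p.2 :: W) + e')
  (fun p _ => ihk _ _ e'0).
have n2 := near_seq (s := cyclic_terms i V) (P := fun cv x => nc (X x ((cv.2 ++ v) :: W)) <=
  kappa * pmajorant k ((cv.2 ++ v) :: W) + A * 2^-1 ^+ k * pweight ((cv.2 ++ v) :: W) + e')
  (fun p _ => ihk _ _ e'0).
have n3 := X_step i v W e'0.
move: n1 n2 n3; apply: filterS3 => x h1 h2 h3.
apply: le_trans h3 _.
pose S1 := \sum_(p <- splits i v) majorant k (size p.1) * majorant k (size p.2).
pose S2 := \sum_(cv <- cyclic_terms i V) nc cv.1 * majorant k (size (cv.2 ++ v)).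
pose T1 := \sum_(p <- splits i v) lweight (size p.1) * lweight (size p.2).
pose T2 := \sum_(cv <- cyclic_terms i V) nc cv.1 * lweight (size (cv.2 ++ v)).
have b1 : \sum_(p <- splits i v) nc (X x (p.1 :: p.2 :: W)) <=
   kappa * pmajorant k W * S1 + A * 2^-1 ^+ k * pweight W * T1 + (size (splits i v))%:R * e'.
  apply: (@le_trans _ _ (\sum_(p <- splits i v) (kappa * pmajorant k W *
     (majorant k (size p.1) * majorant k (size p.2)) +
     A * 2^-1 ^+ k * pweight W * (lweight (size p.1) * lweight (size p.2)) + e'))).
    rewrite big_seq [leRHS]big_seq; apply: ler_sum => p /h1 /le_trans; apply.
    by rewrite !pmajorant_cons !pweight_cons le_eqVlt; apply/orP; left; apply/eqP; ring.
  rewrite !big_split /= -!mulr_sumr; apply: lerD => //.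
  by rewrite big_const_seq count_predT iter_addr_0 mulr_natl.
have b2 : \sum_(cv <- cyclic_terms i V) nc cv.1 * nc (X x ((cv.2 ++ v) :: W)) <=
   kappa * pmajorant k W * S2 + A * 2^-1 ^+ k * pweight W * T2 + c * e'.
  apply: (@le_trans _ _ (\sum_(cv <- cyclic_terms i V) (kappa * pmajorant k W *
     (nc cv.1 * majorant k (size (cv.2 ++ v))) +
     A * 2^-1 ^+ k * pweight W * (nc cv.1 * lweight (size (cv.2 ++ v))) + nc cv.1 * e'))).
    rewrite big_seq [leRHS]big_seq; apply: ler_sum => p /h2.
    move=> /(ler_wpM2l (nc_ge0 p.1)) /le_trans; apply.
    by rewrite !pmajorant_cons !pweight_cons le_eqVlt; apply/orP; left; apply/eqP; ring.
  by rewrite !big_split /= -!mulr_sumr -mulr_suml.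
rewrite pmajorant_cons pweight_cons /=.
have m1 : kappa * pmajorant k W * (S1 + S2) <=
    kappa * (majorant k.+1 (size v).+1 * pmajorant k.+1 W).
  rewrite -mulrA ler_wpM2l// mulrC; apply: ler_pM.
  - rewrite addr_ge0// sumr_ge0// => p _; rewrite mulr_ge0 ?majorant_ge0 ?nc_ge0//.
  - exact: pmajorant_ge0.
  - exact: majorant_step.
  - exact: pmajorant_nondecreasing.
have m2 : A * 2^-1 ^+ k * pweight W * (T1 + T2) <=
    A * 2^-1 ^+ k.+1 * (lweight (size v).+1 * pweight W).
  have -> : A * 2^-1 ^+ k.+1 * (lweight (size v).+1 * pweight W) =
    A * 2^-1 ^+ k * pweight W * (2^-1 * lweight (size v).+1) by rewrite exprS; ring.
  rewrite ler_wpM2l ?lweight_contract// mulr_ge0 ?pweight_ge0// mulr_ge0// exprn_ge0// invr_ge0//.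
move: b1 b2 m1 m2 ee; rewrite !mulrDr.
move: (kappa * _ * S1) (kappa * _ * S2) (_ * T1) (_ * T2) => t1 t2 t3 t4.
move: (\sum_(p <- _) _) (\sum_(cv <- _) _) ((size _)%:R * e') (c * e') => t5 t6 t7 t8.
set t9 := kappa * _; set t10 := A * _ * _; lra.
Qed.

End stability.

End weights.

(** * Limits of complex sequences *)

Section complex_limits.
Context {R : realType}.
Notation C := R[i].
Notation nc := (@Normc.normc R).
Implicit Types (x y : nat -> C) (a l : C).

Definition tends x l : Prop := forall e : R, 0 < e -> \forall n \near \oo, nc (x n - l) <= e.

Lemma nc_eq0_le l : (forall e : R, 0 < e -> nc l <= e) -> l = 0.
Proof.
move=> h; apply: Normc.eq0_normc; apply/eqP; rewrite eq_le nc_ge0 andbT.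
by apply/ler_addgt0Pl => e e0; rewrite addr0; exact: h.
Qed.

Lemma tends_cst l : tends (fun=> l) l.
Proof. by move=> e e0; near=> n; rewrite subrr nc0 ltW. Unshelve. all: by end_near. Qed.

Lemma tendsD x y a l : tends x a -> tends y l -> tends (fun n => x n + y n) (a + l).
Proof.
move=> xa yl e e0; have e2 : 0 < e / 2 by rewrite divr_gt0.
have := yl _ e2; have := xa _ e2; apply: filterS2 => n h1 h2.
rewrite opprD addrACA; apply: le_trans (ncD _ _) _.
by rewrite [leRHS]splitr; exact: lerD.
Qed.

Lemma tendsZ (c : C) x l : tends x l -> tends (fun n => c * x n) (c * l).
Proof.
move=> xl e e0; have c0 : 0 < nc c + 1 by rewrite ltr_wpDl ?nc_ge0.
have := xl _ (divr_gt0 e0 c0); apply: filterS => n.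
rewrite -mulrBr ncM ler_pdivlMr// mulrC => h.
by apply: le_trans h; rewrite ler_wpM2r ?nc_ge0// lerDl.
Qed.

Lemma tendsB x y a l : tends x a -> tends y l -> tends (fun n => x n - y n) (a - l).
Proof.
move=> xa yl; have -> : a - l = a + (- 1) * l by ring.
have -> : (fun n => x n - y n) = (fun n => x n + (- 1) * y n).
  by apply/funext => n; ring.
by apply: tendsD => //; exact: tendsZ.
Qed.

Lemma tends_sum (I : Type) (s : seq I) (F : I -> nat -> C) (f : I -> C) :
  (forall i, tends (F i) (f i)) -> tends (fun n => \sum_(i <- s) F i n) (\sum_(i <- s) f i).
Proof.
move=> h; elim: s => [|i s ih].
  under eq_fun do rewrite big_nil.
  by rewrite big_nil; exact: tends_cst.
under eq_fun do rewrite big_cons.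
by rewrite big_cons; apply: tendsD.
Qed.

Lemma tends_near x y l : (\forall n \near \oo, x n = y n) -> tends x l -> tends y l.
Proof.
by move=> xy xl e e0; have := xl e e0; have := xy; apply: filterS2 => n ->.
Qed.

Lemma tends_unique x a l : tends x a -> tends x l -> a = l.
Proof.
move=> xa xl; apply/eqP; rewrite -subr_eq0; apply/eqP; apply: nc_eq0_le => e e0.
apply: (@filter_const _ (\oo) _); have e2 : 0 < e / 2 by rewrite divr_gt0.
have := xa _ e2; have := xl _ e2; apply: filterS2 => n h1 h2.
have -> : a - l = (x n - l) - (x n - a) by ring.
by apply: le_trans (ncB _ _) _; rewrite [leRHS]splitr; exact: lerD.
Qed.

Lemma tends_nc_le x l (b : R) : tends x l -> (\forall n \near \oo, nc (x n) <= b) -> nc l <= b.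
Proof.
move=> xl xb; apply/ler_addgt0Pl => e e0.
apply: (@filter_const _ (\oo) _); have := xl _ e0; have := xb; apply: filterS2 => n h1 h2.
have -> : l = x n - (x n - l) by ring.
by apply: le_trans (ncB _ _) _; rewrite addrC; exact: lerD.
Qed.

Lemma real_cauchy_limit (u : nat -> R) :
  (forall e : R, 0 < e -> \forall p \near (\oo, \oo), `|u p.1 - u p.2| <= e) ->
  exists c : R, forall e : R, 0 < e -> \forall n \near \oo, `|u n - c| <= e.
Proof.
move=> hu.
have cu : cvg (u @ \oo).
  apply/cauchy_cvgP/cauchy_ballP => e e0; have e2 : 0 < e / 2 by rewrite divr_gt0.
  have [[A B] /= [Aoo Boo] AB] := hu _ e2.
  exists (u @` A, u @` B); first by split; apply: filterS (_ : \oo _); [|exact: Aoo| |exact: Boo]; move=> n; exists n.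
  move=> [_ _] /= [[p Ap <-] [q Bq <-]].
  rewrite /ball /=; apply: le_lt_trans (AB (p, q) (conj Ap Bq)) _.
  by rewrite ltr_pdivrMr// mulr_natr mulr2n ltrDl.
exists (lim (u @ \oo)) => e e0.
move/cvgrPdist_le : cu => /(_ e e0); apply: filterS => n.
by rewrite distrC.
Qed.

Lemma cauchy_tends x :
  (forall e : R, 0 < e -> \forall p \near (\oo, \oo), nc (x p.1 - x p.2) <= e) ->
  exists l, tends x l.
Proof.
move=> hx.
have [a ha] : exists c : R, forall e : R, 0 < e -> \forall n \near \oo, `|complex.Re (x n) - c| <= e.
  apply: real_cauchy_limit => e /hx; apply: filterS => -[p q] /=; apply: le_trans.
  by apply: le_trans (Re_le_nc _); rewrite raddfB.
have [b hb] : exists c : R, forall e : R, 0 < e -> \forall n \near \oo, `|complex.Im (x n) - c| <= e.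
  apply: real_cauchy_limit => e /hx; apply: filterS => -[p q] /=; apply: le_trans.
  by apply: le_trans (Im_le_nc _); rewrite raddfB.
exists (a +i* b) => e e0; have e2 : 0 < e / 2 by rewrite divr_gt0.
have := hb _ e2; have := ha _ e2; apply: filterS2 => n h1 h2.
apply: le_trans (nc_le_ReIm _) _; rewrite [leRHS]splitr.
by apply: lerD; [move: h1|move: h2]; case: (x n).
Qed.

End complex_limits.

(** * Convergence, factorization and uniqueness *)

Section limit_moments.
Context {R : realType} {m : nat}.
Notation C := R[i].
Notation nc := (@Normc.normc R).
Implicit Types (w v : word m) (W : seq (word m)).
Variable V : seq (C * word m).
Variables (r rho delta : R) (D : nat).
Hypothesis r_gt2 : 2 < r.
Hypothesis rho_ge12 : 12 <= rho.
Hypothesis degree_le : forall i cv, cv \in cyclic_terms i V -> (size cv.2 <= D)%N.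
Hypothesis coef_le : forall i, \sum_(cv <- cyclic_terms i V) nc cv.1 <= delta.
Hypothesis small_rho : 16 * rho ^+ D * delta <= 1.
Hypothesis small_r : 4 / r ^+ 2 + 2 * m%:R * delta * r ^+ D <= 1.
Hypothesis rho_r : 4 * r <= rho.

Local Notation pweight := (@pweight R m rho).
Local Notation pweight_ge0 := (pweight_ge0 rho_ge12).

(** Defect in the recursion without its term of order [N^-2]. Only the first word is transformed, so
    words appended at the end, or a constant factor, pass through unchanged. *)
Definition residual (X : seq (word m) -> C) i v W : C :=
  X ((i :: v) :: W) - (\sum_(p <- splits i v) X (p.1 :: p.2 :: W) -
    \sum_(cv <- cyclic_terms i V) cv.1 * X ((cv.2 ++ v) :: W)).

Lemma residualB X Y i v W :
  residual (fun W => X W - Y W) i v W = residual X i v W - residual Y i v W.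
Proof.
rewrite /residual sumrB; under [X in _ - (_ - X)]eq_bigr do rewrite mulrBr.
by rewrite sumrB; ring.
Qed.

Lemma residualMr X (z : C) i v W :
  residual (fun W => X W * z) i v W = residual X i v W * z.
Proof.
rewrite /residual mulrBl; congr (_ - _); rewrite mulrBl !mulr_suml; congr (_ - _).
by apply: eq_bigr => cv _; rewrite mulrA.
Qed.

Lemma residual_le X i v W : nc (X ((i :: v) :: W)) <=
  \sum_(p <- splits i v) nc (X (p.1 :: p.2 :: W)) +
  \sum_(cv <- cyclic_terms i V) nc cv.1 * nc (X ((cv.2 ++ v) :: W)) + nc (residual X i v W).
Proof.
rewrite -[X in nc X <= _](subrK (\sum_(p <- splits i v) X (p.1 :: p.2 :: W) -
    \sum_(cv <- cyclic_terms i V) cv.1 * X ((cv.2 ++ v) :: W))) -/(residual X i v W).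
apply: le_trans (ncD _ _) _; rewrite addrC; apply: lerD => //.
apply: le_trans (ncB _ _) _; apply: lerD; first exact: nc_sum.
apply: le_trans (nc_sum _ _ _) _; apply: ler_sum => cv _; by rewrite ncM.
Qed.

Lemma geometric_lt (A e : R) : 0 <= A -> 0 < e -> exists k, A * 2^-1 ^+ k <= e.
Proof.
move=> A0 e0; exists (Num.bound (A / e)).
rewrite exprVn ler_pdivrMr ?exprn_gt0// mulrC -ler_pdivrMr//.
have /ltW/le_trans := archi_boundP (divr_ge0 A0 (ltW e0)); apply.
by rewrite -natrX ler_nat ltnW// ltn_expl.
Qed.

(** Stability with [kappa = 0], and [k] so large that the halved weight term is below [e / 2]. *)
Lemma vanishing {I : Type} {F : set_system I} {FF : Filter F}
    (X : I -> seq (word m) -> C) (A : R) : 0 <= A ->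
  (\forall x \near F, X x [::] = 0) ->
  (forall W, \forall x \near F, X x ([::] :: W) = X x W) ->
  (forall W, \forall x \near F, nc (X x W) <= A * pweight W) ->
  (forall i v W e, 0 < e -> \forall x \near F, nc (residual (X x) i v W) <= e) ->
  forall W e, 0 < e -> \forall x \near F, nc (X x W) <= e.
Proof.
move=> A0 X0 X1 XA Xr W e e0; have e2 : 0 < e / 2 by rewrite divr_gt0.
have [k hk] := geometric_lt (mulr_ge0 A0 (pweight_ge0 W)) e2.
have h0 : forall e, 0 < e -> \forall x \near F, nc (X x [::]) <= 0 + e.
  by move=> d d0; move: X0; apply: filterS => x ->; rewrite nc0 add0r ltW.
have h1 : forall W, \forall x \near F, nc (X x ([::] :: W)) <= nc (X x W).
  by move=> W'; have := X1 W'; apply: filterS => x ->.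
have h2 : forall i v W e, 0 < e -> \forall x \near F, nc (X x ((i :: v) :: W)) <=
    \sum_(p <- splits i v) nc (X x (p.1 :: p.2 :: W)) +
    \sum_(cv <- cyclic_terms i V) nc cv.1 * nc (X x ((cv.2 ++ v) :: W)) + e.
  move=> i v W' d d0; have := Xr i v W' d d0; apply: filterS => x h.
  by apply: le_trans (residual_le _ _ _ _) _; apply: lerD.
apply: filterS (stability rho_ge12 degree_le coef_le small_rho (lexx 0) A0 h0 h1 XA h2 k W e2) => x h; apply: le_trans h _.
rewrite mul0r add0r [leRHS]splitr; apply: lerD => //.
by rewrite mulrAC.
Qed.

Lemma vanishing_cst (X : seq (word m) -> C) (A : R) : 0 <= A -> X [::] = 0 ->
  (forall W, X ([::] :: W) = X W) -> (forall W, nc (X W) <= A * pweight W) ->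
  (forall i v W, residual X i v W = 0) -> forall W, X W = 0.
Proof.
move=> A0 X0 X1 XA Xr W; apply: nc_eq0_le => e e0; apply: (@filter_const _ (\oo) _).
apply: (vanishing (F := \oo) (X := fun _ : nat => X) A0) e0.
- by near=> x.
- by move=> W'; near=> x.
- by move=> W'; near=> x.
- by move=> i v W' d d0; near=> x; rewrite Xr nc0 ltW.
Unshelve. all: by end_near. Qed.

Variables (M : nat -> seq (word m) -> C) (K : R).
Hypothesis K_ge0 : 0 <= K.
Hypothesis rho_K : 4 * K <= rho.
Hypothesis M_empty : \forall n \near \oo, M n [::] = 1.
Hypothesis M_nil : forall W, \forall n \near \oo, M n ([::] :: W) = M n W.
Hypothesis M_bound : forall W, \forall n \near \oo, nc (M n W) <= 4 * K ^+ size (flatten W).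
Hypothesis M_residual : forall i v W, tends (fun n => residual (M n) i v W) 0.

Lemma near_pair (P : nat -> Prop) : (\forall n \near \oo, P n) ->
  \forall p \near (\oo, \oo), P p.1 /\ P p.2.
Proof. by move=> h; exists (P, P). Qed.

(** Applied to the difference of the moments at two dimensions, along the product filter, vanishing
    is the Cauchy property. *)
Lemma moments_converge W : exists l, tends (M ^~ W) l.
Proof.
apply: cauchy_tends => e e0.
apply: (vanishing (F := filter_prod \oo \oo) (X := fun p W => M p.1 W - M p.2 W) (A := 8)) e0 => //.
- by have := near_pair M_empty; apply: filterS => p [-> ->]; rewrite subrr.
- by move=> W'; have := near_pair (M_nil W'); apply: filterS => p [-> ->].
- move=> W'; have := near_pair (M_bound W'); apply: filterS => p [h1 h2].
  have h := expr_le_pweight rho_ge12 W' K_ge0 rho_K.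
  by apply: le_trans (ncB _ _) _; move: h h1 h2; lra.
- move=> i v W' d d0; have d2 : 0 < d / 2 by rewrite divr_gt0.
  have := near_pair (M_residual i v W' d2); apply: filterS => p [].
  rewrite !subr0 residualB => h1 h2; apply: le_trans (ncB _ _) _.
  by rewrite [leRHS]splitr; exact: lerD.
Qed.

Definition limit_moment W : C := projT1 (cid (moments_converge W)).
Local Notation L := limit_moment.

Lemma tends_limit_moment W : tends (M ^~ W) (L W).
Proof. exact: projT2 (cid (moments_converge W)). Qed.

Lemma limit_moment_empty : L [::] = 1.
Proof.
apply: tends_unique (tends_limit_moment _) _.
apply: tends_near (tends_cst _); move: M_empty; exact: filterS.
Qed.

Lemma limit_moment_nil W : L ([::] :: W) = L W.
Proof.
apply: tends_unique (tends_limit_moment _) _.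
apply: tends_near (tends_limit_moment W); have := M_nil W; exact: filterS.
Qed.

Lemma limit_moment_bound W : nc (L W) <= 4 * K ^+ size (flatten W).
Proof. exact: tends_nc_le (tends_limit_moment _) (M_bound W). Qed.

Lemma limit_moment_residual i v W : residual L i v W = 0.
Proof.
apply: tends_unique (M_residual i v W).
apply: tendsB; first exact: tends_limit_moment.
apply: tendsB; apply: tends_sum => p; first exact: tends_limit_moment.
by apply: tendsZ; exact: tends_limit_moment.
Qed.

(** As functions of [W], both sides solve the same linear recursion without error and agree on the
    empty list, since words appended at the end are passive. *)
Lemma limit_moment_cat W W0 : L (W ++ W0) = L W * L W0.
Proof.
apply/eqP; rewrite -subr_eq0; apply/eqP.
have Kn n : 0 <= K ^+ n by exact: exprn_ge0.
(* [20 = 4 + 4 * 4], from the bound [4 * K^p] on the joint moment and on each factor. *)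
apply: (vanishing_cst (X := fun W => L (W ++ W0) - L W * L W0)
  (A := 20 * K ^+ size (flatten W0))).
- by rewrite mulr_ge0.
- by rewrite limit_moment_empty mul1r subrr.
- by move=> W'; rewrite cat_cons !limit_moment_nil.
- move=> W'; apply: le_trans (ncB _ _) _; rewrite ncM.
  have h1 := limit_moment_bound (W' ++ W0).
  rewrite flatten_cat size_cat exprD in h1.
  have h2 := ler_pM (nc_ge0 _) (nc_ge0 _) (limit_moment_bound W') (limit_moment_bound W0).
  have h3 := ler_wpM2r (Kn (size (flatten W0))) (expr_le_pweight rho_ge12 W' K_ge0 rho_K).
  move: h1 h2 h3; move: (nc _) (nc _ * nc _) (K ^+ _) (K ^+ _) (pweight W') => t1 t2 t3 t4 t5.
  move=> h1 h2 h3; apply: le_trans (lerD h1 h2) _.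
  have -> : 4 * (t4 * t3) + 4 * t4 * (4 * t3) = 20 * (t4 * t3) by ring.
  by rewrite -mulrA [t3 * t5]mulrC ler_wpM2l.
move=> i v W'; rewrite residualB.
have -> : residual (fun W => L (W ++ W0)) i v W' = residual L i v (W' ++ W0) by [].
rewrite limit_moment_residual sub0r; apply/eqP; rewrite oppr_eq0; apply/eqP.
by rewrite residualMr limit_moment_residual mul0r.
Qed.

Definition limit_law w : C := L [:: w].
Local Notation tau := limit_law.

Lemma limit_moment_cons w W : L (w :: W) = tau w * L W.
Proof. exact: (limit_moment_cat [:: w] W). Qed.

Lemma limit_law_nil : tau [::] = 1.
Proof. by rewrite /tau limit_moment_nil limit_moment_empty. Qed.

Definition word_schwinger_dyson (t : word m -> C) := forall i v,
  \sum_(p <- splits i v) t p.1 * t p.2 =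
  t (i :: v) + \sum_(cv <- cyclic_terms i V) cv.1 * t (cv.2 ++ v).

Lemma limit_law_schwinger_dyson : word_schwinger_dyson tau.
Proof.
move=> i v; have /eqP := limit_moment_residual i v [::].
rewrite /residual opprB addrA subr_eq0 => /eqP h.
rewrite -[RHS]/(L [:: i :: v] + \sum_(cv <- cyclic_terms i V) cv.1 * L [:: cv.2 ++ v]) h.
by apply: eq_bigr => p _; rewrite limit_moment_cons.
Qed.

(** Stability for the constant family with [kappa = 1]: as [k] grows the weight term disappears and
    the majorant stays below [r^|w|]. *)
Lemma limit_law_bound w : nc (tau w) <= r ^+ size w.
Proof.
apply/ler_addgt0Pl => e e0; have e2 : 0 < e / 2 by rewrite divr_gt0.
have [k hk] := geometric_lt (mulr_ge0 (ler0n R 4) (pweight_ge0 [:: w])) e2.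
apply: (@filter_const _ (\oo) _).
have h0 : forall e : R, 0 < e -> \forall x \near \oo, nc (L [::]) <= 1 + e.
  by move=> d d0; near=> x; rewrite limit_moment_empty nc1 lerDl ltW.
have h1 : forall W, \forall x \near \oo, nc (L ([::] :: W)) <= nc (L W).
  by move=> W; near=> x; rewrite limit_moment_nil.
have h2 : forall W, \forall x \near \oo, nc (L W) <= 4 * pweight W.
  move=> W; near=> x; apply: le_trans (limit_moment_bound W) _.
  by rewrite ler_wpM2l//; exact: expr_le_pweight.
have h3 : forall i v W (e : R), 0 < e -> \forall x \near \oo, nc (L ((i :: v) :: W)) <=
    \sum_(p <- splits i v) nc (L (p.1 :: p.2 :: W)) +
    \sum_(cv <- cyclic_terms i V) nc cv.1 * nc (L ((cv.2 ++ v) :: W)) + e.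
  move=> i v W d d0; near=> x; apply: le_trans (residual_le _ _ _ _) _.
  by rewrite limit_moment_residual nc0 lerD2l ltW.
apply: filterS (stability (X := fun _ : nat => L) rho_ge12 degree_le coef_le small_rho
  ler01 (ler0n R 4) h0 h1 h2 h3 k [:: w] e2) => _ h; apply: le_trans h _.
have hm := majorant_le r_gt2 degree_le coef_le small_r k (size w).
have -> : pmajorant V k [:: w] = majorant V k (size w) by rewrite /pmajorant big_seq1.
move: hk; rewrite mulrAC mul1r; move: (majorant _ _ _) (4 * _ * _) hm => t1 t2; lra.
Unshelve. all: by end_near. Qed.

(** The products of values of [t] over a list of words solve the linear recursion, which turns the
    quadratic equation into the linear uniqueness statement. *)
Lemma word_schwinger_dyson_unique (t : word m -> C) : t [::] = 1 ->
  word_schwinger_dyson t -> (forall w, nc (t w) <= r ^+ size w) -> t =1 tau.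
Proof.
move=> t1 tSD tr w.
have h : \prod_(u <- [:: w]) t u - L [:: w] = 0; last first.
  by move/eqP: h; rewrite big_seq1 subr_eq0 => /eqP.
have r0 : 0 <= r by have := r_gt2; lra.
apply: (vanishing_cst (X := fun W => \prod_(u <- W) t u - L W) (A := 5)) => //.
- by rewrite big_nil limit_moment_empty subrr.
- by move=> W; rewrite big_cons t1 mul1r limit_moment_nil.
- move=> W; apply: le_trans (ncB _ _) _.
  have h1 := expr_le_pweight rho_ge12 W r0 rho_r.
  have h2 := expr_le_pweight rho_ge12 W K_ge0 rho_K.
  have h3 := limit_moment_bound W.
  have h4 : nc (\prod_(u <- W) t u) <= r ^+ size (flatten W).
    elim: (W) => [|u U ih]; first by rewrite big_nil nc1.
    by rewrite big_cons ncM /= size_cat exprD; apply: ler_pM; rewrite ?nc_ge0.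
  by move: h1 h2 h3 h4; lra.
move=> i v W; rewrite residualB limit_moment_residual subr0 /residual.
rewrite big_cons; set P := \prod_(u <- W) t u.
have -> : \sum_(p <- splits i v) \prod_(u <- [:: p.1, p.2 & W]) t u =
    (\sum_(p <- splits i v) t p.1 * t p.2) * P.
  by rewrite mulr_suml; apply: eq_bigr => p _; rewrite !big_cons mulrA.
have -> : \sum_(cv <- cyclic_terms i V) cv.1 * \prod_(u <- (cv.2 ++ v) :: W) t u =
    (\sum_(cv <- cyclic_terms i V) cv.1 * t (cv.2 ++ v)) * P.
  by rewrite mulr_suml; apply: eq_bigr => p _; rewrite big_cons mulrA.
by rewrite tSD; ring.
Qed.

Lemma limit_law_exists : exists t : word m -> C,
  [/\ t [::] = 1, word_schwinger_dyson t, (forall w, nc (t w) <= r ^+ size w),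
      (forall s : word m -> C, s [::] = 1 -> word_schwinger_dyson s ->
        (forall w, nc (s w) <= r ^+ size w) -> s =1 t) &
      forall w, tends (fun n => M n [:: w]) (t w)].
Proof.
exists tau; split.
- exact: limit_law_nil.
- exact: limit_law_schwinger_dyson.
- exact: limit_law_bound.
- exact: word_schwinger_dyson_unique.
- by move=> w; exact: tends_limit_moment.
Qed.

End limit_moments.

(** * Moments of the matrix model *)

Section model_moments.
Context {R : realType} {m : nat}.
Notation C := R[i].
Notation nc := (@Normc.normc R).
Variable V : seq (C * word m).
Variable a : R.
Hypothesis V_real : forall N (x : mentries R m N), complex.Im (vtrace V (herms x)) = 0.
Hypothesis phi_convex : forall N s (x y : mentries R m N), 0 <= s <= 1 ->
  phi V a (mconv s x y) <= s * phi V a x + (1 - s) * phi V a y.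
Hypothesis a_lt1 : a < 1.
Hypothesis lincoef_le1 : lincoef V <= 1.

Local Notation mrate := (@mrate R m a).

Definition mean_moment N (W : seq (word m)) : C :=
  wint (@upot R m N V) (fun x => pntr (herms x) W) / (@partition R m N V)%:C.

Let Z0 N : (0 < N)%N -> 0 < @partition R m N V.
Proof. exact: (partition_gt0 (@phi_convex N) a_lt1 lincoef_le1). Qed.

Lemma mean_moment_empty N : (0 < N)%N -> mean_moment N [::] = 1.
Proof.
move=> N0; rewrite /mean_moment.
have -> : (fun x : mentries R m N => pntr (herms x) [::]) = (fun=> 1).
  by apply/funext => x; rewrite /pntr big_nil.
by rewrite wint1 divff//; apply/eqP => -[h]; have := Z0 N0; rewrite h ltxx.
Qed.

Lemma ntr_nil N (A : 'I_m -> 'M[C]_N) : (0 < N)%N -> ntr A [::] = 1.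
Proof. by move=> N0; rewrite /ntr wmx_nil mxtrace1 mulVf// pnatr_eq0 -lt0n. Qed.

Lemma mean_moment_nil N W : (0 < N)%N -> mean_moment N ([::] :: W) = mean_moment N W.
Proof.
move=> N0; rewrite /mean_moment; congr (wint _ _ / _); apply/funext => x.
by rewrite pntr_cons ntr_nil// mul1r.
Qed.

Lemma mean_moment_bound N W : (0 < N)%N -> (size (flatten W))%:R <= mrate * N%:R ->
  nc (mean_moment N W) <= 4 * mrate ^+ size (flatten W).
Proof.
move=> N0 h; have Z := Z0 N0.
have := moment_bound (@V_real N) (@phi_convex N) a_lt1 lincoef_le1 N0 h.
rewrite /mean_moment ncM; set t := nc (wint _ _); set p := @partition R m N V in Z *.
have -> : nc (p%:C)^-1 = p^-1 by rewrite -fmorphV nc_real ger0_norm// invr_ge0 ltW.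
by rewrite ler_pdivrMr.
Qed.

Lemma mean_moment_residual N i v W : (0 < N)%N ->
  residual V (mean_moment N) i v W =
  (N%:R ^+ 2)^-1 * \sum_(s <- corrections i v W) mean_moment N s.
Proof.
move=> N0; have Z := Z0 N0.
have coer := upot_coercive (@phi_convex N) a_lt1 lincoef_le1.
have d0 := delta_gt0 a_lt1 N0.
have ur : forall x : mentries R m N, complex.Im (@upot R m N V x) = 0.
  by move=> x; apply: Im_upot; exact: V_real.
have := loop_equation_wint N0 ur d0 coer i v W.
pose g W := wint (@upot R m N V) (fun x => pntr (herms x) W).
rewrite -/(g _) -/(g _) => h.
rewrite [LHS](residualMr V g) -mulr_suml mulrA; congr (_ / _).
rewrite /residual opprB addrA -/(g _).
apply/eqP; rewrite subr_eq -h addrC; apply/eqP; congr (_ + _).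
Qed.

(** For fixed [W] the restriction on the length holds as soon as [N] exceeds it, because
    [mrate >= 1]. *)
Lemma mean_moment_near_bound W : \forall N \near \oo,
  nc (mean_moment N W) <= 4 * mrate ^+ size (flatten W).
Proof.
have K1 := @mrate_ge1 R m a a_lt1.
exists (size (flatten W)).+1 => // N /= hN.
have N0 : (0 < N)%N by apply: leq_trans hN.
apply: mean_moment_bound => //.
apply: (@le_trans _ _ (1 * N%:R)); first by rewrite mul1r ler_nat ltnW.
by rewrite ler_wpM2r.
Qed.

Lemma mean_moment_residual0 i v W : tends (fun N => residual V (mean_moment N) i v W) 0.
Proof.
move=> e e0.
have K1 := @mrate_ge1 R m a a_lt1.
pose S : R := \sum_(s <- corrections i v W) (4 * mrate ^+ size (flatten s)).
have S0 : 0 <= S.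
  by apply: sumr_ge0 => s _; rewrite mulr_ge0// exprn_ge0// (le_trans ler01).
have h : \forall N \near \oo, forall s, s \in corrections i v W ->
   nc (mean_moment N s) <= 4 * mrate ^+ size (flatten s).
  by apply: near_seq => s _; exact: mean_moment_near_bound.
have hN : \forall N \near \oo, S / e <= N%:R /\ (0 < N)%N.
  exists (Num.bound (S / e)).+1 => // N /= hN; split; last exact: leq_trans hN.
  have /ltW/le_trans := archi_boundP (divr_ge0 S0 (ltW e0)); apply.
  by rewrite ler_nat ltnW.
move: h hN; apply: filterS2 => N h [hN N0].
rewrite subr0 mean_moment_residual// ncM.
have N1 : 1 <= N%:R :> R by rewrite ler1n.
have NN : 0 < N%:R :> R by apply: lt_le_trans N1.
have -> : nc (N%:R ^+ 2)^-1 = (N%:R ^+ 2)^-1 :> R.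
  have -> : ((N%:R : C) ^+ 2)^-1 = (((N%:R : R) ^+ 2)^-1)%:C.
    by rewrite fmorphV rmorphXn rmorph_nat.
  by rewrite nc_real ger0_norm// invr_ge0 exprn_ge0.
rewrite mulrC ler_pdivrMr ?exprn_gt0//.
apply: (@le_trans _ _ S).
  apply: le_trans (nc_sum _ _ _) _; rewrite big_seq [leRHS]big_seq.
  by apply: ler_sum => s; exact: h.
apply: (@le_trans _ _ (e * N%:R)); first by rewrite mulrC -ler_pdivrMr.
by apply: ler_wpM2l; [exact: ltW|rewrite expr2 ler_peMr// ltW].
Qed.

End model_moments.

(** * The matrix model *)

Section finite_support_sums.
Context {R : realType} {K : choiceType} {U : zmodType}.
Notation C := R[i].
Variable F : K -> C -> U.
Hypothesis F_additive : forall k x y, F k (x + y) = F k x + F k y.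

(** Common form of the sums over [msupp] that define evaluation, derivatives and involution.
    Additivity in the coefficient allows any larger finite set as index set, so the support of a sum
    need not be known. *)
Definition supp_sum (g : malg K C) : U := \sum_(k <- msupp g) F k (mcoeff k g).

Let F0 k : F k 0 = 0.
Proof. by apply: (addrI (F k 0)); rewrite -F_additive !addr0. Qed.

Lemma supp_sumEw (d : {fset K}) (g : malg K C) : fsubset (msupp g) d ->
  supp_sum g = \sum_(k <- d) F k (mcoeff k g).
Proof.
move=> gd; rewrite /supp_sum (big_fset_incl _ gd)//= => k _ kg.
by rewrite mcoeff_outdom.
Qed.

Lemma supp_sumD (g h : malg K C) : supp_sum (g + h) = supp_sum g + supp_sum h.
Proof.
rewrite (supp_sumEw (msuppD_le g h)) (supp_sumEw (fsubsetUl (msupp g) (msupp h))).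
rewrite (supp_sumEw (fsubsetUr (msupp g) (msupp h))) -big_split /=.
by apply: eq_bigr => k _; rewrite mcoeffD F_additive.
Qed.

Lemma supp_sum0 : supp_sum 0 = 0.
Proof. by apply: (addrI (supp_sum 0)); rewrite -supp_sumD !addr0. Qed.

Lemma supp_sum_sum (I : Type) (s : seq I) (P : pred I) (f : I -> malg K C) :
  supp_sum (\sum_(i <- s | P i) f i) = \sum_(i <- s | P i) supp_sum (f i).
Proof. exact: (big_morph supp_sum supp_sumD supp_sum0). Qed.

Lemma supp_sumU k c : supp_sum (mkmalgU k c) = F k c.
Proof. by rewrite (supp_sumEw msuppU_le) big_seq_fset1 mcoeffUU. Qed.

Lemma supp_sumZ (G : C -> U -> U) (g : malg K C) c :
  (forall x y, G c (x + y) = G c x + G c y) ->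
  (forall k x, F k (c * x) = G c (F k x)) ->
  supp_sum (c *: g) = G c (supp_sum g).
Proof.
move=> GD Gc; have G0 : G c 0 = 0 by apply: (addrI (G c 0)); rewrite -GD !addr0.
rewrite (supp_sumEw (msuppZ_le c g)) (big_morph (G c) GD G0).
by apply: eq_bigr => k _; rewrite mcoeffZ Gc.
Qed.

End finite_support_sums.

Section linear_extensions.
Context {R : realType} {K : choiceType} {U : lmodType R[i]}.
Notation C := R[i].
Implicit Types (g : malg K C) (c : C).

Definition vector_extension (h : K -> U) := supp_sum (fun k (x : C) => x *: h k).
Definition scalar_extension (h : K -> C) := supp_sum (fun k (x : C) => x * h k).

Let vadd (h : K -> U) k (x y : C) : (x + y) *: h k = x *: h k + y *: h k.
Proof. exact: scalerDl. Qed.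

Let sadd (h : K -> C) k (x y : C) : (x + y) * h k = x * h k + y * h k.
Proof. exact: mulrDl. Qed.

Lemma vector_extensionD h g g' :
  vector_extension h (g + g') = vector_extension h g + vector_extension h g'.
Proof. exact: (supp_sumD (vadd h)). Qed.

Lemma vector_extensionZ h c g : vector_extension h (c *: g) = c *: vector_extension h g.
Proof.
apply: (supp_sumZ (vadd h) (G := fun c u => c *: u)) => [x y|k x].
  exact: scalerDr.
by rewrite scalerA.
Qed.

Lemma vector_extensionU h k : vector_extension h (mkmalgU k 1) = h k.
Proof. by rewrite /vector_extension (supp_sumU (vadd h)) scale1r. Qed.

Lemma vector_extension_sum h (I : Type) (s : seq I) (P : pred I) (f : I -> malg K C) :
  vector_extension h (\sum_(i <- s | P i) f i) = \sum_(i <- s | P i) vector_extension h (f i).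
Proof. exact: (supp_sum_sum (vadd h)). Qed.

Lemma scalar_extensionD h g g' :
  scalar_extension h (g + g') = scalar_extension h g + scalar_extension h g'.
Proof. exact: (supp_sumD (sadd h)). Qed.

Lemma scalar_extensionZ h c g : scalar_extension h (c *: g) = c * scalar_extension h g.
Proof.
apply: (supp_sumZ (sadd h) (G := fun c u => c * u)) => [x y|k x].
  exact: mulrDr.
by rewrite mulrA.
Qed.

Lemma scalar_extensionU h k : scalar_extension h (mkmalgU k 1) = h k.
Proof. by rewrite /scalar_extension (supp_sumU (sadd h)) mul1r. Qed.

Lemma scalar_extension_sum h (I : Type) (s : seq I) (P : pred I) (f : I -> malg K C) :
  scalar_extension h (\sum_(i <- s | P i) f i) = \sum_(i <- s | P i) scalar_extension h (f i).
Proof. exact: (supp_sum_sum (sadd h)). Qed.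

End linear_extensions.

(** * From polynomials to words *)

Section noncommutative_words.
Context {R : realType} {m : nat}.
Notation C := R[i].
Notation ncp := (ncpoly R m).
Implicit Types (P : ncp) (w v : word m) (A : forall N, 'I_m -> 'M[C]_N).

Lemma sum_splits (U : zmodType) (G : word m -> word m -> U) (i : 'I_m) w :
  \sum_(k < size w | tnth (in_tuple w) k == i) G (take k w) (drop k.+1 w) =
  \sum_(p <- splits i w) G p.1 p.2.
Proof.
under eq_bigl do rewrite (tnth_nth i).
elim: w G => [|j w ih] G; first by rewrite big_ord0 big_nil.
rewrite [LHS]big_mkcond big_ord_recl /= big_cat big_map /=.
congr (_ + _); first by case: ifP => _; rewrite ?big_nil// big_seq1 drop0.
by rewrite -(ih (fun p q => G (j :: p) q)) -big_mkcond.
Qed.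

Lemma ncdiff_monom i w :
  ncdiff i (ncmonom w : ncp) = \sum_(p <- splits i w) mkmalgU (p : (word m * word m)%type) 1.
Proof.
rewrite [LHS](vector_extensionU (@ncdiff_word R m i) w).
rewrite /ncdiff_word (sum_splits (fun p q => mkmalgU (p, q) 1)).
by apply: eq_bigr => -[].
Qed.

Lemma cyclic_diff_word_splits i w :
  cyclic_diff_word i w = \sum_(p <- splits i w) ncmonom (p.2 ++ p.1) :> ncp.
Proof. exact: (sum_splits (fun p q => ncmonom (q ++ p) : ncp)). Qed.

Lemma ncmonomM w v : ncmonom w * ncmonom v = ncmonom (w ++ v) :> ncp.
Proof. by rewrite /ncmonom malgM_def fgmulUU mulr1. Qed.

Lemma ncstar_monom w : ncstar (ncmonom w : ncp) = ncmonom (rev w).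
Proof.
have -> : ncstar (ncmonom w : ncp) = supp_sum (fun u c => mkmalgU (rev u : word m) c^*) (ncmonom w : ncp) by [].
rewrite supp_sumU; last by move=> k x y; rewrite rmorphD monalgUD.
by rewrite rmorph1.
Qed.

Lemma ncpoly_ind (Q : ncp -> Prop) : (forall P P', Q P -> Q P' -> Q (P + P')) ->
  (forall c w, Q (c *: ncmonom w)) -> forall P, Q P.
Proof.
move=> QD Qm P; rewrite (monalgE P); elim/big_ind : _ => //.
  by have := Qm 0 [::]; rewrite scale0r.
move=> w _; have -> : mkmalgU w (mcoeff w P) = mcoeff w P *: ncmonom w :> ncp; last exact: Qm.
by apply/malgP => k; rewrite mcoeffZ /ncmonom !mcoeffU mulr_natr.
Qed.

(* The algebra structure on a non-commutative [malg] is only a left one. *)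
Lemma ncmul_scaler P c w : P * (c *: ncmonom w) = c *: (P * ncmonom w) :> ncp.
Proof.
have UZ d u : d *: ncmonom u = mkmalgU u d :> ncp.
  by apply/malgP => k; rewrite mcoeffZ /ncmonom !mcoeffU mulr_natr.
elim/ncpoly_ind : P => [P Q hP hQ|d u]; first by rewrite !mulrDl scalerDr hP hQ.
rewrite -!scalerAl ncmonomM scalerA mulrC -scalerA; congr (_ *: _).
by rewrite UZ /ncmonom malgM_def fgmulUU mul1r -UZ.
Qed.

Definition law (t : word m -> C) P : C := scalar_extension t P.

Lemma lawD t P Q : law t (P + Q) = law t P + law t Q.
Proof. exact: scalar_extensionD. Qed.

Lemma lawZ t c P : law t (c *: P) = c * law t P.
Proof. exact: scalar_extensionZ. Qed.

Lemma law_linear t : linear_for *%R (law t).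
Proof. by move=> c P Q; rewrite lawD lawZ. Qed.

HB.instance Definition _ t := GRing.isLinear.Build C ncp C *%R (law t) (law_linear t).

Lemma law_monom t w : law t (ncmonom w) = t w.
Proof. exact: scalar_extensionU. Qed.

Lemma scalar_law (tau : {scalar ncp}) P : tau P = law (fun w => tau (ncmonom w)) P.
Proof.
elim/ncpoly_ind : P => [P Q hP hQ|c w]; first by rewrite !linearD hP hQ.
by rewrite !linearZ /= law_monom.
Qed.

Lemma tensor_form_ncdiff (tau : {scalar ncp}) i w : tensor_form tau (ncdiff i (ncmonom w)) =
  \sum_(p <- splits i w) tau (ncmonom p.1) * tau (ncmonom p.2).
Proof.
rewrite ncdiff_monom.
rewrite [LHS](scalar_extension_sum (fun u => tau (ncmonom u.1) * tau (ncmonom u.2))).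
by apply: eq_bigr => p _; exact: scalar_extensionU.
Qed.

Lemma tensor_form_ncdiffD (tau : {scalar ncp}) i P Q :
  tensor_form tau (ncdiff i (P + Q)) = tensor_form tau (ncdiff i P) + tensor_form tau (ncdiff i Q).
Proof.
rewrite [ncdiff i (P + Q)](vector_extensionD (@ncdiff_word R m i)).
exact: scalar_extensionD.
Qed.

Lemma tensor_form_ncdiffZ (tau : {scalar ncp}) i c P :
  tensor_form tau (ncdiff i (c *: P)) = c * tensor_form tau (ncdiff i P).
Proof.
rewrite [ncdiff i (c *: P)](vector_extensionZ (@ncdiff_word R m i)).
exact: scalar_extensionZ.
Qed.

Lemma nceval_monom N (A : 'I_m -> 'M[C]_N) w : nceval A (ncmonom w) = wmx A w.
Proof. exact: (vector_extensionU (wmx A)). Qed.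

Lemma ncevalD N (A : 'I_m -> 'M[C]_N) P Q : nceval A (P + Q) = nceval A P + nceval A Q.
Proof. exact: (vector_extensionD (wmx A)). Qed.

Lemma ncevalZ N (A : 'I_m -> 'M[C]_N) c P : nceval A (c *: P) = c *: nceval A P.
Proof. exact: (vector_extensionZ (wmx A)). Qed.

Section potential.
Context {n : nat}.
Variables (q : 'I_n -> word m) (t : 'rV[R]_n).

Definition potential_terms : seq (C * word m) :=
  [seq ((t 0 j)%:C, q j) | j <- index_enum 'I_n] ++ [seq ((t 0 j)%:C, rev (q j)) | j <- index_enum 'I_n].
Local Notation V := potential_terms.

Lemma potentialE : potential q t = \sum_(cv <- V) cv.1 *: ncmonom cv.2.
Proof.
rewrite big_cat !big_map /= -big_split /=; apply: eq_bigr => j _.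
by rewrite scalerDr ncstar_monom.
Qed.

Lemma trace_nceval_potential N (A : 'I_m -> 'M[C]_N) :
  \tr (nceval A (potential q t)) = vtrace V A.
Proof.
have n0 : nceval A (0 : ncp) = 0 by rewrite -(scale0r (0 : ncp)) ncevalZ scale0r.
rewrite potentialE (big_morph (nceval A) (ncevalD A) n0) raddf_sum /vtrace.
by apply: eq_bigr => cv _; rewrite /= ncevalZ nceval_monom mxtraceZ.
Qed.

Lemma cyclic_diff_potential i : cyclic_diff i (potential q t) =
  \sum_(cv <- cyclic_terms i V) cv.1 *: ncmonom cv.2.
Proof.
rewrite potentialE [LHS](vector_extension_sum (@cyclic_diff_word R m i)).
rewrite /cyclic_terms big_flatten big_map.
apply: eq_bigr => cv _; rewrite big_map /= vector_extensionZ vector_extensionU.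
by rewrite cyclic_diff_word_splits scaler_sumr.
Qed.

Lemma law_potential_derivative (tau : {scalar ncp}) i v :
  tau ((cyclic_diff i (potential q t) + ncX i) * ncmonom v) =
  tau (ncmonom (i :: v)) + \sum_(cv <- cyclic_terms i V) cv.1 * tau (ncmonom (cv.2 ++ v)).
Proof.
rewrite mulrDl linearD /= addrC ncmonomM; congr (_ + _).
rewrite cyclic_diff_potential mulr_suml linear_sum; apply: eq_bigr => cv _ /=.
by rewrite -scalerAl linearZ /= ncmonomM.
Qed.

Lemma schwinger_dyson_words (tau : {scalar ncp}) : schwinger_dyson (potential q t) tau ->
  tau (ncmonom [::]) = 1 /\ word_schwinger_dyson V (fun w => tau (ncmonom w)).
Proof.
move=> [_ tau1 tauSD]; split; first exact: tau1.
by move=> i v; rewrite -tensor_form_ncdiff tauSD law_potential_derivative.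
Qed.

(** Each condition is linear or antilinear in [P], so monomials suffice. *)
Lemma schwinger_dyson_of_words (tau : {scalar ncp}) : tau (ncmonom [::]) = 1 ->
  (forall w, tau (ncmonom (rev w)) = (tau (ncmonom w))^*) ->
  word_schwinger_dyson V (fun w => tau (ncmonom w)) ->
  schwinger_dyson (potential q t) tau.
Proof.
move=> tau1 tau_rev tauSD; split.
- move=> P.
  have star_add : forall (k : word m) (x y : C),
      mkmalgU (rev k : word m) (x + y)^* =
      mkmalgU (rev k : word m) x^* + mkmalgU (rev k : word m) y^* :> ncp.
    by move=> k x y; rewrite rmorphD monalgUD.
  have sD P' Q : ncstar (P' + Q) = ncstar P' + ncstar Q :> ncp.
    exact: (supp_sumD star_add).
  have sZ c Q : ncstar (c *: Q) = c^* *: ncstar Q :> ncp.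
    apply: (supp_sumZ star_add (G := fun c (x : ncp) => c^* *: x)) => [x y|k x].
      exact: scalerDr.
    by rewrite rmorphM; apply/malgP => u; rewrite mcoeffZ !mcoeffU mulrnAr.
  elim/ncpoly_ind : P => [P Q hP hQ|c w].
    by rewrite sD !linearD /= hP hQ.
  have lz d (Q : ncp) : tau (d *: Q) = d * tau Q by rewrite linearZ.
  have -> : tau (ncstar (c *: ncmonom w)) = c^* * tau (ncmonom (rev w)).
    by rewrite sZ lz ncstar_monom.
  rewrite lz tau_rev; exact: esym (rmorphM _ _ _).
- exact: tau1.
move=> i P; elim/ncpoly_ind : P => [P Q hP hQ|c w].
  rewrite tensor_form_ncdiffD hP hQ.
  exact: esym (etrans (congr1 tau (mulrDr _ P Q)) (linearD tau _ _)).
rewrite tensor_form_ncdiffZ tensor_form_ncdiff ncmul_scaler linearZ /=; congr (_ * _).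
by rewrite law_potential_derivative tauSD.
Qed.

End potential.

End noncommutative_words.

(** * Density of the matrix model *)

Section density_integral.
Context d (T : measurableType d) (R : realType).

Lemma has_density_comp (mu : {measure set T -> \bar R}) (nu la : set T -> \bar R) (rho sigma : T -> R) :
  measurable_fun setT sigma -> (forall x, 0 <= sigma x) ->
  has_density mu nu (EFin \o rho) -> has_density nu la (EFin \o sigma) ->
  has_density mu la (fun x => (sigma x * rho x)%:E).
Proof.
move=> ms s0 nurho lasigma f mf f0; rewrite lasigma// nurho; last 2 first.
- by apply: emeasurable_funM => //; exact/measurable_EFinP.
- by move=> x; rewrite mule_ge0// lee_fin.
by apply: eq_integral => x _; rewrite /= -muleA.
Qed.

Lemma integral_density (mu nu : {measure set T -> \bar R}) (rho : T -> R) (g : T -> R) :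
  (forall x, 0 <= rho x) -> measurable_fun setT g ->
  has_density mu nu (EFin \o rho) ->
  (\int[nu]_x (g x)%:E = \int[mu]_x (g x * rho x)%:E)%E.
Proof.
move=> r0 mg nurho; have mEg : measurable_fun setT (EFin \o g) by exact/measurable_EFinP.
rewrite integralE [RHS]integralE; congr (_ - _)%E.
  rewrite nurho; last 2 first.
  - exact: measurable_funepos.
  - by move=> x; exact: funepos_ge0.
  apply: eq_integral => x _; rewrite !funeposE /= -!EFin_max -EFinM; congr (_%:E).
  by rewrite maxr_pMl// mul0r.
rewrite nurho; last 2 first.
- exact: measurable_funeneg.
- by move=> x; exact: funeneg_ge0.
apply: eq_integral => x _; rewrite !funenegE /= -!EFin_max -EFinM; congr (_%:E).
by rewrite maxr_pMl// mul0r mulNr.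
Qed.

End density_integral.

Section gue_normalization.
Context {R : realType} {N : nat}.
Hypothesis N_gt0 : (0 < N)%N.
Notation ent := (tuple_measure (@lebesgue_measure R) (N * N)).

Lemma measurable_expR_opp d (T : measurableType d) (h : T -> R) :
  measurable_fun setT h -> measurable_fun setT (fun x => expR (- h x)).
Proof. by move=> mh; apply: measurableT_comp => //; exact: measurableT_comp. Qed.

(** One matrix with empty potential is an instance of the model, with [a = 0], so positivity of its
    partition function applies. *)
Lemma gue_normalization :
  0 < fine (\int[ent]_x (expR (- @gue_potential R N x))%:E).
Proof.
have cvx s (x y : mentries R 1 N) : 0 <= s <= 1 ->
    phi ([::] : seq (R[i] * word 1)) 0 (mconv s x y) <= s * phi [::] 0 x + (1 - s) * phi [::] 0 y.
  by move=> _; rewrite /phi /vtrace !big_nil !mul0r /= !addr0 !mulr0 addr0.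
have l1 : lincoef ([::] : seq (R[i] * word 1)) <= 1 by rewrite /lincoef big_nil.
have := partition_gt0 cvx ltr01 l1 N_gt0.
have := partitionE cvx ltr01 l1 N_gt0.
have mg : measurable_fun setT (fun x => (expR (- @gue_potential R N x))%:E).
  by apply/measurable_EFinP; exact: measurable_expR_opp.
have -> : (\int[@mleb R 1 N]_x (weight (@upot R 1 N [::]) x)%:E =
    \int[ent]_x (expR (- @gue_potential R N x))%:E)%E.
  transitivity (\int[@mleb R 1 N]_x (expR (- @gue_potential R N (tnth x ord0)))%:E)%E.
    apply: eq_integral => x _; rewrite /weight (Re_upot _ 0) /phi /vtrace big_nil /=.
    congr (expR (- _))%:E; rewrite /gue_potential /sqnorm big_ord1 /herms.
    by rewrite !mul0r subr0 !add0r mulrA mul1r.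
  rewrite ge0_integral_tuple_measureS; last 2 first.
  - by apply: (measurableT_comp mg); exact: measurable_tnth.
  - by move=> x; rewrite lee_fin expR_ge0.
  apply: eq_integral => x _.
  rewrite (eq_integral (fun=> (expR (- @gue_potential R N x))%:E)); last first.
    by move=> t _; rewrite tnth0.
  by rewrite ge0_integral_tuple_measure0// => t; rewrite lee_fin expR_ge0.
by move=> <-.
Qed.

End gue_normalization.

Section matrix_model_density.
Context {R : realType} {m N : nat}.
Notation C := R[i].
Notation T := (mentries R m N).
Notation mleb := (@mleb R m N).
Notation ent := (tuple_measure (@lebesgue_measure R) (N * N)).
Variables (P : ncpoly R m) (V : seq (C * word m)) (a : R).
Hypothesis P_trace : forall A : 'I_m -> 'M[C]_N, \tr (nceval A P) = vtrace V A.
Hypothesis phi_convex : forall s (x y : T), 0 <= s <= 1 ->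
  phi V a (mconv s x y) <= s * phi V a x + (1 - s) * phi V a y.
Hypothesis a_lt1 : a < 1.
Hypothesis lincoef_le1 : lincoef V <= 1.
Hypothesis N_gt0 : (0 < N)%N.

Local Notation weight := (weight (@upot R m N V)).
Local Notation partition := (@partition R m N V).

Let Zg : R := fine (\int[ent]_x (expR (- @gue_potential R N x))%:E).
Let Zg_gt0 : 0 < Zg. Proof. exact: gue_normalization. Qed.
Let Zm : R := fine (\int[tuple_measure (@gue R N) m]_x (expR (- model_potential P x))%:E).

Let mgue : measurable_fun setT (fun x => Zg^-1 * expR (- @gue_potential R N x)).
Proof. by apply: measurable_funM => //; exact: measurable_expR_opp. Qed.

Let gue_ge0 x : 0 <= Zg^-1 * expR (- @gue_potential R N x).
Proof. by rewrite mulr_ge0 ?expR_ge0// invr_ge0 ltW. Qed.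

Let weightE x : expR (- model_potential P x) *
  \prod_(k < m) (Zg^-1 * expR (- @gue_potential R N (tnth x k))) = Zg^-1 ^+ m * weight x.
Proof.
rewrite big_split /= prodr_const card_ord mulrCA; congr (_ * _).
rewrite -expR_sum -expRD /weight (Re_upot V 0); congr expR.
rewrite /model_potential /trace_eval P_trace sumrN -opprD; congr (- _).
rewrite mulrDr [in RHS]/phi mul0r mul0r addr0; congr (_ + _).
by rewrite /gue_potential /sqnorm /herms subr0 -mulr_sumr mulrA mul1r.
Qed.

Let dens_gue : has_density mleb (tuple_measure (@gue R N) m)
  (EFin \o (fun x => \prod_(k < m) (Zg^-1 * expR (- @gue_potential R N (tnth x k))))).
Proof. exact: (has_density_tuple mgue gue_ge0 (has_density_gibbs _ _)). Qed.

Let ZmE : Zm = Zg^-1 ^+ m * partition.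
Proof.
rewrite /Zm dens_gue; last 2 first.
- by apply/measurable_EFinP; exact: measurable_expR_opp.
- by move=> x; rewrite lee_fin expR_ge0.
under eq_integral do rewrite /= -EFinM weightE EFinM.
rewrite ge0_integralZl ?lee_fin ?exprn_ge0 ?invr_ge0 ?(ltW Zg_gt0)//; last 2 first.
- by apply/measurable_EFinP; exact: measurable_weight (polyfun_upot V).
- by move=> x _; rewrite lee_fin expR_ge0.
by rewrite -(partitionE phi_convex a_lt1 lincoef_le1 N_gt0).
Qed.

(** The normalizing constants of the Gaussian factors cancel: that of the model over the GUE is
    [partition] divided by the [m]-th power of that of the GUE. *)
Lemma matrix_model_density :
  has_density mleb (matrix_model N P) (EFin \o (fun x => weight x / partition)).
Proof.
have Z0 : 0 < partition := partition_gt0 phi_convex a_lt1 lincoef_le1 N_gt0.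
have Zm0 : 0 <= Zm^-1.
  by rewrite invr_ge0 ZmE mulr_ge0 ?exprn_ge0 ?invr_ge0 ?ltW.
have ms : measurable_fun setT (fun x : T => Zm^-1 * expR (- model_potential P x)).
  by apply: measurable_funM => //; exact: measurable_expR_opp.
have s0 (x : T) : 0 <= Zm^-1 * expR (- model_potential P x) by rewrite mulr_ge0 ?expR_ge0.
have dm : has_density (tuple_measure (@gue R N) m) (matrix_model N P)
    (EFin \o (fun x => Zm^-1 * expR (- model_potential P x))).
  exact: has_density_gibbs.
have := has_density_comp ms s0 dens_gue dm.
move=> h f mf f0; rewrite h//; apply: eq_integral => x _ /=; congr (_ * _%:E)%E.
rewrite -mulrA weightE ZmE; field.
by rewrite !lt0r_neq0// exprn_gt0// invr_gt0.
Qed.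

Lemma matrix_model_Rintegral (g : T -> R) : measurable_fun setT g ->
  mleb.-integrable setT (EFin \o (fun x => g x * weight x)) ->
  \int[matrix_model N P]_x g x = (\int[mleb]_x (g x * weight x)) / partition.
Proof.
move=> mg ig; have Z0 : 0 < partition := partition_gt0 phi_convex a_lt1 lincoef_le1 N_gt0.
have r0 (x : T) : 0 <= weight x / partition by rewrite divr_ge0 ?expR_ge0// ltW.
have E := @integral_density _ _ _ mleb (matrix_model N P) _ g r0 mg matrix_model_density.
rewrite [LHS]/Rintegral E.
rewrite mulrC -(RintegralZl (partition^-1) measurableT ig) /Rintegral; congr fine.
by apply: eq_integral => x _; congr (_%:E); ring.
Qed.

End matrix_model_density.

Section hermitian_words.
Context {R : realType} {m N : nat}.
Notation C := R[i].
Notation T := (mentries R m N).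

Lemma wmx_rev (x : T) w i j : wmx (herms x) (rev w) i j = (wmx (herms x) w j i)^*.
Proof.
elim: w i j => [|k w ih] i j.
  by rewrite wmx_nil !mxE eq_sym rmorph_nat.
rewrite rev_cons -cats1 wmx_cat wmx_cons wmx_cons wmx_nil mulmx1.
have mulE (A B : 'M[C]_N) : (A *m B) i j = \sum_l A i l * B l j by rewrite mxE.
have mulE' (A B : 'M[C]_N) : (A *m B) j i = \sum_l A j l * B l i by rewrite mxE.
rewrite mulE mulE' rmorph_sum; apply: eq_bigr => l _.
rewrite rmorphM mulrC ih; congr (_ * _); rewrite /herms; exact: herm_conj.
Qed.

Lemma trace_wmx_rev (x : T) w : \tr (wmx (herms x) (rev w)) = (\tr (wmx (herms x) w))^*.
Proof. by rewrite /mxtrace rmorph_sum; apply: eq_bigr => i _; exact: wmx_rev. Qed.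

Lemma ntr_rev (x : T) w : ntr (herms x) (rev w) = (ntr (herms x) w)^*.
Proof. by rewrite /ntr trace_wmx_rev rmorphM fmorphV rmorph_nat. Qed.

Context {n : nat}.
Variables (q : 'I_n -> word m) (t : 'rV[R]_n) (a : R).
Local Notation V := (potential_terms q t).

(** A word and its reversal carry the same real coefficient and have conjugate traces. *)
Lemma vtrace_potential_real (x : T) : complex.Im (vtrace V (herms x)) = 0.
Proof.
rewrite /vtrace big_cat !big_map /= -big_split raddf_sum big1//= => j _.
rewrite trace_wmx_rev -mulrDr; case: (\tr _) => u v /=; ring.
Qed.

Lemma phi_convex_domain : convex_domain q a t -> forall s (x y : T), 0 <= s <= 1 ->
  phi V a (mconv s x y) <= s * phi V a x + (1 - s) * phi V a y.
Proof.
move=> /(_ N) cvx s x y /andP[s0 s1].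
pose mx (z : T) : 'I_m -> 'M[R]_N := fun k => \matrix_(i, j) tnth (tnth z k) (mxvec_index i j).
pose f (X : 'I_m -> 'M[R]_N) : R := trace_eval (potential q t) (fun k => hermitian_of (X k))
     + a / 2 * \sum_k trace_sqr (hermitian_of (X k)).
have phiE z : phi V a z = f (mx z).
  by rewrite /phi /f /trace_eval trace_nceval_potential.
have h : f (fun k => s *: mx x k + (1 - s) *: mx y k) <= s * f (mx x) + (1 - s) * f (mx y) :=
  cvx (Itv01 s0 s1) (mx x) (mx y) (in_setT _) (in_setT _).
rewrite !phiE; apply: le_trans h; rewrite le_eqVlt; apply/orP; left; apply/eqP.
congr f; apply/funext => k; apply/matrixP => i j.
by rewrite !mxE /mconv !tnth_mktuple.
Qed.

End hermitian_words.

(** * Size of the coefficients of the potential *)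

Section coefficient_bounds.
Context {R : realType} {m n : nat}.
Notation C := R[i].
Notation nc := (@Normc.normc R).
Variables (q : 'I_n -> word m) (t : 'rV[R]_n) (e : R).
Hypothesis t_le : forall j, `|t 0 j| <= e.
Local Notation V := (potential_terms q t).
Let D := \max_j size (q j).

Lemma sum_potential_terms_le (f : nat -> R) (c : R) : (forall j, f (size (q j)) <= c) ->
  0 <= c -> \sum_(cv <- V) nc cv.1 * f (size cv.2) <= 2 * n%:R * c * e.
Proof.
move=> fc c0; rewrite big_cat !big_map /= -big_split /=.
apply: (@le_trans _ _ (\sum_(j < n) (2 * c * e))).
  apply: ler_sum => j _.
  change (nc (t 0 j)%:C * f (size (q j)) + nc (t 0 j)%:C * f (size (rev (q j))) <= 2 * c * e).
  rewrite size_rev nc_real.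
  have := ler_wpM2l (normr_ge0 (t 0 j)) (fc j).
  by have := ler_wpM2r c0 (t_le j); lra.
by rewrite sumr_const card_ord -mulr_natr le_eqVlt; apply/orP; left; apply/eqP; ring.
Qed.

Lemma lincoef_potential : lincoef V <= 2 * n%:R * e.
Proof.
have := sum_potential_terms_le (f := fun=> 1) (c := 1) (fun=> lexx _) ler01.
rewrite mulr1; apply: le_trans; rewrite /lincoef big_mkcond; apply: ler_sum => cv _.
by rewrite mulr1; case: ifP => // _; exact: nc_ge0.
Qed.

Lemma size_splits_le i (w : word m) : (size (splits i w) <= size w)%N.
Proof.
elim: w => //= j w ih; rewrite size_cat size_map.
by case: ifP => _ /=; [rewrite add1n|rewrite add0n leqW].
Qed.

Lemma cyclic_terms_potential i :
  \sum_(cv <- cyclic_terms i V) nc cv.1 <= 2 * n%:R * D%:R * e.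
Proof.
apply: le_trans (sum_potential_terms_le (f := fun l => l%:R) (c := D%:R) _ _) => //.
  rewrite /cyclic_terms big_flatten big_map; apply: ler_sum => cv _.
  rewrite big_map /= big_const_seq count_predT iter_addr_0 -[leLHS]mulr_natr.
  by rewrite ler_wpM2l ?nc_ge0// ler_nat size_splits_le.
by move=> j; rewrite ler_nat; exact: (leq_bigmax (F := fun j => size (q j))).
Qed.

Lemma size_cyclic_terms_potential i cv : cv \in cyclic_terms i V -> (size cv.2 <= D)%N.
Proof.
move=> /flattenP[s /mapP[cw cwV ->]] /mapP[p ps ->] /=.
have -> : (size (p.2 ++ p.1) <= D)%N = (size p.1 + size p.2 <= D)%N.
  by rewrite size_cat addnC.
apply: (@leq_trans (size cw.2)); first by rewrite -(size_splits ps).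
have qD j : (size (q j) <= D)%N by exact: (leq_bigmax (F := fun j => size (q j))).
by move: cwV; rewrite mem_cat => /orP[] /mapP[j _ ->] /=; rewrite ?size_rev.
Qed.

End coefficient_bounds.

(** * The mean empirical distribution *)

Section mean_empirical_limit.
Context {R : realType} {m : nat}.
Notation C := R[i].
Notation nc := (@Normc.normc R).

Lemma tends_conj (x : nat -> C) l : tends x l -> tends (fun n => (x n)^*) l^*.
Proof.
by move=> xl e e0; have := xl e e0; apply: filterS => n; rewrite -rmorphB nc_conj.
Qed.

Lemma tends_cvg (x : nat -> C) (l : C) : tends x l ->
  (x n : R[i]^o) @[n --> \oo] --> (l : R[i]^o).
Proof.
move=> xl; apply/cvgrPdist_le => -[e e'] /= ee.
(* In the order of [R[i]] a positive radius has zero imaginary part. *)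
move: ee; rewrite ltcE /= => /andP[/eqP e'0 e0].
have := xl e e0; apply: filterS => n h; rewrite distrC.
by rewrite lecE /= e'0 eqxx.
Qed.

Variables (V : seq (C * word m)) (P : ncpoly R m) (a : R).
Hypothesis P_trace : forall N (A : 'I_m -> 'M[C]_N), \tr (nceval A P) = vtrace V A.
Hypothesis phi_convex : forall N s (x y : mentries R m N), 0 <= s <= 1 ->
  phi V a (mconv s x y) <= s * phi V a x + (1 - s) * phi V a y.
Hypothesis a_lt1 : a < 1.
Hypothesis lincoef_le1 : lincoef V <= 1.

Lemma mean_empiricalE N (Q : ncpoly R m) : (0 < N)%N ->
  mean_empirical P N Q = law (fun w => mean_moment V N [:: w]) Q.
Proof.
move=> N0.
have coer := upot_coercive (@phi_convex N) a_lt1 lincoef_le1.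
have d0 := delta_gt0 a_lt1 N0.
have ipn w : ispoly (fun x : mentries R m N => pntr (herms x) [:: w]).
  by exists (fun x H => dpntr (herms x) H [:: w]); exact: polyfun_pntr.
pose f w (x : mentries R m N) : C := mcoeff w Q * pntr (herms x) [:: w].
have pf w : ispoly (f w) by exact: ispolyZ.
have ie : ispoly (fun x : mentries R m N => \sum_(w <- msupp Q) f w x) by exact: ispoly_sum.
have empE : (fun x : mentries R m N => empirical (herms x) Q) =
    (fun x => \sum_(w <- msupp Q) f w x).
  apply/funext => x; rewrite /empirical /nceval raddf_sum mulr_sumr; apply: eq_bigr => w _.
  by rewrite /f /= mxtraceZ /pntr big_seq1 /ntr mulrCA.
have [Df /polyfun_measurable[m1 m2]] := ie.
have [i1 i2] := integrable_wint (polyfun_upot V) d0 coer ie.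
have E1 := matrix_model_Rintegral (@P_trace N) (@phi_convex N) a_lt1 lincoef_le1 N0 m1 i1.
have E2 := matrix_model_Rintegral (@P_trace N) (@phi_convex N) a_lt1 lincoef_le1 N0 m2 i2.
transitivity (wint (@upot R m N V) (fun x => \sum_(w <- msupp Q) f w x) / (@partition R m N V)%:C).
  rewrite /mean_empirical.
  have -> : (fun x : mentries R m N => complex.Re (empirical (herms x) Q)) =
     (fun x => complex.Re (\sum_(w <- msupp Q) f w x)).
    by apply/funext => x; rewrite -(congr1 (fun g => g x) empE).
  have -> : (fun x : mentries R m N => complex.Im (empirical (herms x) Q)) =
     (fun x => complex.Im (\sum_(w <- msupp Q) f w x)).
    by apply/funext => x; rewrite -(congr1 (fun g => g x) empE).
  rewrite E1 E2 /wint -fmorphV.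
  by apply/eqP; rewrite eq_complex /= !mulr0 subr0 add0r !eqxx.
rewrite (wint_sum (polyfun_upot V) d0 coer)// mulr_suml.
apply: eq_bigr => w _; rewrite (wintZ (polyfun_upot V) d0 coer)//.
by rewrite mulrA.
Qed.

Lemma mean_moment_rev N w : (0 < N)%N ->
  mean_moment V N [:: rev w] = (mean_moment V N [:: w])^*.
Proof.
move=> N0.
have coer := upot_coercive (@phi_convex N) a_lt1 lincoef_le1.
have d0 := delta_gt0 a_lt1 N0.
have ipn : ispoly (fun x : mentries R m N => pntr (herms x) [:: w]).
  by exists (fun x H => dpntr (herms x) H [:: w]); exact: polyfun_pntr.
have [i1 i2] := integrable_wint (polyfun_upot V) d0 coer ipn.
rewrite /mean_moment.
have -> : (fun x : mentries R m N => pntr (herms x) [:: rev w]) =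
    (fun x => (pntr (herms x) [:: w])^*).
  by apply/funext => x; rewrite /pntr !big_seq1 ntr_rev.
have -> : wint (@upot R m N V) (fun x => (pntr (herms x) [:: w])^*) =
    (wint (@upot R m N V) (fun x => pntr (herms x) [:: w]))^*.
  apply/eqP; rewrite /wint eq_complex /=; apply/andP; split; apply/eqP.
    by apply: eq_Rintegral => x _; case: (pntr _ _).
  rewrite -mulN1r -(RintegralZl (-1) measurableT i2).
  by apply: eq_Rintegral => x _; case: (pntr _ _) => u v /=; ring.
rewrite -fmorphV; move: (wint _ _) (@partition R m N V)^-1 => [u v] p.
by apply/eqP; rewrite eq_complex /=; apply/andP; split; apply/eqP; ring.
Qed.

Lemma tends_law (x : nat -> word m -> C) (t : word m -> C) (Q : ncpoly R m) :
  (forall w, tends (x ^~ w) (t w)) -> tends (fun n => law (x n) Q) (law t Q).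
Proof. by move=> xt; apply: tends_sum => w; exact: tendsZ. Qed.

End mean_empirical_limit.

Lemma row_norm_ge (R : realType) (n : nat) (t : 'rV[R]_n) j : `|t 0 j| <= `|t|.
Proof.
rewrite [leRHS]mx_normrE.
exact: (le_bigmax _ (fun ij : 'I_1 * 'I_n => `|t ij.1 ij.2|) (0, j)).
Qed.

Theorem theorem1p2 (R : realType) (m n : nat) (m_gt0 : (0 < m)%N)
    (n_gt0 : (0 < n)%N) (q : 'I_n -> word m) (a : R) (a_lt1 : a < 1)
    (r : R) (r_gt2 : 2 < r) :
  exists2 eps : R, 0 < eps &
    forall t : 'rV[R]_n, convex_domain q a t -> `|t| <= eps ->
      exists tau : {scalar ncpoly R m},
        [/\ schwinger_dyson (potential q t) tau,
            moments_bounded r tau,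
            (forall tau' : {scalar ncpoly R m},
               schwinger_dyson (potential q t) tau' ->
               moments_bounded r tau' -> tau' =1 tau) &
            forall P : ncpoly R m,
              (mean_empirical (potential q t) N P : R[i]^o) @[N --> \oo]
                --> (tau P : R[i]^o)].
Proof.
pose K := @mrate R m a; have K1 : 1 <= K := @mrate_ge1 R m a a_lt1.
have K0 : 0 <= K := le_trans ler01 K1.
(* Large enough at once for the contraction, for forms bounded by [r^|w|] and for the growth rate
   [K]. *)
pose rho : R := 12 + 4 * r + 4 * K.
pose D := \max_j size (q j).
have r0 : 0 < r by lra.
have kappa0 : 0 < 1 - 4 / r ^+ 2.
  by rewrite subr_gt0 ltr_pdivrMr ?exprn_gt0// mul1r; nra.
have rho0 : 0 <= rho by rewrite /rho; lra.
(* The sum of the three lower bounds on [1 / delta] required by [lincoef_le1], [small_rho] and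
   [small_r]. *)
pose Q : R := 1 + 16 * rho ^+ D + 2 * m%:R * r ^+ D / (1 - 4 / r ^+ 2).
have Q1 : 0 <= 16 * rho ^+ D by rewrite mulr_ge0// exprn_ge0.
have Q2 : 0 <= 2 * m%:R * r ^+ D / (1 - 4 / r ^+ 2).
  by rewrite divr_ge0 ?(ltW kappa0)// mulr_ge0 ?mulr_ge0// exprn_ge0// ltW.
have Q0 : 0 < Q by rewrite /Q; lra.
have nD0 : 0 < 2 * n%:R * D.+1%:R :> R by rewrite !mulr_gt0// ltr0n.
(* Each of the [2 * n] words has at most [D] splits, so the cyclic coefficients sum to at most
   [2 * n * D * eps]. The successor of [D] keeps the denominator positive when all words are empty,
   and also covers [lincoef <= 2 * n * eps]. *)
pose eps : R := (2 * n%:R * D.+1%:R * Q)^-1.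
have eps0 : 0 < eps by rewrite invr_gt0 mulr_gt0.
have epsE : 2 * n%:R * D.+1%:R * eps = Q^-1.
  rewrite /eps invfM mulrA mulfV ?mul1r// lt0r_neq0//.
exists eps => // t t_convex t_small.
have t_le j : `|t 0 j| <= eps by apply: le_trans t_small; exact: row_norm_ge.
set V := potential_terms q t.
have coef_le i : \sum_(cv <- cyclic_terms i V) Normc.normc cv.1 <= Q^-1.
  apply: le_trans (cyclic_terms_potential _ t_le i) _; rewrite -epsE.
  by rewrite ler_wpM2r ?(ltW eps0)// ler_wpM2l ?mulr_ge0// ler_nat.
have lincoef_le1 : lincoef V <= 1.
  apply: le_trans (lincoef_potential _ t_le) _.
  apply: (@le_trans _ _ Q^-1); last by rewrite invf_le1// /Q; lra.
  by rewrite -epsE ler_wpM2r ?(ltW eps0)// ler_peMr ?mulr_ge0// ler1n.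
have V_real N (x : mentries R m N) := vtrace_potential_real q t x.
have phi_convex N := phi_convex_domain (N := N) t_convex.
have rho12 : 12 <= rho by rewrite /rho; lra.
have small_rho : 16 * rho ^+ D * Q^-1 <= 1.
  by rewrite ler_pdivrMr// mul1r /Q; lra.
have small_r : 4 / r ^+ 2 + 2 * m%:R * Q^-1 * r ^+ D <= 1.
  rewrite -lerBrDl mulrAC ler_pdivrMr// -ler_pdivrMl// mulrC /Q; lra.
have rho_r : 4 * r <= rho by rewrite /rho; lra.
have rho_K : 4 * K <= rho by rewrite /rho; lra.
have M_empty : \forall N \near \oo, mean_moment V N [::] = 1.
  by exists 1%N => // N /= N0; exact: (mean_moment_empty phi_convex a_lt1 lincoef_le1).
have M_nil W : \forall N \near \oo, mean_moment V N ([::] :: W) = mean_moment V N W.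
  by exists 1%N => // N /= N0; exact: mean_moment_nil.
have [s [s1 sSD s_le s_unique s_lim]] := limit_law_exists r_gt2 rho12
  (@size_cyclic_terms_potential R m n q t) coef_le small_rho small_r rho_r K0 rho_K M_empty M_nil
  (mean_moment_near_bound V_real phi_convex a_lt1 lincoef_le1)
  (mean_moment_residual0 V_real phi_convex a_lt1 lincoef_le1).
pose tau : {scalar ncpoly R m} := law s.
have tauE w : tau (ncmonom w) = s w := law_monom s w.
exists tau; split.
- apply: schwinger_dyson_of_words => [|w|i v]; rewrite ?tauE//.
    (* Compatibility with the involution holds for the moments of each positive dimension and passes
       to the limit. *)
    apply: tends_unique (s_lim (rev w)) _.
    apply: tends_near (tends_conj (s_lim w)).
    exists 1%N => // N /= N0.
    by rewrite (mean_moment_rev phi_convex a_lt1 lincoef_le1).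
  transitivity (\sum_(p <- splits i v) s p.1 * s p.2).
    by apply: eq_bigr => p _; rewrite !tauE.
  by rewrite sSD; congr (_ + _); apply: eq_bigr => cv _; rewrite tauE.
- by move=> w; rewrite tauE lecR.
- move=> tau' /schwinger_dyson_words[tau'1 tau'SD] tau'_le P.
  rewrite scalar_law; congr (law _ P); apply/funext => w.
  have h u : Normc.normc (tau' (ncmonom u)) <= r ^+ size u by have := tau'_le u; rewrite lecR.
  exact: (s_unique (fun w => tau' (ncmonom w)) tau'1 tau'SD h w).
move=> P; apply: tends_cvg; apply: tends_near (tends_law P s_lim).
exists 1%N => // N /= N0; apply: esym.
apply: (mean_empiricalE _ phi_convex a_lt1 lincoef_le1) => // N' A.
exact: trace_nceval_potential.
Qed.
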